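(* Let $m>1$ be an integer, and let $u,z,s$ be complex numbers with $\Re u>0$ and such that either $z\in\mathbb{C}\setminus[1,\infty)$ and $\Re s>-m-1$, or $z=1$ and $\Re s>-m$. Then $$\int_{[0,1]^m}\frac{m-1-x_1-x_1x_2-\cdots-x_1x_2\cdots x_{m-1}}{1-z\,x_1x_2\cdots x_m}\,(x_1x_2\cdots x_m)^{u-1}\,\bigl(-\ln (x_1x_2\cdots x_m)\bigr)^s\,dx_1\cdots dx_m$$ $$=\frac{\Gamma(s+m)}{(m-2)!}\left[\Phi(z,s+m,u)+\frac{(1-z)\,\Phi(z,s+m-1,u)-u^{-s-m+1}}{z\,(s+m-1)}\right].$$
   Context: Complex powers are $\zeta^s=\exp(s\log\zeta)$ with $\log$ the principal branch of the logarithm; in particular $x^w=\exp(w\ln x)$ for real $x>0$. The Lerch transcendent $\Phi(z,s,u)$ is defined, for $\Re u>0$, as the analytic continuation of the series $\Phi(z,s,u)=\sum_{n\ge 0}\frac{z^n}{(u+n)^s}$, which converges for $\Re u>0$ if either $|z|<1$, or $|z|=1$ and $\Re s>1$. For fixed $u$ with $\Re u>0$, $\Phi$ is holomorphic in $z\in\mathbb{C}\setminus[1,\infty)$ and in all complex $s$. For $z=1$, $\Phi(1,s,u)$ denotes the analytic continuation in $s$ of $\sum_{n\ge0}(u+n)^{-s}$ (the Hurwitz zeta function), and the term $(1-z)\Phi(z,s+m-1,u)$ is $0$ when $z=1$. The right-hand side is understood as a holomorphic function on the stated domain: where the expression has a removable singularity (at $z=0$, at $s=1-m$, or at $s=-m$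 when $z\neq1$), it is interpreted by its limit (in $z$, respectively in $s$). *)

(* Defs.v *)
From HB Require Import structures.
From mathcomp Require Import all_boot all_order all_algebra.
From mathcomp Require Import complex.
From mathcomp Require Import all_classical all_reals all_analysis.

Set Implicit Arguments.
Unset Strict Implicit.
Unset Printing Implicit Defensive.

Import Order.TTheory GRing.Theory Num.Theory.
Import numFieldNormedType.Exports.

Local Open Scope classical_set_scope.
Local Open Scope ring_scope.
Local Open Scope complex_scope.

Section lebesgue_measure_on_tuples.
Context {R : realType}.
Local Notation T := (measurableTypeR R).

Definition cons_pair n (p : T * n.-tuple T) : n.+1.-tuple T :=
  [the n.+1.-tuple T of p.1 :: p.2].

Definition uncons_pair n (x : n.+1.-tuple T) : T * n.-tuple T :=
  (thead x, [tuple of behead x]).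

Lemma cons_pairK n : cancel (@cons_pair n) (@uncons_pair n).
Proof. by move=> [a t]; congr pair; apply: val_inj. Qed.

Lemma measurable_cons_pair n :
  measurable_fun [set: T * n.-tuple T] (@cons_pair n).
Proof. exact: (measurable_cons measurable_fst measurable_snd). Qed.

Lemma measurable_uncons_pair n :
  measurable_fun [set: n.+1.-tuple T] (@uncons_pair n).
Proof.
by apply/measurable_fun_pair; [exact: measurable_tnth|exact: measurable_behead].
Qed.

Section cons_measure.
Variables (n : nat) (mu : {sigma_finite_measure set (n.-tuple T) -> \bar R}).

Definition cons_measure : set (n.+1.-tuple T) -> \bar R :=
  pushforward (@lebesgue_measure R \x mu)%E (@cons_pair n).

Let cons_measure0 : cons_measure set0 = 0%E.
Proof. by rewrite /cons_measure /pushforward preimage_set0 measure0. Qed.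

Let cons_measure_ge0 A : (0 <= cons_measure A)%E.
Proof. by rewrite /cons_measure /pushforward measure_ge0. Qed.

Let cons_measure_sigma_additive : semi_sigma_additive cons_measure.
Proof.
exact: (@measure_semi_sigma_additive _ _ _
  (measure_function_pushforward__canonical__measure_function_Measure
    _ (measurable_cons_pair (n := n)))).
Qed.

HB.instance Definition _ := isMeasure.Build _ _ _ cons_measure
  cons_measure0 cons_measure_ge0 cons_measure_sigma_additive.

Let cons_measure_sigma_finite : sigma_finite setT cons_measure.
Proof.
have /sigma_finiteP[F [TF ndF Foo]] := sigma_finiteT (@lebesgue_measure R).
have /sigma_finiteP[G [TG ndG Goo]] := sigma_finiteT mu.
exists (fun k => @uncons_pair n @^-1` (F k `*` G k)).
  apply/seteqP; split => // x _.
  have [i _ Fi] : (\bigcup_k F k) (thead x) by rewrite -TF.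
  have [j _ Gj] : (\bigcup_k G k) [tuple of behead x] by rewrite -TG.
  exists (maxn i j) => //; split => /=.
  - by move: Fi; exact/subsetPset/ndF/leq_maxl.
  - by move: Gj; exact/subsetPset/ndG/leq_maxr.
move=> k; have [mFk Fkoo] := Foo k; have [mGk Gkoo] := Goo k; split.
  rewrite -[X in measurable X]setTI; apply: measurable_uncons_pair => //.
  exact: measurableX.
rewrite /cons_measure /pushforward -comp_preimage.
rewrite (_ : _ \o _ = id); last by apply/funext => p; exact: cons_pairK.
by rewrite preimage_id product_measure1E// lte_mul_pinfty// ge0_fin_numE.
Qed.

HB.instance Definition _ := Measure_isSigmaFinite.Build _ _ _ cons_measure
  cons_measure_sigma_finite.

End cons_measure.

(* Lebesgue measure on R^n: the n-fold product of the Lebesgue measure on R. *)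
Fixpoint lebesgue_tuple n : {sigma_finite_measure set (n.-tuple T) -> \bar R} :=
  if n is k.+1 then cons_measure (lebesgue_tuple k)
  else \d_([tuple] : 0.-tuple T).

Lemma lebesgue_tuple_box n (A : 'I_n -> set T) :
  (forall i, measurable (A i)) ->
  lebesgue_tuple n [set x | forall i, A i (tnth x i)] =
  (\prod_(i < n) lebesgue_measure (A i))%E.
Proof.
elim: n A => [|n IH] A mA.
  rewrite big_ord0 /= diracE mem_set//= => -[]//.
rewrite big_ord_recl /= /cons_measure /pushforward.
rewrite -IH//.
have mB : measurable [set x : n.-tuple T | forall i, A (lift ord0 i) (tnth x i)].
  rewrite (_ : mkset _ = \bigcap_(i in [set: 'I_n])
      ((fun x : n.-tuple T => tnth x i) @^-1` A (lift ord0 i))); last first.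
    by apply/seteqP; split => x /= H i; [move=> _|]; exact: H.
  apply: fin_bigcap_measurable => // i _.
  by rewrite -[X in measurable X]setTI; exact: measurable_tnth.
rewrite -[RHS]product_measure1E//; congr product_measure1.
apply/seteqP; split => -[a t] /= H.
  by split => [|i]; [have := H ord0|have := H (lift ord0 i)]; rewrite ?tnthS.
by move=> i; case: (unliftP ord0 i) => [j ->|->]; rewrite ?tnthS; apply H.
Qed.

End lebesgue_measure_on_tuples.

Section complex_functions.
Context {R : realType}.
Local Notation C := R[i].
Local Notation Re := (@complex.Re R).
Local Notation Im := (@complex.Im R).

Definition cexp (z : C) : C := (expR (Re z))%:C * (cos (Im z) +i* sin (Im z)).

(* The principal argument, in `]-pi, pi] for z != 0. *)
Definition carg (z : C) : R :=
  let t := acos (Re z / Re `|z|) in if 0 <= Im z then t else - t.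

Definition clog (z : C) : C := ln (Re `|z|) +i* carg z.

(* Meaningful for z != 0 only. *)
Definition cpow (z s : C) : C := cexp (s * clog z).

Definition cintegrable d (T : measurableType d)
    (mu : {measure set T -> \bar R}) (D : set T) (f : T -> C) : Prop :=
  mu.-integrable D (EFin \o (fun x => Re (f x))) /\
  mu.-integrable D (EFin \o (fun x => Im (f x))).

Definition cintegral d (T : measurableType d)
    (mu : {measure set T -> \bar R}) (D : set T) (f : T -> C) : C :=
  (\int[mu]_(x in D) Re (f x)) +i* (\int[mu]_(x in D) Im (f x)).

(* Euler's integral for 0 < Re z, where n = 0; elsewhere its continuation by
   Gamma(z) = Gamma(z + n) / (z (z + 1) ... (z + n - 1)) with the least n such
   that 0 < Re z + n. *)
Definition cGamma (z : C) : C :=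
  let n := Num.truncn (1 - Re z) in
  cintegral (@lebesgue_measure R) `]0, +oo[%classic
    (fun t => cpow t%:C (z + n%:R - 1) * (expR (- t))%:C)
  / \prod_(k < n) (z + k%:R).

Definition analytic_on (U : set C) (f : C -> C) : Prop :=
  forall z0, U z0 -> exists (r : R) (a : nat -> C), 0 < r /\
    forall z, `|z - z0| < r%:C ->
      (series (fun n => a n * (z - z0) ^+ n) : nat -> C^o) @ \oo --> (f z : C^o).

(* The complex plane cut along [1, +oo[. *)
Definition cut_plane : set C := [set z | ~ (Im z = 0 /\ 1 <= Re z)].

(* [Phi z s u] is the Lerch transcendent: for 0 < Re u it is given by the series
   where that converges, and elsewhere by analytic continuation: in z to the cut
   plane and in s to the complex plane, or, on z = 1, in s to s != 1. *)
Definition is_lerch (Phi : C -> C -> C -> C) : Prop :=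
  forall u : C, 0 < Re u ->
  [/\ forall z s : C, `|z| < 1 \/ (`|z| = 1 /\ 1 < Re s) ->
        (series (fun n => z ^+ n / cpow (u + n%:R) s) : nat -> C^o) @ \oo -->
          (Phi z s u : C^o),
      forall s, analytic_on cut_plane (fun z => Phi z s u),
      forall z, cut_plane z -> analytic_on setT (fun s => Phi z s u) &
      analytic_on [set s | s != 1] (fun s => Phi 1 s u) ].

Definition unit_cube m : set (m.-tuple (measurableTypeR R)) :=
  [set x | forall i, 0 <= tnth x i <= 1].

Definition integrand m (u z s : C) (x : m.-tuple (measurableTypeR R)) : C :=
  let p : R := \prod_(i < m) tnth x i in
  ((m%:R - 1 - \sum_(1 <= k < m) \prod_(i < m | (i < k)%N) tnth x i) : R)%:C
  / (1 - z * p%:C) * cpow p%:C (u - 1) * cpow (- ln p)%:C s.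

Definition rhs_expr (Phi : C -> C -> C -> C) m (u z s : C) : C :=
  cGamma (s + m%:R) / ((m - 2)`!)%:R *
  (Phi z (s + m%:R) u +
   ((1 - z) * Phi z (s + m%:R - 1) u - cpow u (- s - m%:R + 1))
   / (z * (s + m%:R - 1))).

(* [v] is the value of [rhs_expr] with the singularity at z = 0 removed. *)
Definition rhs_value_z (Phi : C -> C -> C -> C) m (u z s v : C) : Prop :=
  if z == 0 then (rhs_expr Phi m u z' s : C^o) @[z' --> (0 : C^o)^'] --> (v : C^o)
  else v = rhs_expr Phi m u z s.

(* [v] is the value of [rhs_expr] with all singularities removed. *)
Definition rhs_value (Phi : C -> C -> C -> C) m (u z s v : C) : Prop :=
  if (s == 1 - m%:R) || (s == - m%:R) then
    exists2 g : C^o -> C^o,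
      \forall s' \near (s : C^o)^', rhs_value_z Phi m u z s' (g s') &
      g s' @[s' --> (s : C^o)^'] --> (v : C^o)
  else rhs_value_z Phi m u z s v.

End complex_functions.

Arguments unit_cube {R} m.
Arguments integrand {R} m u z s.

(* Main.v *)
(* Under y = x_1 ... x_m, the weight m - 1 - x_1 - ... - x_1 ... x_{m-1} pushes
   the Lebesgue measure of the cube forward to
   (- ln y) ^ (m - 2) / (m - 2)! * (y - 1 - ln y) dy on ]0, 1[
   (induction on m and Tonelli). With y = exp (- t) the integral becomes 1 / (m - 2)!
   times the Mellin-type integral J(z, s + m), where
     J(z, w) = \int_0^oo t ^ (w - 2) (t - 1 + exp (- t)) exp (- u t)
                 / (1 - z exp (- t)) dt.
   Since t - 1 + exp (- t) is O(t ^ 2) at 0, this converges for -1 < Re w when z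
   is in the cut plane, and for 0 < Re w when z = 1. For |z| < 1 or z = 1 and
   2 < Re w, expanding the geometric series gives
     z w (w - 1) J(z, w) = Gamma(w + 1)
       (z (w - 1) Phi(z, w, u) + (1 - z) Phi(z, w - 1, u) - u ^ (1 - w)).
   Both sides are analytic in z and in w, so this persists by the identity theorem
   along segments, first in z and then in w. Finally J is continuous, so it gives
   the limits at z = 0, w = 0 and w = 1. *)

Require Import Defs.
From mathcomp Require Import all_boot all_order all_algebra.
From mathcomp Require Import complex.
From mathcomp Require Import all_classical all_reals all_analysis.
From mathcomp Require Import measurable_realfun.
From mathcomp Require Import ring lra.

Set Implicit Arguments.
Unset Strict Implicit.
Unset Printing Implicit Defensive.

Import Order.TTheory GRing.Theory Num.Theory.
Import numFieldNormedType.Exports.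
Import Normc.

Local Open Scope classical_set_scope.
Local Open Scope ring_scope.
Local Open Scope complex_scope.

Local Notation normc := (@Normc.normc _).
Local Notation Re := (@complex.Re _).
Local Notation Im := (@complex.Im _).

(** * Complex numbers, series and analytic functions *)

(** Analytic means locally the sum of a power series, so the complex analysis rests on power series
    alone: Cauchy products for closure, accumulating zeros for the identity theorem, dominated
    term-by-term integration for integrals with a parameter. Quotients are avoided: the identity for
    J stays multiplied by z w (w - 1), and Gamma(w + 1) stands in place of Gamma(w), because its
    Euler integral is analytic on all of -1 < Re w. The division takes place only at the end, away
    from the exceptional values. The bound 2 < Re w makes the series of Phi(z, w - 1, u) converge at
    z = 1 too. That point lies outside the cut plane, so it has its own continuation in w; there 1 -
    exp (- t) vanishes at t = 0 and costs J one power of t. Since u is complex, the terms of the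
    expansion are Euler integrals with a complex decay rate v. Their value Gamma(a) v ^ (- a), with
    the principal power, is [mellin_cdecay]. *)

Section complex_basics.
Context {R : realType}.
Implicit Types (x y z w : R[i]) (a b t : R).

Lemma complex_eqP x y : Re x = Re y -> Im x = Im y -> x = y.
Proof. by case: x y => [a b] [c d] /= -> ->. Qed.

Lemma ReD x y : Re (x + y) = Re x + Re y. Proof. by case: x y => [? ?] []. Qed.
Lemma ImD x y : Im (x + y) = Im x + Im y. Proof. by case: x y => [? ?] []. Qed.
Lemma ReN x : Re (- x) = - Re x. Proof. by case: x. Qed.
Lemma ImN x : Im (- x) = - Im x. Proof. by case: x. Qed.
Lemma ReM x y : Re (x * y) = Re x * Re y - Im x * Im y.
Proof. by case: x y => [? ?] []. Qed.
Lemma ImM x y : Im (x * y) = Re x * Im y + Im x * Re y.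
Proof. by case: x y => [? ?] []. Qed.
Lemma Re_nat n : Re (n%:R : R[i]) = n%:R.
Proof. by elim: n => // n IH; rewrite !mulrS ReD IH. Qed.
Lemma Im_nat n : Im (n%:R : R[i]) = 0.
Proof. by elim: n => // n IH; rewrite mulrS ImD IH addr0. Qed.
Lemma natC n : (n%:R : R[i]) = (n%:R : R)%:C.
Proof. by apply: complex_eqP; rewrite ?Re_nat ?Im_nat. Qed.

Definition cReE := (ReD, ImD, ReN, ImN, ReM, ImM, Re_nat, Im_nat).

Lemma RealCM a b : (a * b)%:C = a%:C * b%:C :> R[i]. Proof. exact: rmorphM. Qed.
Lemma RealCD a b : (a + b)%:C = a%:C + b%:C :> R[i]. Proof. exact: rmorphD. Qed.
Lemma RealCN a : (- a)%:C = - a%:C :> R[i]. Proof. exact: rmorphN. Qed.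
Lemma RealCV a : (a^-1)%:C = (a%:C)^-1 :> R[i]. Proof. exact: fmorphV. Qed.
Lemma RealCX a n : (a ^+ n)%:C = a%:C ^+ n :> R[i]. Proof. exact: rmorphXn. Qed.

Lemma normE z : `|z| = (normc z)%:C. Proof. by case: z. Qed.
Lemma Re_norm z : Re `|z| = normc z. Proof. by rewrite normE. Qed.
Lemma normcE z : normc z = Num.sqrt (Re z ^+ 2 + Im z ^+ 2). Proof. by case: z. Qed.
Lemma normc_ge0 z : 0 <= normc z. Proof. by rewrite normcE sqrtr_ge0. Qed.
Lemma normc_sqr z : normc z ^+ 2 = Re z ^+ 2 + Im z ^+ 2.
Proof. by rewrite normcE sqr_sqrtr// addr_ge0// sqr_ge0. Qed.
Lemma normcD x y : normc (x + y) <= normc x + normc y.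
Proof. by rewrite -lecR RealCD -!normE ler_normD. Qed.
Lemma normc_opp x : normc (- x) = normc x.
Proof. by rewrite !normcE !cReE !sqrrN. Qed.
Lemma normcB x y : normc (x - y) = normc (y - x).
Proof. by rewrite -normc_opp opprB. Qed.
Lemma normc_eq0 z : (normc z == 0) = (z == 0).
Proof. by apply/eqP/eqP => [/eq0_normc|->]; rewrite ?normc0. Qed.
Lemma normc_gt0 z : (0 < normc z) = (z != 0).
Proof. by rewrite lt_def normc_eq0 normc_ge0 andbT. Qed.
Lemma normcX z n : normc (z ^+ n) = normc z ^+ n.
Proof. by elim: n => [|n IH]; rewrite ?normc1// !exprS normcM IH. Qed.
Lemma normc_real a : normc a%:C = `|a|.
Proof. by rewrite normcE /= expr0n addr0 sqrtr_sqr. Qed.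
Lemma normc_nat n : normc (n%:R : R[i]) = n%:R.
Proof. by rewrite natC normc_real normr_nat. Qed.
Lemma Re_le_normc z : `|Re z| <= normc z.
Proof. by rewrite normcE -sqrtr_sqr ler_wsqrtr// lerDl sqr_ge0. Qed.
Lemma Im_le_normc z : `|Im z| <= normc z.
Proof. by rewrite normcE -sqrtr_sqr ler_wsqrtr// lerDr sqr_ge0. Qed.
Lemma normc_le z : normc z <= `|Re z| + `|Im z|.
Proof.
rewrite -(@ler_pXn2r _ 2) ?nnegrE ?normc_ge0 ?addr_ge0//.
have := mulr_ge0 (normr_ge0 (Re z)) (normr_ge0 (Im z)).
by rewrite normc_sqr sqrrD !real_normK ?num_real// mulr2n; lra.
Qed.
Lemma normc_sum I (r : seq I) (P : pred I) (F : I -> R[i]) :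
  normc (\sum_(i <- r | P i) F i) <= \sum_(i <- r | P i) normc (F i).
Proof.
apply: (big_ind2 (fun z a => normc z <= a)); rewrite ?normc0// => z a w b za wb.
by rewrite (le_trans (normcD _ _))// lerD.
Qed.
Lemma Re_sum (F : nat -> R[i]) n :
  Re (\sum_(0 <= i < n) F i) = \sum_(0 <= i < n) Re (F i).
Proof. by elim: n => [|n IH]; [by rewrite !big_geq|rewrite !big_nat_recr//=]; rewrite ReD IH. Qed.
Lemma Im_sum (F : nat -> R[i]) n :
  Im (\sum_(0 <= i < n) F i) = \sum_(0 <= i < n) Im (F i).
Proof. by elim: n => [|n IH]; [by rewrite !big_geq|rewrite !big_nat_recr//=]; rewrite ImD IH. Qed.

(** The norm of [R[i]] takes its values in [R[i]], so an epsilon is a complex number. Being positive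
    forces it to be real, which moves convergence to the real-valued [normc]. *)
Lemma cvgC_normP {T : Type} (F : set_system T) {FF : Filter F} (f : T -> R[i]) (l : R[i]) :
  (f x : R[i]^o) @[x --> F] --> (l : R[i]^o) <->
  normc (f x - l) @[x --> F] --> (0 : R).
Proof.
split=> [/cvgrPdist_le H|/cvgrPdist_le H]; apply/cvgrPdist_le => e e0.
  have e0' : 0 < e%:C by rewrite ltcR.
  have := H _ e0'; apply: filterS => x; rewrite normE lecR normcB => h.
  by rewrite sub0r normrN ger0_norm ?normc_ge0.
have e0' : e = (Re e)%:C.
  by apply: complex_eqP => //=; move: e0; rewrite ltcE => /andP[/eqP ->].
have {}e0 : 0 < Re e by move: e0; rewrite {1}e0' ltcR.
have := H _ e0; apply: filterS => x; rewrite sub0r normrN ger0_norm ?normc_ge0// => h.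
by rewrite e0' normE lecR normcB.
Qed.

Lemma cvg_norm_squeeze {T : Type} (F : set_system T) {FF : Filter F} (f g : T -> R) (l : R) :
  (\forall x \near F, `|f x - l| <= g x) -> g x @[x --> F] --> (0 : R) ->
  f x @[x --> F] --> l.
Proof.
move=> fg g0; apply/subr_cvg0; apply: norm_cvg0.
apply: (squeeze_cvgr _ (cvg_cst 0) g0).
by apply: filterS fg => x H; rewrite normr_ge0.
Qed.

Lemma cvgC_ReImP {T : Type} (F : set_system T) {FF : Filter F} (f : T -> R[i]) (l : R[i]) :
  (f x : R[i]^o) @[x --> F] --> (l : R[i]^o) <->
  (Re (f x) @[x --> F] --> Re l) /\ (Im (f x) @[x --> F] --> Im l).
Proof.
split=> [/cvgC_normP H|[H1 H2]].
  split; apply: (cvg_norm_squeeze _ H); apply: nearW => x.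
    by rewrite -ReN -ReD Re_le_normc.
  by rewrite -ImN -ImD Im_le_normc.
apply/cvgC_normP.
apply: (@cvg_norm_squeeze _ _ _ _ (fun i => `|Re (f i) - Re l| + `|Im (f i) - Im l|)).
  apply: nearW => x; rewrite subr0 ger0_norm ?normc_ge0//.
  by rewrite -ReN -ReD -ImN -ImD normc_le.
rewrite -[0](addr0 (0:R)) -{1}(normr0 R) -{2}(normr0 R).
by apply: cvgD; apply: cvg_norm; apply/subr_cvg0.
Qed.

Lemma cvgC_cst {T : Type} (F : set_system T) {FF : Filter F} (l : R[i]) :
  ((fun=> l) x : R[i]^o) @[x --> F] --> (l : R[i]^o).
Proof. exact: cvg_cst. Qed.

Lemma cvgC_D {T : Type} (F : set_system T) {FF : Filter F} (f g : T -> R[i]) l k :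
  (f x : R[i]^o) @[x --> F] --> (l : R[i]^o) ->
  (g x : R[i]^o) @[x --> F] --> (k : R[i]^o) ->
  (f x + g x : R[i]^o) @[x --> F] --> (l + k : R[i]^o).
Proof. exact: cvgD. Qed.

Lemma cvgC_M {T : Type} (F : set_system T) {FF : Filter F} (f g : T -> R[i]) l k :
  (f x : R[i]^o) @[x --> F] --> (l : R[i]^o) ->
  (g x : R[i]^o) @[x --> F] --> (k : R[i]^o) ->
  (f x * g x : R[i]^o) @[x --> F] --> (l * k : R[i]^o).
Proof. exact: cvgM. Qed.

Lemma cvgC_unique {T : Type} (F : set_system T) {FF : ProperFilter F} (f : T -> R[i]) l k :
  (f x : R[i]^o) @[x --> F] --> (l : R[i]^o) ->
  (f x : R[i]^o) @[x --> F] --> (k : R[i]^o) -> l = k.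
Proof.
move=> H1 H2; apply: (cvg_unique _ H1 H2).
exact: (@norm_hausdorff _ R[i]^o).
Qed.

Lemma cexpD z w : cexp (z + w) = cexp z * cexp w.
Proof.
rewrite /cexp !cReE expRD RealCM.
rewrite -[RHS]mulrACA; congr (_ * _).
by apply: complex_eqP; rewrite ?cReE /= ?cosD ?sinD//; ring.
Qed.

Lemma cexp_real a : cexp a%:C = (expR a)%:C.
Proof. by rewrite /cexp /= cos0 sin0 mulr1. Qed.

Lemma cexp0 : cexp (0 : R[i]) = 1.
Proof. by rewrite cexp_real expR0. Qed.

Lemma Re_cexp z : Re (cexp z) = expR (Re z) * cos (Im z).
Proof. by rewrite /cexp ReM /= mul0r subr0. Qed.
Lemma Im_cexp z : Im (cexp z) = expR (Re z) * sin (Im z).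
Proof. by rewrite /cexp ImM /= mul0r addr0. Qed.

Lemma normc_cexp z : normc (cexp z) = expR (Re z).
Proof.
rewrite /cexp normcM normc_real [X in _ * X]normcE /= cos2Dsin2 sqrtr1 mulr1.
by rewrite ger0_norm ?expR_ge0.
Qed.

Lemma cexp_neq0 z : cexp z != 0.
Proof. by rewrite -normc_eq0 normc_cexp gt_eqF// expR_gt0. Qed.

Lemma cexpN z : cexp (- z) = (cexp z)^-1.
Proof.
apply: (mulfI (cexp_neq0 z)); rewrite -cexpD subrr cexp0 mulfV//.
exact: cexp_neq0.
Qed.

Lemma clog_real t : 0 < t -> clog t%:C = (ln t)%:C.
Proof.
move=> t0; rewrite /clog /carg lexx !Re_norm normc_real gtr0_norm//.
by rewrite divff ?gt_eqF// acos1.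
Qed.

Lemma cpow_real t w : 0 < t -> cpow t%:C w = cexp (w * (ln t)%:C).
Proof. by move=> t0; rewrite /cpow clog_real. Qed.

Lemma Re_norm_bnd z : z != 0 -> -1 <= Re z / Re `|z| <= 1.
Proof.
move=> z0; rewrite Re_norm -ler_norml normrM normfV.
rewrite [X in _ / X]ger0_norm ?normc_ge0// ler_pdivrMr ?normc_gt0// mul1r.
exact: Re_le_normc.
Qed.

(** With x = Re z / |z|, the sine of [acos x] is sqrt (1 - x ^ 2) = |Im z| / |z|; the sign test in
    [carg] restores the sign of Im z. *)
Lemma cexp_clog z : z != 0 -> cexp (clog z) = z.
Proof.
move=> z0; have nz : 0 < normc z by rewrite normc_gt0.
have B := Re_norm_bnd z0; have [/andP[a0 api] ca] := acos_def B.
have sa := sin_acos B; rewrite /cexp /clog /= lnK ?posrE ?Re_norm//=.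
have E : (Im z / normc z) ^+ 2 = 1 - (Re z / normc z) ^+ 2.
  rewrite !expr_div_n normc_sqr; field.
  by rewrite -normc_sqr expf_neq0// gt_eqF.
rewrite /carg !Re_norm in sa ca a0 api B *.
rewrite -E sqrtr_sqr normrM normfV (gtr0_norm nz) in sa.
have [I0|I0] := leP 0 (Im z).
  rewrite ca sa ger0_norm//; apply: complex_eqP; rewrite ?cReE /=.
    by field; rewrite gt_eqF.
  by field; rewrite gt_eqF.
rewrite cosN sinN ca sa ltr0_norm//; apply: complex_eqP; rewrite ?cReE /=.
  by field; rewrite gt_eqF.
by field; rewrite gt_eqF.
Qed.

(** The cosine of the argument is Re z / |z| > 0, and cos decreases on [0, pi]. This keeps the
    powers v ^ x, 0 <= x <= 1, in the right half-plane. *)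
Lemma Im_clog_lt z : 0 < Re z -> `|Im (clog z)| < pi / 2.
Proof.
move=> rz; have z0 : z != 0 by apply: contraTneq rz => ->; rewrite /= ltxx.
have B := Re_norm_bnd z0; have [/andP[a0 api] ca] := acos_def B.
have L : acos (Re z / Re `|z|) < pi / 2.
  rewrite ltNge; apply/negP => H.
  have : cos (acos (Re z / Re `|z|)) <= 0.
    rewrite -cos_pihalf leNgt; apply/negP => C.
    have := @ltr_cos R; move: H C; rewrite le_eqVlt => /orP[/eqP->|H C].
      by rewrite ltxx.
    move=> lc; move: C; rewrite lc ?in_itv/= ?a0 ?api//.
      by rewrite ltNge (ltW H).
    by rewrite divr_ge0 ?pi_ge0//= ler_pdivrMr// ler_pMr ?pi_gt0// ler1n.
  by rewrite ca leNgt divr_gt0// Re_norm normc_gt0.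
rewrite /clog /= /carg; case: ifP => _; rewrite ?normrN ger0_norm//.
Qed.

End complex_basics.

(** * Series of complex numbers and Cauchy products *)

Section complex_series.
Context {R : realType}.
Local Notation C := R[i].
Implicit Types (a b : nat -> C).

Definition csum a (l : C) : Prop :=
  (series a : nat -> C^o) @ \oo --> (l : C^o).

Lemma csumD a b l k : csum a l -> csum b k -> csum (fun n => a n + b n) (l + k).
Proof.
move=> al bk; rewrite /csum (_ : series _ = fun n => series a n + series b n).
  by apply: cvgC_D al bk.
by apply/funext => n; rewrite /series /= big_split.
Qed.

Lemma csumZ a c l : csum a l -> csum (fun n => c * a n) (c * l).
Proof.
move=> al; rewrite /csum (_ : series _ = fun n => c * series a n).
  by apply: cvgC_M al; exact: cvgC_cst.
by apply/funext => n; rewrite /series /= mulr_sumr.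
Qed.

Lemma csum_unique a l k : csum a l -> csum a k -> l = k.
Proof. exact: cvgC_unique. Qed.

Lemma csum_ReImP a l : csum a l <->
  (series (fun n => Re (a n)) @ \oo --> Re l) /\
  (series (fun n => Im (a n)) @ \oo --> Im l).
Proof.
rewrite (_ : series (fun n => Re (a n)) = fun n => Re (series a n)); last first.
  by apply/funext => n; rewrite /series /= Re_sum.
rewrite (_ : series (fun n => Im (a n)) = fun n => Im (series a n)); last first.
  by apply/funext => n; rewrite /series /= Im_sum.
exact: (cvgC_ReImP (F := \oo) (series a)).
Qed.

Lemma csum_bounded a l : csum a l -> exists M : R, 0 < M /\ forall n, normc (a n) <= M.
Proof.
move=> /cvgC_normP /cvgr0_norm_le H.
have [N _ HN] := H 1 ltr01.
(* [M] bounds every partial sum: the finite sum covers the indices below [N], and 1 + |l| the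
   others. A term is a difference of two partial sums, whence the bound [M + M]. *)
pose M := 1 + normc l + \sum_(0 <= k < N) normc (series a k).
have S0 k : 0 <= \sum_(0 <= k < k) normc (series a k).
  by apply: sumr_ge0 => ? _; exact: normc_ge0.
have HM n : normc (series a n) <= M.
  have [nN|Nn] := ltnP n N.
    rewrite /M; have := normc_ge0 l.
    suff : normc (series a n) <= \sum_(0 <= k < N) normc (series a k) by lra.
    rewrite (@big_cat_nat _ _ _ n.+1)//= big_nat_recr//=.
    have := S0 n.
    have : 0 <= \sum_(n.+1 <= i < N) normc (series a i).
      by apply: sumr_ge0 => ? _; exact: normc_ge0.
    by lra.
  have := HN n Nn; rewrite /= ger0_norm ?normc_ge0// => h.
  have := normcD (series a n - l) l; rewrite subrK /M.
  by have := S0 N; lra.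
exists (M + M); split.
  have := normc_ge0 l; have := S0 N; rewrite /M; lra.
move=> n; rewrite -(seriesSB a n).
by have := normcD (series a n.+1) (- series a n); rewrite normc_opp; have := HM n; have := HM n.+1; lra.
Qed.

Lemma series_abs_cvg (u : nat -> R) (B : R) : (forall n, 0 <= u n) ->
  (forall n, series u n <= B) -> exists l, series u @ \oo --> l /\ l <= B.
Proof.
move=> u0 uB; have c : cvgn (series u).
  apply: nondecreasing_is_cvgn; last by exists B => _ [n _ <-].
  by apply/nondecreasing_seqP => n; rewrite seriesSr lerDl.
exists (limn (series u)); split => //.
by apply: limr_le => //; apply: nearW.
Qed.

Definition cconv a b n : C := \sum_(0 <= i < n.+1) a i * b (n - i)%N.

Lemma series_cconv a b n :
  series (cconv a b) n = \sum_(0 <= i < n) a i * series b (n - i)%N.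
Proof.
elim: n => [|n IH]; first by rewrite /series /= !big_geq.
rewrite seriesSr IH /cconv !big_nat_recr//= subnn subSnn.
rewrite seriesSr; rewrite [series b 0]/series /= [\sum_(0 <= k < 0) _]big_geq// add0r addrA; congr (_ + _).
rewrite -big_split /= !big_nat; apply: eq_bigr => i /andP[_ ni].
by rewrite -mulrDr subSn 1?ltnW// seriesSr.
Qed.

(** [KA] and [KB] express absolute convergence. The product of the partial sums minus the partial
    sum of the convolution is the sum over i < n of a_i times (b_(n-i) + ... + b_(n-1)). For i < n/2
    the second factor is part of the tail of b beyond n/2; for i >= n/2 the a_i themselves form a
    tail. *)
Lemma cauchy_product a b A B (KA KB : R) : csum a A -> csum b B ->
  (forall n, series (normc \o a) n <= KA) -> (forall n, series (normc \o b) n <= KB) ->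
  csum (cconv a b) (A * B).
Proof.
move=> aA bB aK bK.
have a0 n : 0 <= (normc \o a) n by exact: normc_ge0.
have b0 n : 0 <= (normc \o b) n by exact: normc_ge0.
have [la [la_cvg _]] := series_abs_cvg a0 aK.
have [lb [lb_cvg _]] := series_abs_cvg b0 bK.
set u := series (normc \o a) in la_cvg aK *; set v := series (normc \o b) in lb_cvg bK *.
have nd_u : {homo u : m n / (m <= n)%N >-> m <= n}.
  by apply/nondecreasing_seqP => n; rewrite /u seriesSr lerDl.
have nd_v : {homo v : m n / (m <= n)%N >-> m <= n}.
  by apply/nondecreasing_seqP => n; rewrite /v seriesSr lerDl.
have half : (fun n => n./2) @ \oo --> \oo.
  apply/cvgnyPge => N; exists N.*2 => // n /= Nn.
  by rewrite -(doubleK N) half_leq.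
have v2 : v n./2 @[n --> \oo] --> lb by exact: cvg_comp half lb_cvg.
have u2 : u n./2 @[n --> \oo] --> la by exact: cvg_comp half la_cvg.
have KA0 : 0 <= KA by apply: le_trans (aK 0%N); rewrite /u /series /= big_geq.
have KB0 : 0 <= KB by apply: le_trans (bK 0%N); rewrite /v /series /= big_geq.
have ab : (fun n => series a n * series b n : C^o) @ \oo --> (A * B : C^o).
  by apply: cvgC_M aA bB.
have d0 : (fun n => series a n * series b n - series (cconv a b) n : C^o) @ \oo --> (0 : C^o).
  apply/cvgC_normP.
  apply: (@cvg_norm_squeeze _ _ _ _ _ (fun n => KA * (v n - v n./2) + KB * (u n - u n./2))); last first.
    have <- : KA * (lb - lb) + KB * (la - la) = 0 by rewrite !subrr !mulr0 addr0.
    apply: cvgD; apply: cvgM; [exact: cvg_cst|exact: cvgB|exact: cvg_cst|exact: cvgB].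
  apply: nearW => n; rewrite !subr0 ger0_norm ?normc_ge0//.
  rewrite series_cconv /series /= mulr_suml -sumrB.
  apply: le_trans (normc_sum _ _ _) _.
  have step i : (i < n)%N ->
      normc (a i * \sum_(0 <= k < n) b k - a i * \sum_(0 <= k < n - i) b k) <=
      normc (a i) * (v n - v (n - i)%N).
    move=> ni; rewrite -mulrBr normcM ler_wpM2l ?normc_ge0//.
    rewrite (@big_cat_nat _ _ _ (n - i)) ?leq_subr//= addrAC subrr add0r.
    by rewrite /v sub_series_geq ?leq_subr//= normc_sum.
  apply: (@le_trans _ _ (\sum_(0 <= i < n) normc (a i) * (v n - v (n - i)%N))).
    by apply: ler_sum_nat => i /andP[_ ni]; exact: step.
  have n2 : (n./2 <= n)%N by rewrite -{2}(odd_double_half n) -addnn addnA leq_addl.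
  rewrite (@big_cat_nat _ _ _ n./2)//=; apply: lerD.
    apply: (@le_trans _ _ (u n./2 * (v n - v n./2))).
      rewrite /u /series /= mulr_suml; apply: ler_sum_nat => i /andP[_ ni].
      rewrite ler_wpM2l ?normc_ge0// lerB// nd_v//.
      rewrite leq_subRL; last by rewrite (leq_trans (ltnW ni)).
      rewrite (leq_trans (leq_add (ltnW ni) (leqnn _)))// addnn.
      by rewrite -[X in (_ <= X)%N]odd_double_half leq_addl.
    by rewrite ler_wpM2r// subr_ge0 nd_v.
  rewrite mulrC /u sub_series_geq// mulr_suml; apply: ler_sum => i _.
  rewrite ler_wpM2l ?normc_ge0// lerBlDr (le_trans (bK n))// lerDl.
  by rewrite /v; apply: sumr_ge0 => ? _; exact: normc_ge0.
rewrite -[A * B]addr0 -(mulr0 (-1)).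
rewrite /csum (_ : series (cconv a b) = fun n => series a n * series b n +
   (-1) * (series a n * series b n - series (cconv a b) n)); last first.
  by apply/funext => n /=; rewrite mulN1r opprB addrC subrK.
by apply: cvgC_D ab _; apply: cvgC_M d0; exact: cvgC_cst.
Qed.

End complex_series.

(** * The exponential series *)

Section cexp_series.
Context {R : realType}.
Local Notation C := R[i].

Lemma csum_real (u : nat -> R) (l : R) :
  series u @ \oo --> l -> csum (fun n => (u n)%:C) l%:C.
Proof.
move=> ul; apply/csum_ReImP; split => //=.
rewrite (_ : series _ = fun=> 0); first exact: cvg_cst.
by apply/funext => n; rewrite /series /= big1.
Qed.

Definition cexp_coeff (z : C) (n : nat) : C := z ^+ n / (n`!%:R).

Lemma normc_cexp_coeff (z : C) n : normc (cexp_coeff z n) = exp_coeff (normc z) n.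
Proof. by rewrite /cexp_coeff normcM normcX normcV normc_nat. Qed.

Lemma series_exp_coeff_le (t : R) n : 0 <= t -> series (exp_coeff t) n <= expR t.
Proof.
move=> t0; apply: nondecreasing_cvgn_le; last exact: is_cvg_series_exp_coeff.
by apply/nondecreasing_seqP => k; rewrite seriesSr lerDl exp_coeff_ge0.
Qed.

Lemma series_cexp_coeff_le (z : C) n :
  series (normc \o cexp_coeff z) n <= expR (normc z).
Proof.
rewrite (_ : normc \o _ = exp_coeff (normc z)); last first.
  by apply/funext => k /=; rewrite normc_cexp_coeff.
by rewrite series_exp_coeff_le// normc_ge0.
Qed.

Lemma cconv_cexp_coeff (z w : C) :
  cconv (cexp_coeff z) (cexp_coeff w) = cexp_coeff (z + w).
Proof.
apply/funext => n; rewrite /cconv /cexp_coeff addrC exprDn mulr_suml big_mkord.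
apply: eq_bigr => -[i /=]; rewrite ltnS => ni _.
rewrite -(bin_fact ni) -mulr_natr.
have F k : (k`!%:R : C) != 0 by rewrite pnatr_eq0 -lt0n fact_gt0.
have B : ('C(n, i)%:R : C) != 0 by rewrite pnatr_eq0 -lt0n bin_gt0.
by rewrite !natrM; field; rewrite B !F.
Qed.

Lemma im_coeff (t : R) n :
  cexp_coeff (0 +i* t) n = cos_coeff t n +i* sin_coeff t n.
Proof.
have -> : 0 +i* t = 'i%C * t%:C by apply: complex_eqP; rewrite !cReE /=; ring.
rewrite /cexp_coeff exprMn natC -RealCV -RealCX -mulrA -RealCM.
rewrite /cos_coeff /sin_coeff /=.
have even k : 'i%C ^+ k.*2 = ((-1) ^+ k)%:C :> C.
  by rewrite -mul2n exprM sqr_i RealCX RealCN.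
rewrite -{1}(odd_double_half n) exprD even.
have -> : n.-1./2 = if odd n then n./2 else (n.-1)./2.
  by case: ifP => // no; rewrite -{1}(odd_double_half n) no /= doubleK.
rewrite -exprnP; set c := (-1) ^+ n./2; set d := t ^+ n / _.
case: (odd n) => /=; apply: complex_eqP; rewrite ?expr1 ?expr0 !cReE /=;
  rewrite -?(mulrA _ _ n`!%:R^-1) -?/d -?mulrA -?/d -?/c; ring.
Qed.

(** [cexp] is defined through [expR], [cos] and [sin], so its power series is a theorem: it is the
    Cauchy product of the series at Re z and at i Im z, recombined by the binomial theorem. *)
Lemma csum_cexp (z : C) : csum (cexp_coeff z) (cexp z).
Proof.
have -> : cexp z = cexp (Re z)%:C * cexp (0 +i* Im z).
  by rewrite -cexpD; congr cexp; apply: complex_eqP; rewrite !cReE /= ?addr0 ?add0r.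
rewrite [in cexp_coeff _](_ : z = (Re z)%:C + (0 +i* Im z)); last first.
  by apply: complex_eqP; rewrite !cReE /= ?addr0 ?add0r.
rewrite -cconv_cexp_coeff.
apply: cauchy_product; last 2 first.
- exact: series_cexp_coeff_le.
- exact: series_cexp_coeff_le.
- rewrite cexp_real (_ : cexp_coeff _ = fun n => (exp_coeff (Re z) n)%:C); last first.
    by apply/funext => n; rewrite /cexp_coeff /exp_coeff natC -RealCV -RealCX -RealCM.
  by apply: csum_real; exact: is_cvg_series_exp_coeff.
- rewrite (_ : cexp _ = cos (Im z) +i* sin (Im z)); last first.
    by rewrite /cexp /= expR0 mul1r.
  rewrite (_ : cexp_coeff _ = fun n => cos_coeff (Im z) n +i* sin_coeff (Im z) n); last first.
    by apply/funext => n; exact: im_coeff.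
  apply/csum_ReImP; split => /=; rewrite unlock.
  + exact: is_cvg_series_cos_coeff.
  + exact: is_cvg_series_sin_coeff.
Qed.

End cexp_series.

(** * Power series and the identity theorem *)

Section analytic_functions.
Context {R : realType}.
Local Notation C := R[i].
Implicit Types (f g : C -> C) (a b : nat -> C) (r : R).

Definition pseries_at f (z0 : C) r a : Prop :=
  0 < r /\ forall h, normc h < r -> csum (fun n => a n * h ^+ n) (f (z0 + h)).

Definition analytic_at f z0 := exists r a, pseries_at f z0 r a.

Lemma analytic_onP (U : set C) f :
  analytic_on U f <-> forall z0, U z0 -> analytic_at f z0.
Proof.
split=> H z0 /H [r [a [r0 F]]]; exists r, a; split => // h.
  by move=> hr; have := F (z0 + h); rewrite addrAC subrr add0r normE ltcR; exact.
by rewrite normE ltcR => /F; rewrite [z0 + _]addrC subrK.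
Qed.

Lemma cvgC_norm_le (u : nat -> C) (l : C) (B : R) N :
  (u n : C^o) @[n --> \oo] --> (l : C^o) -> (forall n, (N <= n)%N -> normc (u n) <= B) ->
  normc l <= B.
Proof.
move=> /cvgC_normP/cvgr0_norm_lt H uB; rewrite leNgt; apply/negP => Bl.
have e0 : 0 < normc l - B by rewrite subr_gt0.
have [k _ /(_ (maxn N k) (leq_maxr _ _)) /=] := H _ e0.
rewrite ger0_norm ?normc_ge0// => h.
have := normcD (l - u (maxn N k)) (u (maxn N k)).
rewrite subrK normcB.
by have := uB _ (leq_maxl N k); lra.
Qed.

Lemma geometric_series_le (q : R) n : 0 <= q -> q < 1 ->
  \sum_(0 <= k < n) q ^+ k <= (1 - q)^-1.
Proof.
move=> q0 q1; rewrite -[leRHS]mul1r ler_pdivlMr ?subr_gt0// mulrC.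
rewrite big_mkord -opprB mulNr -subrX1 opprB lerBlDr lerDl.
exact: exprn_ge0.
Qed.

Lemma pseries_bound f z0 r a (t : R) : pseries_at f z0 r a -> 0 <= t -> t < r ->
  exists M : R, 0 < M /\ forall n, normc (a n) * t ^+ n <= M.
Proof.
move=> [r0 F] t0 tr; have := F t%:C.
rewrite normc_real ger0_norm// => /(_ tr)/csum_bounded[M [M0 HM]].
exists M; split => // n; have := HM n.
by rewrite normcM -RealCX normc_real ger0_norm// exprn_ge0.
Qed.

(** Abel's lemma: the terms are bounded at a radius w strictly between t and r, so at t they are
    dominated by a geometric series of ratio t / w. *)
Lemma pseries_abs f z0 r a (t : R) : pseries_at f z0 r a -> 0 <= t -> t < r ->
  exists K : R, forall n, series (fun n => normc (a n) * t ^+ n) n <= K.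
Proof.
move=> Hf t0 tr; pose w := (t + r) / 2.
have w0 : 0 < w by rewrite /w; lra.
have wr : w < r by rewrite /w; lra.
have tw : t < w by rewrite /w; lra.
have [M [M0 HM]] := pseries_bound Hf (ltW w0) wr.
exists (M * (1 - t / w)^-1) => n.
apply: (@le_trans _ _ (\sum_(0 <= k < n) M * (t / w) ^+ k)).
  apply: ler_sum => k _; have h := HM k.
  rewrite expr_div_n mulrA ler_pdivlMr ?exprn_gt0//.
  by rewrite mulrAC ler_wpM2r ?exprn_ge0.
rewrite -mulr_sumr ler_wpM2l ?(ltW M0)// geometric_series_le//.
  by rewrite divr_ge0// ltW.
by rewrite ltr_pdivrMr// mul1r.
Qed.

(** The Taylor remainder of order N, with constants independent of N. N = 1 gives the value at the
    centre and continuity; N = n + 1 isolates the first nonzero coefficient a_n. *)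
Lemma pseries_tail f z0 r a : pseries_at f z0 r a ->
  exists w M : R, [/\ 0 < w, 0 < M & forall N h, normc h <= w / 2 ->
    normc (f (z0 + h) - series (fun n => a n * h ^+ n) N) <= M * (normc h / w) ^+ N].
Proof.
move=> Hf; have [r0 F] := Hf; pose w := r / 2.
have w0 : 0 < w by rewrite /w; lra.
have wr : w < r by rewrite /w; lra.
have [M [M0 HM]] := pseries_bound Hf (ltW w0) wr.
(* For |h| <= w / 2 the geometric tail has ratio at most 1/2, hence sum at most 2. *)
exists w, (M * 2); split => //; first by lra.
move=> N h hw; have hr : normc h < r by apply: le_lt_trans hw _; rewrite /w; lra.
have cv := F _ hr; set s := series _ in cv *.
apply: (@cvgC_norm_le (fun n => s n - s N) _ _ N).
  by apply: cvgC_D cv _; exact: cvgC_cst.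
move=> n Nn; rewrite /s sub_series_geq// (le_trans (normc_sum _ _ _))//.
have q0 : 0 <= normc h / w by rewrite divr_ge0 ?normc_ge0// ltW.
have q1 : normc h / w <= 1 / 2 by rewrite ler_pdivrMr//; lra.
apply: (@le_trans _ _ (\sum_(N <= k < n) M * (normc h / w) ^+ k)).
  apply: ler_sum => k _; have H := HM k.
  rewrite normcM normcX expr_div_n mulrA ler_pdivlMr ?exprn_gt0//.
  by rewrite mulrAC ler_wpM2r ?exprn_ge0 ?normc_ge0.
rewrite -mulr_sumr -mulrA ler_wpM2l ?(ltW M0)//.
rewrite -{1}(add0n N) big_addn.
under eq_bigr do rewrite exprD.
rewrite -mulr_suml ler_wpM2r ?exprn_ge0//.
apply: (@le_trans _ _ (1 - normc h / w)^-1).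
  by apply: geometric_series_le => //; lra.
by rewrite -[leRHS]invrK lef_pV2 ?posrE ?invr_gt0//; lra.
Qed.

Lemma pseries_at0 f z0 r a : pseries_at f z0 r a -> f z0 = a 0%N.
Proof.
move=> Hf; have [w [M [w0 M0 T]]] := pseries_tail Hf.
have := T 1%N 0; rewrite normc0 mul0r expr1 mulr0 addr0 => /(_ _) H.
apply/eqP; rewrite -subr_eq0 -normc_eq0 eq_le normc_ge0 andbT.
have := H _; rewrite /series /= big_nat1 expr0 mulr1; apply.
by rewrite divr_ge0// ltW.
Qed.

Lemma nbhsC_P (z0 : C) (P : C -> Prop) :
  (\forall z \near (z0 : C^o), P z) <->
  exists2 e : R, 0 < e & forall z, normc (z - z0) < e -> P z.
Proof.
split=> [/nbhs_normP[e /= e0 H]|[e e0 H]].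
  have eE : e = (Re e)%:C.
    by apply: complex_eqP => //=; move: e0; rewrite ltcE => /andP[/eqP ->].
  exists (Re e); first by rewrite -ltcR -eE.
  by move=> z ze; apply: H => /=; rewrite eE /= normE ltcR normcB.
apply/nbhs_normP; exists e%:C => /=; first by rewrite ltcR.
by move=> z /=; rewrite normE ltcR normcB; exact: H.
Qed.

Lemma analytic_at_continuous f z0 : analytic_at f z0 ->
  (f z : C^o) @[z --> (z0 : C^o)] --> (f z0 : C^o).
Proof.
move=> [r [a Hf]]; have [w [M [w0 M0 T]]] := pseries_tail Hf.
apply/(@cvgrPdist_le _ _ _ _ (nbhs_filter (z0 : C^o))) => e e0.
have eE : e = (Re e)%:C.
  by apply: complex_eqP => //=; move: e0; rewrite ltcE => /andP[/eqP ->].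
have {e0}e0 : 0 < Re e by rewrite -ltcR -eE.
apply/nbhsC_P; exists (Num.min (w / 2) (w * Re e / M)).
  by rewrite lt_min divr_gt0//= divr_gt0// mulr_gt0.
move=> z; rewrite lt_min => /andP[/ltW zw h].
have := T 1%N _ zw; rewrite [z0 + _]addrC subrK /series /= big_nat1 expr0 mulr1 -(pseries_at0 Hf) expr1 => h'.
rewrite eE normE lecR normcB (le_trans h')// mulrA ler_pdivrMr// mulrC.
by rewrite -ler_pdivlMr// [_ * w]mulrC ltW.
Qed.

(** By strong induction all coefficients vanish. If a_n were the first nonzero one, a zero h would
    satisfy |a_n| |h| ^ n <= M (|h| / w) ^ (n + 1), which is false as soon as |h| < |a_n| / K. *)
Lemma pseries_isolated f z0 r a : pseries_at f z0 r a ->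
  (forall e : R, 0 < e -> exists h, [/\ 0 < normc h, normc h < e & f (z0 + h) = 0]) ->
  forall h, normc h < r -> f (z0 + h) = 0.
Proof.
move=> Hf Z; have [w [M [w0 M0 T]]] := pseries_tail Hf.
suff a0 n : a n = 0.
  move=> h hr; have [_ /(_ _ hr) F] := Hf.
  apply: csum_unique F _; rewrite /csum (_ : series _ = fun=> 0); first exact: cvgC_cst.
  by apply/funext => n; rewrite /series /= big1// => k _; rewrite a0 mul0r.
have [m] := ubnP n; elim: m n => // m IH n; rewrite ltnS => nm.
apply/eqP; rewrite -normc_eq0; apply/negPn/negP => an0.
have {}an0 : 0 < normc (a n) by rewrite lt_def an0 normc_ge0.
pose K := M / w ^+ n.+1.
have K0 : 0 < K by rewrite divr_gt0// exprn_gt0.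
have e0 : 0 < Num.min (w / 2) (normc (a n) / K).
  by rewrite lt_min divr_gt0//= divr_gt0.
have [h [h0]] := Z _ e0; rewrite lt_min => /andP[hw haK] fh.
have := T n.+1 h (ltW hw); rewrite fh sub0r normc_opp seriesSr.
rewrite /series /= big_nat big1 ?add0r; last first.
  by move=> k /andP[_ kn]; rewrite IH ?mul0r//; exact: leq_trans nm.
rewrite normcM normcX expr_div_n mulrA mulrAC -/K exprS [X in _ <= X]mulrA.
rewrite ler_pM2r ?exprn_gt0//.
by move: haK; rewrite ltr_pdivlMr// mulrC => ? ?; lra.
Qed.

Definition segment (p q : C) (t : R) : C := p + t%:C * (q - p).

(* The supremum of the parameters up to which f vanishes is a non-isolated zero. *)
Lemma identity_on_segment f (p q : C) :
  (forall t : R, 0 <= t <= 1 -> analytic_at f (segment p q t)) ->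
  (exists2 e : R, 0 < e & forall z, normc (z - p) < e -> f z = 0) ->
  f q = 0.
Proof.
move=> Ha [e e0 fe].
have [<-|pq] := eqVneq p q; first by apply: fe; rewrite subrr normc0.
pose L := normc (q - p).
have L0 : 0 < L by rewrite normc_gt0 subr_eq0 eq_sym.
have segB s t : normc (segment p q s - segment p q t) = `|s - t| * L.
  rewrite (_ : _ - _ = (s - t)%:C * (q - p)); first by rewrite normcM normc_real.
  by rewrite RealCD RealCN /segment; ring.
pose S : set R := [set t | 0 <= t <= 1 /\ forall t', 0 <= t' <= t -> f (segment p q t') = 0].
have S0 : S 0.
  split; first by rewrite lexx ler01.
  move=> t; rewrite -eq_le => /eqP <-; apply: fe.
  by rewrite /segment mul0r addr0 subrr normc0.
have hS : has_sup S.
  by split; [exists 0|exists 1 => t [/andP[]]].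
pose T := sup S.
have T0 : 0 <= T by apply: (ub_le_sup hS.2).
have T1 : T <= 1 by apply: (ge_sup (ex_intro _ 0 S0)) => t [/andP[]].
have Sub t : S t -> t <= T by exact: (ub_le_sup hS.2).
have Tgt0 : 0 < T.
  (* The segment is run at speed [L], so parameters below e / L stay in the disc where f vanishes;
     the half keeps the inequality strict. *)
  apply: (@lt_le_trans _ _ (Num.min 1 (e / L / 2))).
    by rewrite lt_min ltr01/= !divr_gt0.
  apply: Sub; split; first by rewrite le_min ler01 ge_min lexx /= !divr_ge0// ltW.
  move=> t /andP[t0]; rewrite le_min => /andP[t1 te]; apply: fe.
  have Ep : p = segment p q 0 by rewrite /segment mul0r addr0.
  rewrite [X in _ - X]Ep segB -[e](@divfK _ L) ?gt_eqF// ltr_pM2r// subr0 ger0_norm//.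
  apply: le_lt_trans te _; have : 0 < e / L by rewrite divr_gt0.
  by lra.
have fS t : 0 <= t -> t < T -> f (segment p q t) = 0.
  move=> t0 tT; have d0 : 0 < T - t by rewrite subr_gt0.
  have [s [_ H]] := sup_adherent d0 hS.
  by rewrite opprB addrC subrK => /ltW ts; apply: H; rewrite t0.
have [r [a Hf]] := Ha T (introT andP (conj T0 T1)).
have Z : forall h, normc h < r -> f (segment p q T + h) = 0.
  apply: (pseries_isolated Hf) => d d0.
  (* A parameter in ]0, T[ whose point is at distance less than [d] from the point at [T]: a zero
     different from the centre. *)
  pose x := T - Num.min T (d / L) / 2.
  have m0 : 0 < Num.min T (d / L) by rewrite lt_min Tgt0/= divr_gt0.
  have mT : Num.min T (d / L) <= T by rewrite ge_min lexx.
  have md : Num.min T (d / L) <= d / L by rewrite ge_min lexx orbT.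
  exists (segment p q x - segment p q T); rewrite segB.
  have -> : `|x - T| = Num.min T (d / L) / 2.
    by rewrite /x addrAC subrr sub0r normrN ger0_norm// divr_ge0// ltW.
  split.
  - by rewrite mulr_gt0// divr_gt0.
  - by rewrite -ltr_pdivlMr//; lra.
  - by rewrite addrC subrK; apply: fS; rewrite /x; lra.
have [r0 _] := Hf.
(* The disc of radius [r] about the point at [T] contains the points of parameter up to T + r / L /
   2, so vanishing extends beyond [T] unless T = 1. *)
have ST : S (Num.min 1 (T + r / L / 2)).
  have rL : 0 < r / L by rewrite divr_gt0.
  split; first by rewrite le_min ler01 ge_min lexx /=; lra.
  move=> t /andP[t0]; rewrite le_min => /andP[t1 te].
  have [tT|Tt] := ltP t T; first exact: fS.
  rewrite -[segment p q t](subrK (segment p q T)) addrC; apply: Z.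
  rewrite segB ger0_norm ?subr_ge0// -[r](@divfK _ L) ?gt_eqF// ltr_pM2r//.
  by lra.
have TE : T = 1.
  apply/eqP; rewrite eq_le T1 /= leNgt; apply/negP => lt1.
  have := Sub _ ST; rewrite ge_min !leNgt lt1 /=.
  by rewrite ltrDl !divr_gt0.
have := Z 0; rewrite normc0 addr0 TE /segment mul1r addrC subrK; exact.
Qed.

End analytic_functions.

(** * Closure properties of analytic functions *)

Section analytic_closure.
Context {R : realType}.
Local Notation C := R[i].
Implicit Types (f g : C -> C).

Lemma csum_finite (a : nat -> C) N :
  (forall n, (N <= n)%N -> a n = 0) -> csum a (series a N).
Proof.
move=> a0; apply/cvgC_normP/cvgr0Pnorm_le => e e0.
exists N => // n /= Nn; rewrite sub_series_geq// big_nat big1 ?normc0 ?normr0 ?ltW//.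
by move=> i /andP[Ni _]; exact: a0.
Qed.

Lemma csum_shift (a : nat -> C) l : csum a l -> csum (fun n => a n.+1) (l - a 0%N).
Proof.
move=> al; rewrite /csum (_ : series _ = fun n => series a n.+1 + (- a 0%N)).
  apply: cvgC_D; last exact: cvgC_cst.
  by rewrite (cvg_shiftS (series a : nat -> C^o)).
by apply/funext => n; rewrite /series /= big_nat_recl//= addrC addKr.
Qed.

Lemma analytic_at_cst (c : C) (z0 : C) : analytic_at (fun=> c) z0.
Proof.
exists 1, (fun n => if n is 0%N then c else 0); split => // h _.
rewrite [X in csum _ X](_ : c = series (fun n => (if n is 0%N then c else 0) * h ^+ n) 1%N).
  by apply: csum_finite => -[|n]// _; rewrite mul0r.
by rewrite /series /= big_nat1 expr0 mulr1.
Qed.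

Lemma analytic_at_id (z0 : C) : analytic_at id z0.
Proof.
pose a n : C := match n with 0%N => z0 | 1%N => 1 | _ => 0 end.
exists 1, a; split => // h _.
rewrite [X in csum _ X](_ : id (z0 + h) = series (fun n => a n * h ^+ n) 2%N).
  by apply: csum_finite => -[|[|n]]// _; rewrite mul0r.
by rewrite /series /= big_nat_recr//= big_nat1 expr0 expr1 mulr1 mul1r.
Qed.

Lemma analytic_atD f g (z0 : C) : analytic_at f z0 -> analytic_at g z0 ->
  analytic_at (fun z => f z + g z) z0.
Proof.
move=> [r [a [r0 F]]] [s [b [s0 G]]].
exists (Num.min r s), (fun n => a n + b n); split; first by rewrite lt_min r0.
move=> h; rewrite lt_min => /andP[hr hs].
have := csumD (F _ hr) (G _ hs); congr csum.
by apply/funext => n; rewrite mulrDl.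
Qed.

Lemma analytic_atM f g (z0 : C) : analytic_at f z0 -> analytic_at g z0 ->
  analytic_at (fun z => f z * g z) z0.
Proof.
move=> [r [a Hf]] [s [b Hg]]; have [r0 F] := Hf; have [s0 G] := Hg.
exists (Num.min r s), (cconv a b); split; first by rewrite lt_min r0.
move=> h; rewrite lt_min => /andP[hr hs].
have [KA HKA] := pseries_abs Hf (normc_ge0 h) hr.
have [KB HKB] := pseries_abs Hg (normc_ge0 h) hs.
have E c : normc \o (fun n => c n * h ^+ n) = fun n => normc (c n) * normc h ^+ n :> R.
  by apply/funext => n /=; rewrite normcM normcX.
have := @cauchy_product _ _ _ _ _ KA KB (F _ hr) (G _ hs).
rewrite !E => /(_ HKA HKB); congr csum; apply/funext => n.
rewrite /cconv mulr_suml; apply: eq_big_nat => i /andP[_].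
by rewrite ltnS => ni; rewrite mulrACA -exprD subnKC.
Qed.

Lemma analytic_atB f g (z0 : C) : analytic_at f z0 -> analytic_at g z0 ->
  analytic_at (fun z => f z - g z) z0.
Proof.
move=> Hf Hg.
have := analytic_atD Hf (analytic_atM (analytic_at_cst (-1) z0) Hg).
by congr analytic_at; apply/funext => z; rewrite mulN1r.
Qed.

Lemma analytic_at_shift f (c : C) (z0 : C) :
  analytic_at f (z0 + c) -> analytic_at (fun z => f (z + c)) z0.
Proof.
move=> [r [a [r0 F]]]; exists r, a; split; first exact: r0.
by move=> h hr; rewrite (addrAC z0 h c); exact: F.
Qed.

Lemma analytic_at_cexp (c d z0 : C) : analytic_at (fun z => cexp (c * z + d)) z0.
Proof.
exists 1, (fun n => cexp (c * z0 + d) * (c ^+ n / n`!%:R)); split => // h _.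
have -> : c * (z0 + h) + d = (c * z0 + d) + c * h by rewrite mulrDr addrAC.
rewrite [X in csum _ X]cexpD.
have := csumZ (c := cexp (c * z0 + d)) (csum_cexp (z := c * h)); congr csum.
by apply/funext => n; rewrite /cexp_coeff exprMn; ring.
Qed.

End analytic_closure.

(** * Complex-valued integrals *)

Section complex_integral.
Context {R : realType} d (T : measurableType d) (mu : {measure set T -> \bar R}).
Variables (D : set T).
Hypothesis (mD : measurable D).
Local Notation C := R[i].
Implicit Types (f g : T -> C).

Definition cmeas f := measurable_fun D (fun x => Re (f x)) /\ measurable_fun D (fun x => Im (f x)).

Lemma cmeas_real (g : T -> R) : measurable_fun D g -> cmeas (fun x => (g x)%:C).
Proof. by move=> mg; split => //=; exact: measurable_cst. Qed.

Lemma cmeas_cst (c : C) : cmeas (fun=> c).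
Proof. by split; exact: measurable_cst. Qed.

Lemma cmeasD f g : cmeas f -> cmeas g -> cmeas (fun x => f x + g x).
Proof.
move=> [fr fi] [gr gi]; split.
  by under eq_fun do rewrite ReD; exact: measurable_funD.
by under eq_fun do rewrite ImD; exact: measurable_funD.
Qed.

Lemma cmeasM f g : cmeas f -> cmeas g -> cmeas (fun x => f x * g x).
Proof.
move=> [fr fi] [gr gi]; split.
  by under eq_fun do rewrite ReM; apply: measurable_funB; exact: measurable_funM.
by under eq_fun do rewrite ImM; apply: measurable_funD; exact: measurable_funM.
Qed.

Lemma cmeasN f : cmeas f -> cmeas (fun x => - f x).
Proof.
move=> mf; have := cmeasM (cmeas_cst (-1)) mf.
by under eq_fun do rewrite mulN1r.
Qed.

Lemma cmeasB f g : cmeas f -> cmeas g -> cmeas (fun x => f x - g x).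
Proof. by move=> mf mg; exact: cmeasD (cmeasN mg). Qed.

Lemma cmeasX f n : cmeas f -> cmeas (fun x => f x ^+ n).
Proof.
move=> mf; elim: n => [|n IH]; first exact: cmeas_cst.
by under eq_fun do rewrite exprS; exact: cmeasM.
Qed.

Lemma cmeas_sum (F : nat -> T -> C) n : (forall i, cmeas (F i)) ->
  cmeas (fun x => \sum_(0 <= i < n) F i x).
Proof.
move=> mF; elim: n => [|n IH].
  by under eq_fun do rewrite big_geq//; exact: cmeas_cst.
by under eq_fun do rewrite big_nat_recr//=; exact: cmeasD.
Qed.

Lemma cmeasV f : cmeas f -> cmeas (fun x => (f x)^-1).
Proof.
move=> [fr fi].
(* The squared modulus is nonnegative, so its inverse is the real power of exponent -1, a measurable
   function; the two agree at 0 as well. *)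
have mn : measurable_fun D (fun x => (Re (f x) ^+ 2 + Im (f x) ^+ 2) `^ (-1)).
  apply: (measurableT_comp (measurable_powR (-1))).
  by apply: measurable_funD; exact: measurable_funX.
have E x : (Re (f x) ^+ 2 + Im (f x) ^+ 2) `^ (-1) = (Re (f x) ^+ 2 + Im (f x) ^+ 2)^-1.
  by rewrite powR_inv1// addr_ge0// sqr_ge0.
have I (z : C) : z^-1 = (Re z / (Re z ^+ 2 + Im z ^+ 2)) +i* (- (Im z / (Re z ^+ 2 + Im z ^+ 2))).
  by case: z.
split.
  under eq_fun do rewrite I /= -E.
  exact: measurable_funM.
under eq_fun do rewrite I /= -E -mulNr.
by apply: measurable_funM => //; exact: measurableT_comp.
Qed.

Lemma cmeas_cexp f : cmeas f -> cmeas (fun x => cexp (f x)).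
Proof.
move=> [fr fi]; apply: cmeasM.
  by apply: cmeas_real; exact: (measurableT_comp (@measurable_expR R)).
split => /=.
  by apply: (measurableT_comp _ fi); apply: continuous_measurable_fun; exact: continuous_cos.
by apply: (measurableT_comp _ fi); apply: continuous_measurable_fun; exact: continuous_sin.
Qed.

Lemma cintegrable_le f (g : T -> R) : cmeas f -> mu.-integrable D (EFin \o g) ->
  (forall x, D x -> normc (f x) <= g x) -> cintegrable mu D f.
Proof.
move=> [fr fi] ig fg; split; apply: (le_integrable mD _ _ ig) => //=.
- exact/measurable_EFinP.
- move=> x Dx; rewrite lee_fin (le_trans (Re_le_normc _))// (le_trans (fg _ Dx))//.
  exact: ler_norm.
- exact/measurable_EFinP.
- move=> x Dx; rewrite lee_fin (le_trans (Im_le_normc _))// (le_trans (fg _ Dx))//.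
  exact: ler_norm.
Qed.

Lemma cintegrable_cmeas f : cintegrable mu D f -> cmeas f.
Proof.
by move=> [/integrableP[/measurable_EFinP ? _] /integrableP[/measurable_EFinP ? _]]; split.
Qed.

Lemma eq_cintegral f g : {in D, f =1 g} -> cintegral mu D f = cintegral mu D g.
Proof.
by move=> fg; rewrite /cintegral; congr (_ +i* _); apply: eq_Rintegral => x xD; rewrite fg.
Qed.

Lemma eq_cintegrable f g : {in D, f =1 g} -> cintegrable mu D f -> cintegrable mu D g.
Proof.
by move=> fg [fr fi]; split; [apply: eq_integrable fr => //|apply: eq_integrable fi => //]
  => x xD /=; rewrite fg.
Qed.

Lemma cintegrableD f g : cintegrable mu D f -> cintegrable mu D g ->
  cintegrable mu D (fun x => f x + g x).
Proof.
move=> [fr fi] [gr gi]; split.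
  by apply: eq_integrable (integrableD mD fr gr) => // x _ /=; rewrite ReD EFinD.
by apply: eq_integrable (integrableD mD fi gi) => // x _ /=; rewrite ImD EFinD.
Qed.

Lemma cintegralD f g : cintegrable mu D f -> cintegrable mu D g ->
  cintegral mu D (fun x => f x + g x) = cintegral mu D f + cintegral mu D g.
Proof.
move=> [fr fi] [gr gi]; apply: complex_eqP; rewrite cReE /= -RintegralD//;
  by apply: eq_Rintegral => x _; rewrite cReE.
Qed.

Lemma cintegrableZ (c : C) f : cintegrable mu D f -> cintegrable mu D (fun x => c * f x).
Proof.
move=> [fr fi].
have Z k h : mu.-integrable D (EFin \o h) -> mu.-integrable D (EFin \o (fun x => k * h x)).
  by move=> ih; apply: eq_integrable (integrableZl mD k ih) => // x _ /=; rewrite EFinM.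
split.
  by apply: eq_integrable (integrableB mD (Z (Re c) _ fr) (Z (Im c) _ fi)) => // x _ /=; rewrite ReM EFinB.
by apply: eq_integrable (integrableD mD (Z (Re c) _ fi) (Z (Im c) _ fr)) => // x _ /=; rewrite ImM EFinD.
Qed.

Lemma cintegralZ (c : C) f : cintegrable mu D f ->
  cintegral mu D (fun x => c * f x) = c * cintegral mu D f.
Proof.
move=> [fr fi].
have Z k h : mu.-integrable D (EFin \o h) -> mu.-integrable D (EFin \o (fun x => k * h x)).
  by move=> ih; apply: eq_integrable (integrableZl mD k ih) => // x _ /=; rewrite EFinM.
apply: complex_eqP; rewrite cReE /=.
  rewrite -!RintegralZl// -RintegralB//; [|exact: Z|exact: Z].
  by apply: eq_Rintegral => x _; rewrite cReE.
rewrite -!RintegralZl// -RintegralD//; [|exact: Z|exact: Z].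
by apply: eq_Rintegral => x _; rewrite cReE.
Qed.

Lemma cintegrableB f g : cintegrable mu D f -> cintegrable mu D g ->
  cintegrable mu D (fun x => f x - g x).
Proof.
move=> fi gi; have := cintegrableD fi (cintegrableZ (-1) gi).
by apply: eq_cintegrable => x _; rewrite mulN1r.
Qed.

Lemma cintegralB f g : cintegrable mu D f -> cintegrable mu D g ->
  cintegral mu D (fun x => f x - g x) = cintegral mu D f - cintegral mu D g.
Proof.
move=> fi gi; rewrite -mulN1r -cintegralZ// -cintegralD//; last exact: cintegrableZ.
by apply: eq_cintegral => x _; rewrite mulN1r.
Qed.

Lemma cintegrable_sum (F : nat -> T -> C) n : (forall i, cintegrable mu D (F i)) ->
  cintegrable mu D (fun x => \sum_(0 <= i < n) F i x).
Proof.
move=> iF; elim: n => [|n IH].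
  apply: (@eq_cintegrable (fun=> 0)); first by move=> x _; rewrite big_geq.
  by split; exact: integrable0.
apply: eq_cintegrable (cintegrableD IH (iF n)) => x _.
by rewrite big_nat_recr.
Qed.

Lemma cintegral_sum (F : nat -> T -> C) n : (forall i, cintegrable mu D (F i)) ->
  cintegral mu D (fun x => \sum_(0 <= i < n) F i x) = \sum_(0 <= i < n) cintegral mu D (F i).
Proof.
move=> iF; elim: n => [|n IH].
  rewrite big_geq// (@eq_cintegral _ (fun=> 0)); last by move=> x _; rewrite big_geq.
  by rewrite /cintegral /= !Rintegral_cst// !mul0r.
rewrite big_nat_recr//= -IH -cintegralD//; last exact: cintegrable_sum.
by apply: eq_cintegral => x _; rewrite big_nat_recr.
Qed.

Lemma cdominated_convergence (F : nat -> T -> C) f (g : T -> R) :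
  (forall n, cmeas (F n)) -> cmeas f ->
  (forall x, D x -> (F n x : C^o) @[n --> \oo] --> (f x : C^o)) ->
  mu.-integrable D (EFin \o g) ->
  (forall n x, D x -> normc (F n x) <= g x) ->
  cintegrable mu D f /\ (cintegral mu D (F n) : C^o) @[n --> \oo] --> (cintegral mu D f : C^o).
Proof.
move=> mF [mfr mfi] Ff ig Fg.
(* [p] stands for [Re] or [Im]: all that is used is that it is dominated by [normc]. *)
have dct (p : C -> R) : (forall z, `|p z| <= normc z) ->
   (forall n, measurable_fun D (p \o F n)) -> measurable_fun D (p \o f) ->
   (forall x, D x -> p (F n x) @[n --> \oo] --> p (f x)) ->
   mu.-integrable D (EFin \o (p \o f)) /\
   \int[mu]_(x in D) p (F n x) @[n --> \oo] --> \int[mu]_(x in D) p (f x).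
  move=> pn mpF mpf cp.
  have [] := @dominated_convergence _ _ _ mu D mD (fun n => EFin \o (p \o F n)) (EFin \o (p \o f)) (EFin \o g).
  - by move=> n; exact/measurable_EFinP.
  - exact/measurable_EFinP.
  - by apply: aeW => x Dx; apply: cvg_EFin; [exact: nearW|exact: cp].
  - exact: ig.
  - by apply: aeW => x n Dx /=; rewrite lee_fin (le_trans (pn _))// Fg.
  move=> ipf _ cv; split => //.
  apply: fine_cvg; rewrite fineK//; exact: integrable_fin_num.
have cvr x : D x -> Re (F n x) @[n --> \oo] --> Re (f x) by move=> /Ff/cvgC_ReImP[].
have cvi x : D x -> Im (F n x) @[n --> \oo] --> Im (f x) by move=> /Ff/cvgC_ReImP[].
have [ir cr] := dct _ (@Re_le_normc R) (fun n => (mF n).1) mfr cvr.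
have [ii ci] := dct _ (@Im_le_normc R) (fun n => (mF n).2) mfi cvi.
split; first by split.
by apply/cvgC_ReImP; split.
Qed.

(** The domination bears on the partial sums and not on the sum of the norms. For geometric series
    of ratio q with |q| < 1 the partial sums are at most 2 / |1 - q|, a bound that remains usable
    when |q| tends to 1, as happens for |z| = 1 at t = 0. *)
Lemma cintegral_series (c : nat -> T -> C) f (g : T -> R) :
  (forall n, cmeas (c n)) -> cmeas f ->
  (forall x, D x -> csum (c ^~ x) (f x)) ->
  mu.-integrable D (EFin \o g) ->
  (forall n x, D x -> normc (series (c ^~ x) n) <= g x) ->
  [/\ forall n, cintegrable mu D (c n), cintegrable mu D f &
      csum (fun n => cintegral mu D (c n)) (cintegral mu D f)].
Proof.
move=> mc mf cf ig cg.
have ic n : cintegrable mu D (c n).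
  (* A single term is a difference of two consecutive partial sums, each bounded by [g]. *)
  apply: (@cintegrable_le _ (fun x => g x + g x)) => //.
    by apply: eq_integrable (integrableD mD ig ig) => // x _ /=; rewrite EFinD.
  move=> x Dx; rewrite -(seriesSB (c ^~ x) n).
  by rewrite (le_trans (normcD _ _))// normc_opp lerD ?cg.
have mS n : cmeas (fun x => series (c ^~ x) n) by exact: cmeas_sum.
have [fi cv] := @cdominated_convergence (fun n x => series (c ^~ x) n) f g mS mf cf ig cg.
split => //; rewrite /csum (_ : series _ =
    fun n => cintegral mu D (fun x => series (c ^~ x) n)); first exact: cv.
by apply/funext => n; rewrite /series /= cintegral_sum.
Qed.

End complex_integral.

(** * Derivatives of real functions *)

Section real_derivatives.
Context {R : realType}.
Implicit Types (f g : R -> R) (a b t : R).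

(** Hides the class [is_derive], so that derivatives are assembled by explicit application and their
    value is adjusted afterwards with [der_eq]. *)
Definition der f t a : Prop := is_derive t 1 f a.

Lemma der_eq f t a b : der f t a -> a = b -> der f t b. Proof. by move=> ? <-. Qed.
Lemma der_derivable f t a : der f t a -> derivable f t 1. Proof. by case. Qed.
Lemma der_cst a t : der (fun=> a) t 0. Proof. exact: is_derive_cst. Qed.
Lemma der_id t : der id t 1. Proof. exact: is_derive_id. Qed.
Lemma derN f t a : der f t a -> der (fun x => - f x) t (- a).
Proof. by move=> df; exact: is_deriveN. Qed.
Lemma derD f g t a b : der f t a -> der g t b -> der (fun x => f x + g x) t (a + b).
Proof. by move=> df dg; exact: is_deriveD. Qed.
Lemma derB f g t a b : der f t a -> der g t b -> der (fun x => f x - g x) t (a - b).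
Proof. by move=> df dg; exact: is_deriveB. Qed.
Lemma derM f g t a b : der f t a -> der g t b ->
  der (fun x => f x * g x) t (a * g t + f t * b).
Proof.
move=> df dg; apply: (der_eq (is_deriveM df dg)).
by rewrite addrC -[g t *: a]/(g t * a) mulrC.
Qed.
Lemma der_comp f g t a b : der f (g t) a -> der g t b -> der (fun x => f (g x)) t (a * b).
Proof. by move=> df dg; exact: is_derive1_comp. Qed.
Lemma der_expR f t a : der f t a -> der (fun x => expR (f x)) t (expR (f t) * a).
Proof. by apply: der_comp; exact: is_derive_expR. Qed.
Lemma der_cos f t a : der f t a -> der (fun x => cos (f x)) t (- sin (f t) * a).
Proof. by apply: der_comp; exact: is_derive_cos. Qed.
Lemma der_sin f t a : der f t a -> der (fun x => sin (f x)) t (cos (f t) * a).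
Proof. by apply: der_comp; exact: is_derive_sin. Qed.
Lemma der_ln t : 0 < t -> der (@ln R) t t^-1.
Proof. exact: is_derive1_ln. Qed.
Lemma derV f t a : f t != 0 -> der f t a -> der (fun x => (f x)^-1) t (- a / f t ^+ 2).
Proof.
move=> f0 df; have := is_deriveV f0 df; move/der_eq; apply.
by rewrite -[LHS]/(- (f t) ^- 2 * a); ring.
Qed.
Lemma derZ f t a b : der f t a -> der (fun x => b * f x) t (b * a).
Proof. by move=> df; apply: der_eq (derM (der_cst b t) df) _; rewrite mul0r add0r. Qed.

End real_derivatives.

(** * Mellin transforms on the half-line *)

Section halfline.
Context {R : realType}.
Local Notation C := R[i].
Local Notation mu := (@lebesgue_measure R).
Local Notation pos := (`]0, +oo[%classic : set R).

Lemma measurable_pos : measurable (pos : set (measurableTypeR R)). Proof. exact: measurable_itv. Qed.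

Lemma FTC_derivable (f F : R -> R) (a b : R) : a < b ->
  (forall x, a <= x <= b -> der F x (f x)) ->
  (forall x, a <= x <= b -> derivable f x 1) ->
  (\int[mu]_(x in `[a, b]) (f x)%:E = (F b - F a)%:E)%E.
Proof.
move=> ab dF df; rewrite (@continuous_FTC2 _ _ F)//.
- by apply: derivable_within_continuous => x; rewrite in_itv/=; exact: df.
- have cF x : a <= x <= b -> {for x, continuous F}.
    move=> /dF [Fx _]; apply: differentiable_continuous.
    exact/derivable1_diffP.
  split.
  + by move=> x /[!in_itv]/= /andP[ax xb]; apply: (@ex_derive _ _ _ _ _ _ (f x)); apply: dF; rewrite !ltW.
  + by apply: cvg_at_right_filter; apply: cF; rewrite lexx ltW.
  + by apply: cvg_at_left_filter; apply: cF; rewrite lexx ltW.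
- move=> x /[!in_itv]/= /andP[ax xb]; rewrite derive1E.
  by apply: (@derive_val _ _ _ _ _ _ (f x)); apply: dF; rewrite !ltW.
Qed.

(** With [n.+2] the interval is nondegenerate already for n = 0; [n.+1] would give the single point
    1 there. *)
Definition exhaust (n : nat) : set R := `[(n.+2%:R)^-1, n.+2%:R]%classic.

Lemma exhaust_lt n : (n.+2%:R)^-1 < (n.+2%:R : R).
Proof.
by rewrite (@lt_trans _ _ 1)// ?invf_lt1// ?ltr1n.
Qed.

Lemma exhaust_pos n t : exhaust n t -> 0 < t.
Proof. by rewrite /exhaust /= in_itv/= => /andP[+ _]; apply: lt_le_trans. Qed.

Lemma bigcup_exhaust : \bigcup_n exhaust n = pos.
Proof.
apply/seteqP; split=> [t [n _ /exhaust_pos]|t]; first by rewrite /= in_itv/= andbT.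
rewrite /= in_itv/= andbT => t0.
pose n1 := (Num.truncn t).+1; pose n2 := (Num.truncn t^-1).+1.
have H1 : t <= n1%:R by rewrite ltW// truncnS_gt.
have H2 : t^-1 <= n2%:R by rewrite ltW// truncnS_gt.
exists (n1 + n2)%N => //; rewrite /exhaust /= in_itv/=; apply/andP; split.
  rewrite invf_ple ?posrE// (le_trans H2)// ler_nat.
  by rewrite -addn2 -addnA addnCA leq_addr.
by rewrite (le_trans H1)// ler_nat -addn2 -addnA leq_addr.
Qed.

Lemma nondecreasing_exhaust : nondecreasing_seq exhaust.
Proof.
apply/nondecreasing_seqP => n; apply/subsetPset => t; rewrite /exhaust /= !in_itv/=.
move=> /andP[h1 h2]; apply/andP; split.
  by rewrite (le_trans _ h1)// lef_pV2 ?posrE// ler_nat.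
by rewrite (le_trans h2)// ler_nat.
Qed.

Lemma measurable_derivable_pos (f : R -> R) :
  (forall t : R, 0 < t -> derivable f t 1) -> measurable_fun pos f.
Proof.
move=> df; apply: open_continuous_measurable_fun; first exact: interval_open.
move=> x; rewrite inE /= in_itv/= andbT => x0.
by apply: differentiable_continuous; exact/derivable1_diffP/df.
Qed.

Lemma FTC_exhaust (f F : R -> R) n :
  (forall t : R, 0 < t -> der F t (f t)) -> (forall t : R, 0 < t -> derivable f t 1) ->
  (\int[mu]_(x in exhaust n) (f x)%:E = (F n.+2%:R - F (n.+2%:R)^-1)%:E)%E.
Proof.
move=> dF df; apply: FTC_derivable; first exact: exhaust_lt.
- by move=> x /andP[+ _] => h; apply: dF; apply: lt_le_trans h.
- by move=> x /andP[+ _] => h; apply: df; apply: lt_le_trans h.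
Qed.

(** On each interval of [exhaust] the integral is a difference of two values of the primitive F,
    hence at most K; monotone convergence passes to the half-line. *)
Lemma ge0_integrable_pos (f F : R -> R) (K : R) :
  (forall t : R, 0 < t -> 0 <= f t) -> (forall t : R, 0 < t -> der F t (f t)) ->
  (forall t : R, 0 < t -> derivable f t 1) -> (forall t : R, 0 < t -> 0 <= F t <= K) ->
  mu.-integrable pos (EFin \o f).
Proof.
move=> f0 dF df FK; apply/integrableP; split.
  by apply/measurable_EFinP; exact: measurable_derivable_pos.
apply: (@le_lt_trans _ _ K%:E); last exact: ltry.
rewrite [X in (X <= _)%E](_ : _ = \int[mu]_(x in pos) (EFin \o f) x)%E; last first.
  by apply: eq_integral => t; rewrite inE /= in_itv/= andbT => t0; rewrite ger0_norm// f0.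
rewrite -bigcup_exhaust.
have cv := @ge0_nondecreasing_set_cvg_integral _ (measurableTypeR R) R exhaust (EFin \o f) mu nondecreasing_exhaust.
have {}cv : (\int[mu]_(x in exhaust i) (EFin \o f) x)%E @[i --> \oo] -->
   (\int[mu]_(x in \bigcup_i exhaust i) (EFin \o f) x)%E.
  apply: cv.
  - by move=> i; exact: measurable_itv.
  - move=> i; apply/measurable_EFinP; apply: measurable_funS (measurable_derivable_pos df) => //.
    by move=> t /exhaust_pos; rewrite /= in_itv/= andbT.
  - by move=> i t /exhaust_pos t0; rewrite lee_fin f0.
rewrite -(cvg_lim _ cv)//; apply: lime_le; first by apply/cvg_ex; eexists; exact: cv.
apply: nearW => n; rewrite (FTC_exhaust n dF df) lee_fin.
have n0 : 0 < n.+2%:R :> R by [].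
have n1 : 0 < (n.+2%:R)^-1 :> R by rewrite invr_gt0.
by have /andP[_ H1] := FK _ n0; have /andP[H2 _] := FK _ n1; lra.
Qed.

(** Integration by parts on the half-line in the only form required: F is the boundary term and
    vanishes at both ends. Integrability of f dominates its truncations to [exhaust n]. *)
Lemma FTC_vanish (f F : R -> R) :
  (forall t : R, 0 < t -> der F t (f t)) -> (forall t : R, 0 < t -> derivable f t 1) ->
  mu.-integrable pos (EFin \o f) ->
  F (n.+2%:R) @[n --> \oo] --> (0 : R) -> F (n.+2%:R)^-1 @[n --> \oo] --> (0 : R) ->
  \int[mu]_(x in pos) f x = 0.
Proof.
move=> dF df fi F0 Fy.
pose fn n t := if t \in exhaust n then f t else 0.
have mf := measurable_derivable_pos df.
have measurable_pos : measurable pos by exact: measurable_itv.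
have [] := @dominated_convergence _ (measurableTypeR R) R mu pos measurable_pos (fun n => EFin \o fn n) (EFin \o f) (EFin \o (fun t => `|f t|)).
- move=> n; apply/measurable_EFinP; rewrite (_ : fn n = fun t => \1_(exhaust n) t * f t).
    by apply: measurable_funM => //; apply: measurable_indic; exact: measurable_itv.
  by apply/funext => t; rewrite /fn indicE; case: (t \in _); rewrite ?mul1r ?mul0r.
- exact/measurable_EFinP.
- apply: aeW => t tpos.
  have [n _ tn] : (\bigcup_n exhaust n) t by rewrite bigcup_exhaust.
  apply: cvg_near_cst; exists n => // k /= nk; rewrite /fn mem_set//.
  by have /subsetPset := nondecreasing_exhaust nk; exact.
- exact: integrable_norm.
- apply: aeW => t n _ /=; rewrite lee_fin /fn; case: ifPn => // _.
  by rewrite normr0.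
move=> _ _ cv.
have E n : (\int[mu]_(t in pos) (EFin \o fn n) t)%E = (F n.+2%:R - F (n.+2%:R)^-1)%:E.
  rewrite -(FTC_exhaust n dF df).
  rewrite [LHS](_ : _ = \int[mu]_(t in pos) ((EFin \o f) \_ (exhaust n)) t)%E; last first.
    by apply: eq_integral => t _; rewrite /fn patchE /=; case: ifP.
  rewrite -integral_mkcondr; congr integral; apply/setIidr => t /exhaust_pos.
  by rewrite /= in_itv/= andbT.
rewrite /Rintegral (cvg_unique _ cv (_ : _ --> 0%E))//.
rewrite (_ : (fun n => _) = fun n => (F n.+2%:R - F (n.+2%:R)^-1)%:E); last first.
  by apply/funext => n; rewrite E.
apply: cvg_EFin; first exact: nearW.
by rewrite -(subrr 0); apply: cvgB.
Qed.

Lemma pow_exp_bound (g c : R) : 0 <= g -> 0 < c ->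
  exists K : R, 0 < K /\ forall t, 0 < t -> expR (g * ln t) * expR (- (c * t)) <= K.
Proof.
rewrite le_eqVlt => /predU1P[<- c0|g0 c0].
  exists 1; split => // t t0; rewrite mul0r expR0 mul1r -expR0 ler_expR oppr_le0.
  by rewrite mulr_ge0// ltW.
(* t ^ g exp (- c t) is largest at t = g / c. The witness (g / c) ^ g is that maximum without its
   factor exp (- g); it comes from ln x <= x - 1 at x = t c / g. *)
exists (expR (g * ln (g / c))); split; first exact: expR_gt0.
move=> t t0; rewrite -expRD ler_expR.
have : ln (t * (c / g)) <= t * (c / g) - 1.
  have tcg : 0 < t * (c / g) by rewrite mulr_gt0// divr_gt0.
  by rewrite lerBrDl; have := @expR_ge1Dx R (ln (t * (c / g))); rewrite lnK.
have cg : ln (g / c) = - ln (c / g) by rewrite -lnV ?posrE ?divr_gt0// invf_div.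
rewrite cg (lnM (x := t) (y := c / g)) ?posrE ?divr_gt0// => h.
have : g * (ln t + ln (c / g)) <= g * (t * (c / g) - 1) by rewrite ler_wpM2l// ltW.
have -> : g * (t * (c / g) - 1) = c * t - g by field; rewrite gt_eqF.
by lra.
Qed.

Definition pw (b t : R) : R := expR (b * ln t).

Lemma pw_gt0 b t : 0 < pw b t. Proof. exact: expR_gt0. Qed.
Lemma pwD b c t : pw (b + c) t = pw b t * pw c t.
Proof. by rewrite /pw mulrDl expRD. Qed.
Lemma pw1 t : 0 < t -> pw 1 t = t.
Proof. by move=> t0; rewrite /pw mul1r lnK. Qed.

Lemma der_pw (b t : R) : 0 < t -> der (pw b) t (pw b t * (b * t^-1)).
Proof. by move=> t0; apply: der_expR; apply: derZ; exact: der_ln. Qed.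

(* Comparison with t ^ a / (1 + t ^ (a + 1)) ^ 2, which has a bounded primitive. *)
Lemma integrable_pw_exp (a c : R) : -1 < a -> 0 < c ->
  mu.-integrable pos (EFin \o (fun t => pw a t * expR (- (c * t)))).
Proof.
move=> a1 c0; pose b := a + 1; have b0 : 0 < b by rewrite /b; lra.
pose F t := (1 - (1 + pw b t)^-1) / b.
pose f t := pw a t * (1 + pw b t) ^- 2.
have pb0 t : 0 < 1 + pw b t by have := pw_gt0 b t; lra.
have ifp : mu.-integrable pos (EFin \o f).
  apply: (@ge0_integrable_pos f F b^-1).
  - by move=> t t0; rewrite /f mulr_ge0 ?invr_ge0 ?exprn_ge0 ?ltW// pw_gt0.
  - move=> t t0; apply: der_eq.
      apply: derM; last exact: der_cst.
      apply: derB; first exact: der_cst.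
      apply: derV; first by rewrite gt_eqF.
      by apply: derD; [exact: der_cst|exact: der_pw].
    rewrite /f /b pwD pw1//.
    field; rewrite (gt_eqF t0) (gt_eqF b0) /= andbT gt_eqF//.
    by rewrite addr_gt0// mulr_gt0// pw_gt0.
  - move=> t t0; apply: der_derivable; apply: derM; first exact: der_pw.
    apply: derV; first by rewrite expf_neq0// gt_eqF.
    rewrite /=; under [X in der X]eq_fun do rewrite expr2.
    by apply: derM; apply: derD; (exact: der_cst || exact: der_pw).
  - move=> t t0; have i0 : 0 < (1 + pw b t)^-1 by rewrite invr_gt0.
    have i1 : (1 + pw b t)^-1 <= 1 by rewrite invf_le1// lerDl ltW// pw_gt0.
    apply/andP; split; first by apply: divr_ge0; [lra|exact: ltW].
    by rewrite /F ler_pdivrMr// mulVf ?gt_eqF//; lra.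
have [K1 [K10 HK1]] := pow_exp_bound (ltW b0) c0.
have b20 : 0 <= b + b by lra.
have [K2 [K20 HK2]] := pow_exp_bound b20 c0.
(* The three summands bound those of (1 + t ^ b) ^ 2 exp (- c t) once the square is expanded. *)
have ig := integrableZl measurable_pos (1 + 2 * K1 + K2) ifp.
apply: le_integrable ig => //.
  apply/measurable_EFinP; apply: measurable_derivable_pos => t t0.
  apply: der_derivable; apply: derM; first exact: der_pw.
  by apply: der_expR; apply: derN; apply: derZ; exact: der_id.
move=> t /=; rewrite in_itv/= andbT => t0; rewrite lee_fin.
rewrite !ger0_norm ?mulr_ge0 ?expR_ge0 ?(ltW (pw_gt0 _ _)) ?invr_ge0 ?exprn_ge0 ?(ltW (pb0 _))//; last by lra.
rewrite mulrCA /f ler_wpM2l ?(ltW (pw_gt0 _ _))//.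
rewrite ler_pdivlMr ?exprn_gt0//.
have h1 := HK1 _ t0; have h2 := HK2 _ t0.
have h3 : expR (- (c * t)) <= 1 by rewrite -expR0 ler_expR oppr_le0 mulr_ge0// ltW.
have -> : expR (- (c * t)) * (1 + pw b t) ^+ 2 = expR (- (c * t)) +
   2 * (pw b t * expR (- (c * t))) + pw (b + b) t * expR (- (c * t)) by rewrite pwD; ring.
rewrite /pw in h1 h2 *; lra.
Qed.

End halfline.

(** * Analyticity of Mellin transforms *)

Section mellin.
Context {R : realType}.
Local Notation C := R[i].
Local Notation mu := (@lebesgue_measure R).
Local Notation pos := (`]0, +oo[%classic : set (measurableTypeR R)).

Lemma pos_gt0 (t : R) : pos t -> 0 < t.
Proof. by rewrite /= in_itv/= andbT. Qed.

(** The power t ^ s for t > 0, where it equals [cpow] ([cpow_real]), but free of the case analysis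
    in [carg], so that it is easy to differentiate. *)
Definition tpow (s : C) (t : R) : C := cexp (s * (ln t)%:C).

Lemma tpowD s s' t : tpow (s + s') t = tpow s t * tpow s' t.
Proof. by rewrite /tpow mulrDl cexpD. Qed.

Lemma normc_tpow s t : normc (tpow s t) = pw (Re s) t.
Proof. by rewrite /tpow normc_cexp ReM /= mulr0 subr0. Qed.

Lemma cmeas_ln : cmeas pos (fun t => (ln t)%:C).
Proof.
by apply: cmeas_real; apply: (measurable_funS measurableT); last exact: measurable_ln.
Qed.

Lemma cmeas_tpow s : cmeas pos (tpow s).
Proof. by apply: cmeas_cexp; apply: cmeasM cmeas_ln; exact: cmeas_cst. Qed.

Definition mellin (w : R -> C) (s : C) : C := cintegral mu pos (fun t => tpow s t * w t).

(* [w] is O(t^k) at 0 and decays exponentially at infinity. *)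
Definition mellin_weight (w : R -> C) (k : R) : Prop := cmeas pos w /\
  exists B c : R, 0 < c /\ forall t, 0 < t -> normc (w t) <= B * (pw k t * expR (- (c * t))).

Lemma pw_abs_le (r t : R) : 0 <= r -> expR (r * `|ln t|) <= pw r t + pw (- r) t.
Proof.
move=> r0; rewrite /pw; have [l0|l0] := leP 0 (ln t).
  by rewrite ger0_norm// lerDl expR_ge0.
by rewrite ltr0_norm// mulNr -mulrN lerDr expR_ge0.
Qed.

(** The factor [expR (r * |ln t|)] dominates every partial sum of the exponential series of h ln t
    with |h| <= r, so one integrable [g] serves a whole disc about [s]. With r = 0 it is plain
    integrability. *)
Lemma mellin_dominated (w : R -> C) (k : R) (s : C) (r : R) :
  mellin_weight w k -> 0 <= r -> -1 < Re s + k - r -> exists g : R -> R,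
  mu.-integrable pos (EFin \o g) /\
  forall t, 0 < t -> expR (r * `|ln t|) * normc (tpow s t * w t) <= g t.
Proof.
move=> [mw [B [c [c0 HB]]]] r0 srk.
exists (fun t => B * (pw (Re s + k + r) t * expR (- (c * t)) + pw (Re s + k - r) t * expR (- (c * t)))).
split.
  have h1 : -1 < Re s + k + r by lra.
  have := integrableZl (@measurable_pos R) B (integrableD (@measurable_pos R) (integrable_pw_exp h1 c0) (integrable_pw_exp srk c0)).
  by apply: eq_integrable => //; exact: measurable_pos.
move=> t t0; rewrite normcM normc_tpow.
rewrite mulrA (le_trans (ler_wpM2l _ (HB _ t0)))//.
  by rewrite mulr_ge0 ?expR_ge0// ltW// pw_gt0.
have B0 : 0 <= B.
  have := le_trans (normc_ge0 _) (HB _ t0); rewrite pmulr_lge0// mulr_gt0 ?expR_gt0//.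
rewrite mulrCA ler_wpM2l// -mulrDl -mulrA.
have -> : pw (Re s + k + r) t + pw (Re s + k - r) t = (pw r t + pw (- r) t) * (pw (Re s) t * pw k t).
  by rewrite !pwD; ring.
rewrite -mulrA -[in leRHS]mulrA ler_wpM2r ?pw_abs_le//.
by rewrite mulr_ge0 ?expR_ge0// mulr_ge0 ?expR_ge0.
Qed.

Lemma mellin_integrable (w : R -> C) (k : R) (s : C) :
  mellin_weight w k -> -1 < Re s + k -> cintegrable mu pos (fun t => tpow s t * w t).
Proof.
move=> Hw sk; have sk0 : -1 < Re s + k - 0 by rewrite subr0.
have [g [ig gP]] := mellin_dominated Hw (lexx 0) sk0.
apply: (cintegrable_le (@measurable_pos R) _ ig).
  by apply: cmeasM; [exact: cmeas_tpow|exact: Hw.1].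
by move=> t /pos_gt0 t0; have := gP _ t0; rewrite mul0r expR0 mul1r.
Qed.

(** Expand t ^ h = sum of (h ln t) ^ n / n! and integrate term by term. *)
Lemma mellin_analytic (w : R -> C) (k : R) (s : C) :
  mellin_weight w k -> -1 < Re s + k -> analytic_at (mellin w) s.
Proof.
(* Half the distance from Re s to the abscissa -1 - k, which leaves room for the factor t ^ (- r)
   near 0. *)
move=> Hw sk; pose r := (Re s + k + 1) / 2.
have r0 : 0 < r by rewrite /r; lra.
have skr : -1 < Re s + k - r by rewrite /r; lra.
have [g [ig gP]] := mellin_dominated Hw (ltW r0) skr.
pose a n t := ((ln t)%:C ^+ n / n`!%:R) * (tpow s t * w t).
have S h : normc h < r -> [/\ forall n, cintegrable mu pos (fun t => h ^+ n * a n t),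
    cintegrable mu pos (fun t => tpow (s + h) t * w t) &
    csum (fun n => cintegral mu pos (fun t => h ^+ n * a n t)) (mellin w (s + h))].
  move=> hr; apply: (cintegral_series (@measurable_pos R) _ _ _ ig).
  - move=> n; apply: cmeasM; first exact: cmeas_cst.
    apply: cmeasM; last by apply: cmeasM; [exact: cmeas_tpow|exact: Hw.1].
    by apply: cmeasM; [apply: cmeasX; exact: cmeas_ln|exact: cmeas_cst].
  - by apply: cmeasM; [exact: cmeas_tpow|exact: Hw.1].
  - move=> t _; rewrite tpowD [X in csum _ X](_ : _ = tpow s t * w t * cexp (h * (ln t)%:C)); last first.
      by rewrite -/(tpow h t) mulrAC.
    have := csumZ (c := tpow s t * w t) (csum_cexp (z := h * (ln t)%:C)); congr csum.
    by apply/funext => n; rewrite /cexp_coeff exprMn /a; ring.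
  - move=> n t /pos_gt0 t0; apply: le_trans (gP _ t0).
    rewrite [series _ _](_ : _ = series (cexp_coeff (h * (ln t)%:C)) n * (tpow s t * w t)); last first.
      rewrite /series /= mulr_suml; apply: eq_bigr => i _.
      by rewrite /cexp_coeff exprMn /a; ring.
    rewrite normcM ler_wpM2r ?normc_ge0//.
    apply: (le_trans (normc_sum _ _ _)).
    apply: (le_trans (series_cexp_coeff_le _ _)).
    by rewrite ler_expR normcM normc_real ler_wpM2r// ltW.
(* [S] gives integrability only of h ^ n times the coefficient; a nonzero increment, here r / 2, is
   chosen to divide it out. *)
have ia n : cintegrable mu pos (a n).
  have r2 : normc (r / 2)%:C < r by rewrite normc_real ger0_norm; lra.
  have [/(_ n) + _ _] := S _ r2; move/(cintegrableZ (@measurable_pos R) (((r / 2)%:C ^+ n)^-1)).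
  apply: eq_cintegrable; first exact: measurable_pos.
  move=> t _; rewrite mulrA mulVf ?mul1r// expf_neq0// -normc_eq0 normc_real.
  by rewrite normr_eq0 gt_eqF//; lra.
exists r, (fun n => cintegral mu pos (a n)); split => // h /S[_ _]; congr csum.
by apply/funext => n; rewrite cintegralZ// 1?mulrC//; exact: measurable_pos.
Qed.

End mellin.

(** * The integral representation of the Lerch transcendent *)

Section resolvent.
Context {R : realType}.
Local Notation C := R[i].
Local Notation mu := (@lebesgue_measure R).
Local Notation pos := (`]0, +oo[%classic : set (measurableTypeR R)).

Lemma series_geometricC (q : C) n : q != 1 ->
  series (GRing.exp q) n = (1 - q ^+ n) / (1 - q).
Proof.
move=> q1; have q0 : 1 - q != 0 by rewrite subr_eq0 eq_sym.
apply: (mulIf q0); rewrite divfK// mulrC /series /= big_mkord.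
by rewrite -[1 - q]opprB mulNr -subrX1 opprB.
Qed.

Lemma csum_geometric (q : C) : normc q < 1 -> csum (GRing.exp q) (1 - q)^-1.
Proof.
move=> q1; have qn1 : q != 1 by apply: contraTneq q1 => ->; rewrite normc1 ltxx.
apply/cvgC_normP.
apply: (@cvg_norm_squeeze _ _ _ _ _ (fun n => normc (1 - q)^-1 * normc q ^+ n)).
  apply: nearW => n; rewrite subr0 ger0_norm ?normc_ge0// [X in X - _](series_geometricC n qn1).
  by rewrite mulrBl mul1r addrAC subrr add0r normc_opp normcM normcX mulrC.
rewrite -(mulr0 (normc (1 - q)^-1)); apply: cvgM; first exact: cvg_cst.
by apply: cvg_expr; rewrite ger0_norm ?normc_ge0.
Qed.

(** If Re z < 1, the real part of 1 - z y is at least 1 or 1 - Re z, according to the sign of Re z.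
    Otherwise Im z is nonzero, and |Im z| / |z| is the distance from 1 to the line through 0 and
    z. *)
Lemma cut_plane_dist (z : C) : cut_plane z ->
  exists2 e : R, 0 < e & forall y : R, 0 <= y <= 1 -> e <= normc (1 - z * y%:C).
Proof.
move=> cz; have [z1|z1] := ltP (Re z) 1.
  exists (Num.min 1 (1 - Re z)); first by rewrite lt_min ltr01/= subr_gt0.
  move=> y /andP[y0 y1]; apply: le_trans (Re_le_normc _).
  apply: le_trans (ler_norm _); rewrite !cReE /= mulr0 subr0.
  have [rz|rz] := leP (Re z) 0.
    have := mulr_ge0_le0 y0 rz; rewrite ge_min mulrC => h.
    by apply/orP; left; lra.
  have := ler_wpM2l (ltW rz) y1; rewrite ge_min mulr1 => h.
  by apply/orP; right; lra.
have b0 : Im z != 0 by apply/eqP => b0; apply: cz; split.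
have z0 : 0 < normc z by rewrite normc_gt0; apply: contra_neq b0 => ->.
exists (`|Im z| / normc z); first by rewrite divr_gt0// normr_gt0.
move=> y _; rewrite -(@ler_pXn2r _ 2) ?nnegrE ?normc_ge0 ?divr_ge0 ?normc_ge0//.
rewrite expr_div_n real_normK ?num_real// !normc_sqr !cReE /=.
set a := Re z in z1 *; set b := Im z in b0 *.
have N0 : 0 < a ^+ 2 + b ^+ 2.
  by rewrite ltr_wpDl ?sqr_ge0// lt_def sqr_ge0 sqrf_eq0 b0.
rewrite ler_pdivrMr// -subr_ge0.
rewrite (_ : _ - _ = ((a ^+ 2 + b ^+ 2) * y - a) ^+ 2) ?sqr_ge0//; ring.
Qed.

Lemma expRN_01 (t : R) : 0 < t -> 0 <= expR (- t) <= 1.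
Proof. by move=> t0; rewrite expR_ge0 -expR0 ler_expR oppr_le0 ltW. Qed.

Lemma cmeas_expRN (D : set (measurableTypeR R)) : cmeas D (fun t => (expR (- t))%:C).
Proof.
apply: cmeas_real; apply: (measurable_funS measurableT) => //.
by apply: measurableT_comp => //; exact: measurable_expR.
Qed.

Lemma cmeas_resolvent (D : set (measurableTypeR R)) (z : C) :
  cmeas D (fun t => (1 - z * (expR (- t))%:C)^-1).
Proof.
apply: cmeasV; apply: cmeasB; first exact: cmeas_cst.
by apply: cmeasM; [exact: cmeas_cst|exact: cmeas_expRN].
Qed.

(** With y = exp (- t), 1 / (1 - (z + h) y) is 1 / (1 - z y) times a geometric series of ratio h y /
    (1 - z y), of modulus at most 1/2 uniformly in t when |h| < e / 2. *)
Lemma resolvent_analytic (W : R -> C) (g : R -> R) (z : C) :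
  cmeas pos W -> mu.-integrable pos (EFin \o g) ->
  (forall t, 0 < t -> normc (W t) <= g t) -> cut_plane z ->
  analytic_at (fun z => cintegral mu pos (fun t => W t / (1 - z * (expR (- t))%:C))) z.
Proof.
move=> mW ig Wg /cut_plane_dist[e e0 He].
pose A t := 1 - z * (expR (- t))%:C.
pose a n t := W t * (expR (- t))%:C ^+ n / A t ^+ n.+1.
have mA : cmeas pos (fun t => (A t)^-1) by exact: cmeas_resolvent.
(* 1 / e bounds the inverse of [A t], and 2 the partial sums of the geometric series. *)
have ig' := integrableZl (@measurable_pos R) (2 / e) ig.
have A0 t : 0 < t -> A t != 0.
  by move=> t0; rewrite -normc_gt0; exact: lt_le_trans (He _ (expRN_01 t0)).
have q12 t h : 0 < t -> normc h < e / 2 -> normc (h * (expR (- t))%:C / A t) <= 1 / 2.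
  move=> t0 he; have /andP[y0 y1] := expRN_01 t0; have := He _ (expRN_01 t0).
  rewrite -/(A t) => hA; rewrite !normcM normcV normc_real ger0_norm//.
  rewrite ler_pdivrMr; last exact: lt_le_trans hA.
  have := ler_pM (normc_ge0 h) y0 (ltW he) y1; lra.
have cE h n t : h ^+ n * a n t = (W t / A t) * (h * (expR (- t))%:C / A t) ^+ n.
  by rewrite /a exprSr invfM !exprMn exprVn; ring.
have S h : normc h < e / 2 -> [/\ forall n, cintegrable mu pos (fun t => h ^+ n * a n t),
    cintegrable mu pos (fun t => W t / (1 - (z + h) * (expR (- t))%:C)) &
    csum (fun n => cintegral mu pos (fun t => h ^+ n * a n t))
      (cintegral mu pos (fun t => W t / (1 - (z + h) * (expR (- t))%:C)))].
  move=> he; apply: (cintegral_series (@measurable_pos R) _ _ _ ig').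
  - move=> n; apply: cmeasM; [exact: cmeas_cst|].
    rewrite (_ : a n = fun t => W t * (expR (- t))%:C ^+ n * (A t)^-1 ^+ n.+1); last first.
      by apply/funext => t; rewrite /a exprVn.
    apply: cmeasM; last exact: cmeasX.
    by apply: cmeasM => //; apply: cmeasX; exact: cmeas_expRN.
  - by apply: cmeasM => //; exact: cmeas_resolvent.
  - move=> t /pos_gt0 t0; have qt := q12 _ _ t0 he.
    have q1 : normc (h * (expR (- t))%:C / A t) < 1 by lra.
    have := csumZ (c := W t / A t) (csum_geometric q1).
    have A0' := A0 _ t0.
    rewrite (_ : W t / (1 - (z + h) * (expR (- t))%:C) = W t / A t * (1 - h * (expR (- t))%:C / A t)^-1).
      by congr csum; apply/funext => n; rewrite cE.
    rewrite -[RHS]mulrA -invfM; congr (_ / _).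
    by rewrite mulrBr mulr1 mulrCA divff// mulr1 /A; ring.
  - move=> n t /pos_gt0 t0; have qt := q12 _ _ t0 he.
    rewrite [series _ _](_ : _ = (W t / A t) * series (GRing.exp (h * (expR (- t))%:C / A t)) n); last first.
      by rewrite /series /= mulr_sumr; apply: eq_bigr => i _; rewrite cE.
    have hA := He _ (expRN_01 t0); rewrite -/(A t) in hA.
    have G : normc (series (GRing.exp (h * (expR (- t))%:C / A t)) n) <= 2.
      apply: (le_trans (normc_sum _ _ _)); under eq_bigr do rewrite normcX.
      apply: le_trans (geometric_series_le _ (normc_ge0 _) _) _; first by lra.
      by rewrite -[leRHS]invrK lef_pV2 ?posrE ?invr_gt0//; lra.
    have WA : normc (W t / A t) <= g t / e.
      rewrite normcM normcV ler_pM ?invr_ge0 ?normc_ge0 ?Wg//.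
      by rewrite lef_pV2 ?posrE//; exact: lt_le_trans hA.
    rewrite normcM /= (_ : 2 / e * g t = g t / e * 2); last by ring.
    by rewrite ler_pM ?normc_ge0.
have ia n : cintegrable mu pos (a n).
  have r2 : normc (e / 4)%:C < e / 2 by rewrite normc_real ger0_norm; lra.
  have [/(_ n) + _ _] := S _ r2; move/(cintegrableZ (@measurable_pos R) (((e / 4)%:C ^+ n)^-1)).
  apply: eq_cintegrable; first exact: measurable_pos.
  move=> t _; rewrite mulrA mulVf ?mul1r// expf_neq0// -normc_eq0 normc_real.
  by rewrite normr_eq0 gt_eqF//; lra.
exists (e / 2), (fun n => cintegral mu pos (a n)); split; first by lra.
move=> h /S[_ _]; congr csum.
by apply/funext => n; rewrite cintegralZ// 1?mulrC//; exact: measurable_pos.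
Qed.

End resolvent.

(** * Calculus for complex-valued functions of a real variable *)

Section complex_derivatives.
Context {R : realType}.
Local Notation C := R[i].
Local Notation mu := (@lebesgue_measure R).
Local Notation pos := (`]0, +oo[%classic : set (measurableTypeR R)).
Implicit Types (f g : R -> C).

Definition cder f (t : R) (l : C) : Prop :=
  der (fun x => Re (f x)) t (Re l) /\ der (fun x => Im (f x)) t (Im l).

Lemma cder_eq f t l k : cder f t l -> l = k -> cder f t k. Proof. by move=> ? <-. Qed.

Lemma cder_cst (c : C) t : cder (fun=> c) t 0.
Proof. by split; exact: der_cst. Qed.

Lemma cder_real (h : R -> R) t a : der h t a -> cder (fun x => (h x)%:C) t a%:C.
Proof. by move=> dh; split => //=; exact: der_cst. Qed.

Lemma cderD f g t l k : cder f t l -> cder g t k -> cder (fun x => f x + g x) t (l + k).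
Proof.
move=> [fr fi] [gr gi]; split; rewrite cReE.
  by under [X in der X]eq_fun do rewrite cReE; exact: derD.
by under [X in der X]eq_fun do rewrite cReE; exact: derD.
Qed.

Lemma cderM f g t l k : cder f t l -> cder g t k ->
  cder (fun x => f x * g x) t (l * g t + f t * k).
Proof.
move=> [fr fi] [gr gi]; split; rewrite !cReE.
  under [X in der X]eq_fun do rewrite cReE.
  apply: (der_eq (derB (derM fr gr) (derM fi gi))); ring.
under [X in der X]eq_fun do rewrite cReE.
apply: (der_eq (derD (derM fr gi) (derM fi gr))); ring.
Qed.

Lemma cderZ (c : C) f t l : cder f t l -> cder (fun x => c * f x) t (c * l).
Proof. by move=> df; apply: (cder_eq (cderM (cder_cst c t) df)); rewrite mul0r add0r. Qed.

Lemma cder_cexp f t l : cder f t l -> cder (fun x => cexp (f x)) t (l * cexp (f t)).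
Proof.
move=> [fr fi]; split.
  rewrite ReM Re_cexp Im_cexp; under [X in der X]eq_fun do rewrite Re_cexp.
  apply: (der_eq (derM (der_expR fr) (der_cos fi))); ring.
rewrite ImM Re_cexp Im_cexp; under [X in der X]eq_fun do rewrite Im_cexp.
apply: (der_eq (derM (der_expR fr) (der_sin fi))); ring.
Qed.

Lemma cFTC_vanish (f F : R -> C) :
  (forall t : R, 0 < t -> cder F t (f t)) -> (forall t : R, 0 < t -> exists l, cder f t l) ->
  cintegrable mu pos f ->
  (F n.+2%:R : C^o) @[n --> \oo] --> (0 : C^o) ->
  (F (n.+2%:R)^-1 : C^o) @[n --> \oo] --> (0 : C^o) ->
  cintegral mu pos f = 0.
Proof.
move=> dF df [fr fi] /cvgC_ReImP[r0 i0] /cvgC_ReImP[r1 i1].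
apply: complex_eqP => /=.
  apply: (@FTC_vanish _ _ (fun t => Re (F t))) => //; first by move=> t /dF[].
  by move=> t /df[l [dr _]]; exact: der_derivable dr.
apply: (@FTC_vanish _ _ (fun t => Im (F t))) => //; first by move=> t /dF[].
by move=> t /df[l [_ di]]; exact: der_derivable di.
Qed.

Lemma der_under_integral (f df : R -> R -> R) (g : R -> R) (u v a : R) : u < a < v ->
  (forall x, u < x < v -> mu.-integrable pos (EFin \o f x)) ->
  (forall x t, u < x < v -> 0 < t -> der (f ^~ t) x (df x t)) ->
  (forall x t, u < x < v -> 0 < t -> `|df x t| <= g t) ->
  mu.-integrable pos (EFin \o g) ->
  der (fun x => \int[mu]_(t in pos) f x t) a (\int[mu]_(t in pos) df a t).
Proof.
move=> uav fi fdf dfg ig.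
have uav' : `]u, v[%classic a by rewrite /= in_itv.
have d1 x t : u < x < v -> 0 < t -> partial1of2 f x t = df x t.
  by move=> uxv t0; rewrite partial1of2E; have [_ ->] := fdf x t uxv t0.
have fi' x : `]u, v[%classic x -> mu.-integrable pos (EFin \o f x).
  by rewrite /= in_itv/=; exact: fi.
have dd x t : `]u, v[%classic x -> pos t -> derivable (f ^~ t) x 1.
  by rewrite /= in_itv/= => uxv /pos_gt0 t0; exact: der_derivable (fdf x t uxv t0).
have ig' := integrable_norm ig.
have dg x t : `]u, v[%classic x -> pos t -> `|partial1of2 f x t| <= `|g t|.
  rewrite /= in_itv/= => uxv /pos_gt0 t0; rewrite d1// (le_trans (dfg _ _ uxv t0))//.
  exact: ler_norm.
have g0 (t : R) : 0 <= `|g t| by [].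
split.
  exact: (@derivable_under_integral _ _ (measurableTypeR R) mu f pos (@measurable_pos R) a u v uav' fi' dd _ g0 ig' dg).
rewrite -derive1E (@differentiation_under_integral _ _ (measurableTypeR R) mu f pos (@measurable_pos R) a u v uav' fi' dd _ g0 ig' dg).
by apply: eq_Rintegral => t; rewrite inE => /pos_gt0 t0; exact: d1.
Qed.

Lemma cder_under_integral (f df : R -> R -> C) (g : R -> R) (u v a : R) : u < a < v ->
  (forall x, u < x < v -> cintegrable mu pos (f x)) ->
  (forall x t, u < x < v -> 0 < t -> cder (f ^~ t) x (df x t)) ->
  (forall x t, u < x < v -> 0 < t -> normc (df x t) <= g t) ->
  mu.-integrable pos (EFin \o g) ->
  cder (fun x => cintegral mu pos (f x)) a (cintegral mu pos (df a)).
Proof.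
move=> uav fi fdf dfg ig; split => /=.
  apply: (@der_under_integral _ (fun x t => Re (df x t)) g u v) => // x; first by move=> /fi[].
    by move=> t uxv /(fdf x t uxv)[].
  by move=> t uxv t0; rewrite (le_trans (Re_le_normc _))// dfg.
apply: (@der_under_integral _ (fun x t => Im (df x t)) g u v) => // x; first by move=> /fi[].
  by move=> t uxv /(fdf x t uxv)[].
by move=> t uxv t0; rewrite (le_trans (Im_le_normc _))// dfg.
Qed.

Lemma der0_cst (f : R -> R) (a b : R) : a < b ->
  (forall x, a <= x <= b -> der f x 0) -> f a = f b.
Proof.
move=> ab df; have d x : x \in `]a, b[ -> is_derive x 1 f 0.
  by rewrite in_itv/= => /andP[/ltW ax /ltW xb]; apply: df; rewrite ax.
have c : {within `[a, b], continuous f}.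
  apply: derivable_within_continuous => x; rewrite in_itv/= => /df.
  exact: der_derivable.
have [x _] := @MVT _ f (fun=> 0) a b ab d c.
by rewrite mul0r => /eqP; rewrite subr_eq0 => /eqP.
Qed.

Lemma cder0_cst (f : R -> C) (a b : R) : a < b ->
  (forall x, a <= x <= b -> cder f x 0) -> f a = f b.
Proof.
move=> ab df; apply: complex_eqP.
  by apply: (der0_cst (f := fun x => Re (f x)) ab) => x /df[].
by apply: (der0_cst (f := fun x => Im (f x)) ab) => x /df[].
Qed.

End complex_derivatives.

(** * Euler's integral with a complex decay rate *)

Section gamma_scaling.
Context {R : realType}.
Local Notation C := R[i].
Local Notation mu := (@lebesgue_measure R).
Local Notation pos := (`]0, +oo[%classic : set (measurableTypeR R)).

Definition cdecay (v : C) (t : R) : C := cexp (- (v * t%:C)).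

Lemma normc_cdecay (v : C) t : normc (cdecay v t) = expR (- (Re v * t)).
Proof. by rewrite normc_cexp !cReE /= mulr0 subr0. Qed.

Lemma cmeas_cdecay (v : C) : cmeas pos (cdecay v).
Proof.
apply: cmeas_cexp; apply: cmeasN; apply: cmeasM; first exact: cmeas_cst.
by apply: cmeas_real; exact: measurable_id.
Qed.

Lemma pw0 (t : R) : pw 0 t = 1. Proof. by rewrite /pw mul0r expR0. Qed.

Lemma cdecay_weight (v : C) : 0 < Re v -> mellin_weight (cdecay v) 0.
Proof.
move=> v0; split; first exact: cmeas_cdecay.
exists 1, (Re v); split => // t t0.
by rewrite normc_cdecay pw0 !mul1r.
Qed.

Lemma tpow_real (a t : R) : tpow a%:C t = (pw a t)%:C.
Proof. by rewrite /tpow -RealCM cexp_real. Qed.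

Lemma tpow1 (t : R) : 0 < t -> tpow 1 t = t%:C.
Proof. by move=> t0; rewrite tpow_real pw1. Qed.

Lemma tpowB1 (a : C) (t : R) : 0 < t -> tpow (a - 1) t = tpow a t * (t^-1)%:C.
Proof.
move=> t0; rewrite -[in RHS](subrK 1 a) [in RHS]tpowD tpow1// -mulrA -RealCM.
by rewrite divff ?mulr1// gt_eqF.
Qed.

Lemma cder_tpow (a : C) (t : R) : 0 < t -> cder (tpow a) t (a * (t^-1)%:C * tpow a t).
Proof. by move=> t0; apply: cder_cexp; apply: cderZ; apply: cder_real; exact: der_ln. Qed.

Lemma cder_cdecay (v : C) (t : R) : cder (cdecay v) t (- v * cdecay v t).
Proof.
apply: cder_cexp; rewrite -[X in cder _ _ X]mulr1.
under [X in cder X]eq_fun do rewrite -mulNr.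
by apply: cderZ; apply: cder_real; exact: der_id.
Qed.

Lemma pw_inv_cvg0 (a : R) : 0 < a -> pw a (n.+2%:R)^-1 @[n --> \oo] --> (0 : R).
Proof.
move=> a0; apply/cvgr0Pnorm_le => e e0.
(* (n + 2) ^ (- a) <= e holds as soon as n + 2 >= e ^ (- 1 / a), the number truncated here. *)
pose N := Num.truncn (expR (- ln e / a)).
exists N => // n /= Nn; rewrite ger0_norm ?(ltW (pw_gt0 _ _))//.
rewrite -[e in leRHS]lnK// ler_expR lnV ?posrE// mulrN lerNl -lerN2 opprK.
rewrite lerNl -ler_pdivrMl// -[leLHS]expRK ler_ln ?posrE ?expR_gt0//.
rewrite mulrC ltW// (lt_le_trans (truncnS_gt _))// ler_nat.
by rewrite ltnS (leq_trans Nn).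
Qed.

Lemma pw_exp_cvg0 (a c : R) : 0 < a -> 0 < c ->
  pw a n.+2%:R * expR (- (c * n.+2%:R)) @[n --> \oo] --> (0 : R).
Proof.
(* [pow_exp_bound] is applied with one extra power of t: t ^ (a + 1) exp (- c t) <= K leaves K / t,
   which tends to 0. *)
move=> a0 c0; have a1 : 0 <= a + 1 by lra.
have [K [K0 HK]] := pow_exp_bound a1 c0.
have H : K * harmonic n @[n --> \oo] --> (0 : R).
  by rewrite -(mulr0 K); apply: cvgM; [exact: cvg_cst|exact: cvg_harmonic].
apply: (cvg_norm_squeeze _ H); apply: nearW => n.
rewrite subr0 ger0_norm ?mulr_ge0 ?expR_ge0//.
have n0 : 0 < n.+2%:R :> R by [].
have := HK _ n0; rewrite -/(pw _ _) pwD pw1// => h.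
apply: (@le_trans _ _ (K / n.+2%:R)).
  by rewrite ler_pdivlMr// mulrAC.
by rewrite /harmonic /= ler_wpM2l ?ltW// ltf_pV2 ?posrE// ltr_nat.
Qed.

(** The difference of the two integrands is the derivative of t ^ a exp (- v t), which vanishes at 0
    and at infinity. For v = 1 this is the recurrence of the Gamma function. *)
Lemma gamma_ibp (a v : C) : 0 < Re a -> 0 < Re v ->
  a * mellin (cdecay v) (a - 1) = v * mellin (cdecay v) a.
Proof.
move=> a0 v0.
have i1 : cintegrable mu pos (fun t => tpow (a - 1) t * cdecay v t).
  by apply: mellin_integrable (cdecay_weight v0) _; rewrite !cReE /=; lra.
have i2 : cintegrable mu pos (fun t => tpow a t * cdecay v t).
  by apply: mellin_integrable (cdecay_weight v0) _; lra.
apply/eqP; rewrite -subr_eq0; apply/eqP.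
have j1 := cintegrableZ (@measurable_pos R) a i1; have j2 := cintegrableZ (@measurable_pos R) v i2.
rewrite /mellin -(cintegralZ (@measurable_pos R) a i1) -(cintegralZ (@measurable_pos R) v i2).
rewrite -(cintegralB (@measurable_pos R) j1 j2).
apply: (@cFTC_vanish _ _ (fun t => tpow a t * cdecay v t)).
- move=> t t0; apply: (cder_eq (cderM (cder_tpow a t0) (cder_cdecay v t))).
  by rewrite tpowB1//; ring.
- move=> t t0; eexists; apply: cderD.
    by apply: cderZ; apply: cderM; [exact: cder_tpow|exact: cder_cdecay].
  under [X in cder X]eq_fun do rewrite -mulN1r.
  by apply: cderZ; apply: cderZ; apply: cderM; [exact: cder_tpow|exact: cder_cdecay].
- exact: (cintegrableB (@measurable_pos R) j1 j2).
- apply/cvgC_normP; apply: (cvg_norm_squeeze _ (pw_exp_cvg0 a0 v0)).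
  apply: nearW => n.
  by rewrite !subr0 ger0_norm ?normc_ge0// normcM normc_tpow normc_cdecay.
- apply/cvgC_normP; apply: (cvg_norm_squeeze _ (pw_inv_cvg0 a0)).
  apply: nearW => n; rewrite !subr0 ger0_norm ?normc_ge0// normcM normc_tpow normc_cdecay.
  rewrite ler_piMr ?expR_ge0// -expR0 ler_expR oppr_le0 mulr_ge0 ?invr_ge0//.
  exact: ltW.
Qed.

End gamma_scaling.

Section gamma_scaling_complex.
Context {R : realType}.
Local Notation C := R[i].
Local Notation mu := (@lebesgue_measure R).
Local Notation pos := (`]0, +oo[%classic : set (measurableTypeR R)).

(* [x |-> cexp (x * k)], k = clog v, joins 1 to v inside the right half-plane. *)
Lemma cexp_strip_bounds (k : C) : `|Im k| < pi / 2 ->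
  exists e c V : R, [/\ 0 < e, e <= 1, 0 < c & forall x, - e < x < 1 + e ->
    c <= Re (cexp (x%:C * k)) /\ normc (cexp (x%:C * k)) <= V].
Proof.
move=> kp; set f := `|Im k| in kp; set p := pi / 2 in kp.
have f0 : 0 <= f by exact: normr_ge0.
have p0 : 0 < p by rewrite /p divr_gt0// pi_gt0.
(* Since e p = (p - f) / 2, the angle |x Im k| stays below [th], midway between [f] and pi / 2. The
   range of x exceeds [0, 1] because differentiation under the integral at x = 0 and x = 1 takes
   place in an open interval. *)
pose e := (p - f) / (2 * p).
have e0 : 0 < e by rewrite /e divr_gt0//; lra.
have e1 : e <= 1 by rewrite /e ler_pdivrMr; lra.
pose th := (f + p) / 2.
have eth : (1 + e) * f <= th.
  have : e * f <= e * p by rewrite ler_wpM2l//; lra.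
  have -> : e * p = (p - f) / 2 by rewrite /e; field; rewrite gt_eqF.
  by rewrite /th; lra.
have cth : 0 < cos th.
  by rewrite cos_gt0_pihalf// -/p /th; apply/andP; split; lra.
have bnd x y : - e < x < 1 + e -> `|x * y| <= 2 * `|y|.
  by move=> /andP[x1 x2]; rewrite normrM ler_wpM2r// ler_norml; lra.
exists e, (expR (- (2 * `|Re k|)) * cos th), (expR (2 * `|Re k|)); split => //.
  by rewrite mulr_gt0// expR_gt0.
move=> x xe; have := bnd x (Re k) xe; rewrite ler_norml => /andP[h1 h2].
split; last by rewrite normc_cexp ReM /= mul0r subr0 ler_expR.
rewrite Re_cexp ReM ImM /= !mul0r subr0 addr0.
apply: ler_pM; rewrite ?expR_ge0 ?(ltW cth)// ?ler_expR//.
rewrite -[leRHS]cos_norm leNgt; apply/negP => H.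
have xf : `|x * Im k| <= th.
  apply: le_trans eth; rewrite normrM -/f ler_wpM2r//.
  by move/andP: xe => [x1 x2]; rewrite ler_norml; lra.
have thp : th <= pi.
  have -> : pi = p * 2 by rewrite /p divfK.
  by rewrite /th; lra.
have T0 : 0 <= th by rewrite /th; lra.
have := @ltr_cos R th `|x * Im k|; rewrite !in_itv/= normr_ge0 (le_trans xf thp) T0 thp.
by move=> /(_ isT isT) E; move: H; rewrite E ltNge xf.
Qed.

(* The derivative of v ^ a * mellin (cdecay v) (a - 1) along [x |-> v ^ x] is an
   integral that vanishes by parts ([gamma_ibp]), so the values at x = 0 and
   x = 1 agree: no contour is rotated. *)
Lemma mellin_cdecay (a v : C) : 0 < Re a -> 0 < Re v ->
  mellin (cdecay v) (a - 1) = mellin (cdecay 1) (a - 1) * cpow v (- a).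
Proof.
move=> a0 v0; have vn0 : v != 0 by apply: contraTneq v0 => ->; rewrite /= ltxx.
pose k := clog v; have vk : cexp k = v by exact: cexp_clog.
have [e [c [V [e0 e1 c0 B]]]] := cexp_strip_bounds (Im_clog_lt v0).
pose vl x := cexp (x%:C * k); pose E x := cexp (a * (x%:C * k)).
pose Psi x t := E x * (tpow (a - 1) t * cdecay (vl x) t).
(* The x-derivative of [Psi]: the factor [E] brings k a, and [cdecay (vl x) t] brings - k (vl x) t,
   whose t raises the exponent a - 1 to a. [gamma_ibp] at v = [vl x] makes its integral vanish. *)
pose dPsi x t := k * E x * (a * (tpow (a - 1) t * cdecay (vl x) t)
                            - vl x * (tpow a t * cdecay (vl x) t)).
pose M := expR (2 * `|Re (a * k)|).
have EM x : - e < x < 1 + e -> normc (E x) <= M.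
  move=> /andP[x1 x2]; rewrite normc_cexp ler_expR.
  have -> : Re (a * (x%:C * k)) = x * Re (a * k) by rewrite !cReE /=; ring.
  apply: le_trans (ler_norm _) _; rewrite normrM ler_wpM2r// ler_norml; lra.
have rv x : - e < x < 1 + e -> 0 < Re (vl x) by move=> /B[+ _]; apply: lt_le_trans.
have i1 x : - e < x < 1 + e -> cintegrable mu pos (fun t => tpow (a - 1) t * cdecay (vl x) t).
  by move=> /rv vx0; apply: mellin_integrable (cdecay_weight vx0) _; rewrite !cReE /=; lra.
have i2 x : - e < x < 1 + e -> cintegrable mu pos (fun t => tpow a t * cdecay (vl x) t).
  by move=> /rv vx0; apply: mellin_integrable (cdecay_weight vx0) _; lra.
pose g t := normc k * M * (normc a * (pw (Re a - 1) t * expR (- (c * t)))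
                            + V * (pw (Re a) t * expR (- (c * t)))).
have ig : mu.-integrable pos (EFin \o g).
  have h1 : -1 < Re a - 1 by lra.
  have h2 : -1 < Re a by lra.
  have := integrableZl (@measurable_pos R) (normc k * M) (integrableD (@measurable_pos R)
    (integrableZl (@measurable_pos R) (normc a) (integrable_pw_exp h1 c0))
    (integrableZl (@measurable_pos R) V (integrable_pw_exp h2 c0))).
  by apply: eq_integrable => //; exact: measurable_pos.
have dg x t : - e < x < 1 + e -> 0 < t -> normc (dPsi x t) <= g t.
  move=> xe t0; have [cR Vn] := B _ xe.
  have dec : normc (cdecay (vl x) t) <= expR (- (c * t)).
    by rewrite normc_cdecay ler_expR lerN2 ler_wpM2r// ltW.
  rewrite /dPsi normcM (normcM k); apply: ler_pM; rewrite ?mulr_ge0 ?normc_ge0//.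
    by apply: ler_wpM2l; [exact: normc_ge0|exact: EM xe].
  apply: le_trans (normcD _ _) _.
  rewrite normc_opp (normcM a) (normcM (vl x)).
  rewrite (normcM (tpow (a - 1) t)) (normcM (tpow a t)).
  rewrite (normc_tpow a) (normc_tpow (a - 1)).
  have -> : Re (a - 1) = Re a - 1 by rewrite ReD.
  apply: lerD.
    by rewrite ler_wpM2l ?normc_ge0// ler_wpM2l// ltW// pw_gt0.
  rewrite ler_pM ?normc_ge0 ?mulr_ge0 ?normc_ge0 ?(ltW (pw_gt0 _ _))//.
  by rewrite ler_wpM2l// ltW// pw_gt0.
have dPsiE x t : 0 < t -> cder (Psi ^~ t) x (dPsi x t).
  move=> t0; apply: cder_eq.
    apply: cderM.
      by apply: cder_cexp; apply: cderZ; apply: cderM; [apply: cder_real; exact: der_id|exact: cder_cst].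
    apply: cderZ; apply: cder_cexp.
    under [X in cder X]eq_fun do rewrite -mulN1r.
    apply: cderZ; apply: cderM; last exact: cder_cst.
    by apply: cder_cexp; apply: cderM; [apply: cder_real; exact: der_id|exact: cder_cst].
  rewrite /dPsi (_ : tpow a t = tpow (a - 1) t * t%:C); last first.
    by rewrite (tpowB1 a t0) -mulrA -RealCM mulVf ?mulr1// gt_eqF.
  rewrite -/(E x) -/(vl x) -/(cdecay (vl x) t). rewrite (_ : 1%:C = 1 :> C)//; ring.
have W0 x : - e < x < 1 + e -> cder (fun x => cintegral mu pos (Psi x)) x 0.
  move=> xe; apply: (cder_eq (cder_under_integral (df := dPsi) xe _ _ _ ig)).
  - by move=> y ye; apply: cintegrableZ; [exact: measurable_pos|exact: i1].
  - by move=> y t _; exact: dPsiE.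
  - exact: dg.
  have j1 := cintegrableZ (@measurable_pos R) a (i1 _ xe).
  have j2 := cintegrableZ (@measurable_pos R) (vl x) (i2 _ xe).
  rewrite /dPsi (cintegralZ (@measurable_pos R) (k * E x) (cintegrableB (@measurable_pos R) j1 j2)).
  rewrite (cintegralB (@measurable_pos R) j1 j2) (cintegralZ (@measurable_pos R) a (i1 _ xe)).
  rewrite (cintegralZ (@measurable_pos R) (vl x) (i2 _ xe)).
  by have := gamma_ibp a0 (rv _ xe); rewrite /mellin => ->; rewrite subrr mulr0.
have PsiE x : - e < x < 1 + e -> cintegral mu pos (Psi x) = E x * mellin (cdecay (vl x)) (a - 1).
  by move=> xe; rewrite /Psi (cintegralZ (@measurable_pos R) _ (i1 _ xe)).
have in0 : - e < 0 < 1 + e by apply/andP; split; lra.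
have in1 : - e < 1 < 1 + e by apply/andP; split; lra.
have := @cder0_cst _ (fun x => cintegral mu pos (Psi x)) 0 1 ltr01 _.
rewrite !PsiE// /E /vl !mul0r mulr0 cexp0 mul1r => ->; last first.
  by move=> x /andP[x0 x1]; apply: W0; apply/andP; split; lra.
rewrite !mul1r vk mulrAC /cpow mulNr cexpN -/k divff ?cexp_neq0//.
by rewrite mul1r.
Qed.

End gamma_scaling_complex.

(** * The kernel of J and its series expansion *)

Section kernel_weight.
Context {R : realType}.
Local Notation C := R[i].
Local Notation mu := (@lebesgue_measure R).
Local Notation pos := (`]0, +oo[%classic : set (measurableTypeR R)).
Variables (u : C) (u0 : 0 < Re u).

Definition ramp (t : R) : R := t - 1 + expR (- t).

Lemma ramp_ge0 t : 0 <= ramp t.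
Proof. by rewrite /ramp; have := @expR_ge1Dx R (- t); lra. Qed.

Lemma expRN_le (t : R) : 0 <= t -> expR (- t) <= (1 + t)^-1.
Proof.
by move=> t0; rewrite expRN lef_pV2 ?posrE ?expR_gt0 ?expR_ge1Dx//; lra.
Qed.

(** From exp (- t) <= 1 / (1 + t) <= 1 - t + t ^ 2, the last step because (1 - t + t ^ 2) (1 + t) =
    1 + t ^ 3. *)
Lemma ramp_le t : 0 <= t -> ramp t <= t ^+ 2.
Proof.
move=> t0; have t1 : 0 < 1 + t by lra.
have h : (1 + t)^-1 <= 1 - t + t ^+ 2.
  rewrite -[leLHS]mul1r ler_pdivrMr//.
  have -> : (1 - t + t ^+ 2) * (1 + t) = 1 + t ^+ 3 by ring.
  by rewrite lerDl exprn_ge0.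
by have := expRN_le t0; rewrite /ramp; lra.
Qed.

Lemma cmeas_ramp : cmeas pos (fun t => (ramp t)%:C).
Proof.
rewrite (_ : (fun t => _) = fun t => t%:C - 1 + (expR (- t))%:C); last first.
  by apply/funext => t; rewrite /ramp !RealCD RealCN.
apply: cmeasD (cmeas_expRN _); apply: cmeasB; last exact: cmeas_cst.
by apply: cmeas_real; exact: measurable_id.
Qed.

Definition num_weight (v : C) (t : R) : C := cdecay v t * (ramp t)%:C.

Definition lerch_weight (z : C) (t : R) : C := num_weight u t / (1 - z * (expR (- t))%:C).

Lemma cmeas_num_weight (v : C) : cmeas pos (num_weight v).
Proof. by apply: cmeasM; [exact: cmeas_cdecay|exact: cmeas_ramp]. Qed.

Lemma pw2 (t : R) : 0 < t -> pw 2 t = t ^+ 2.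
Proof. by move=> t0; rewrite (_ : 2 = 1 + 1)// pwD !pw1. Qed.

Lemma num_weight_le (v : C) (t : R) : 0 < t ->
  normc (num_weight v t) <= pw 2 t * expR (- (Re v * t)).
Proof.
move=> t0; rewrite normcM normc_real normc_cdecay ger0_norm ?ramp_ge0// mulrC pw2//.
by rewrite ler_wpM2r ?expR_ge0// ramp_le// ltW.
Qed.

Lemma num_weight_weight (v : C) : 0 < Re v -> mellin_weight (num_weight v) 2.
Proof.
move=> v0; split; first exact: cmeas_num_weight.
by exists 1, (Re v); split => // t t0; rewrite mul1r; exact: num_weight_le.
Qed.

Lemma lerch_weight_cut (z : C) : cut_plane z -> mellin_weight (lerch_weight z) 2.
Proof.
move=> /cut_plane_dist[e e0 He]; split.
  by apply: cmeasM; [exact: cmeas_num_weight|exact: cmeas_resolvent].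
exists e^-1, (Re u); split => // t t0.
rewrite normcM normcV mulrC ler_pM ?invr_ge0 ?normc_ge0 ?num_weight_le//.
have h := He _ (expRN_01 t0); rewrite lef_pV2 ?posrE//.
exact: lt_le_trans h.
Qed.

(** The denominator 1 - exp (- t) costs one of the two powers of t, through t <= (1 + t) (1 - exp (-
    t)). Half of the exponential decay is spent on absorbing the factor 1 + t. *)
Lemma lerch_weight_1 : mellin_weight (lerch_weight 1) 1.
Proof.
split; first by apply: cmeasM; [exact: cmeas_num_weight|exact: cmeas_resolvent].
have c0 : 0 < Re u / 2 by rewrite divr_gt0.
have [K [K0 HK]] := pow_exp_bound ler01 c0.
exists (1 + K), (Re u / 2); split => // t t0.
have e1 : 0 < 1 - expR (- t) by rewrite subr_gt0 -expR0 ltr_expR oppr_lt0.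
rewrite normcM normcV mul1r (_ : 1 - (expR (- t))%:C = (1 - expR (- t))%:C); last first.
  by rewrite RealCD RealCN.
rewrite normc_real gtr0_norm// ler_pdivrMr// pw1//.
apply: (le_trans (num_weight_le _ t0)); rewrite pw2//.
have h : t <= (1 + t) * (1 - expR (- t)).
  have := expRN_le (ltW t0); rewrite -[X in _ <= X -> _]mul1r ler_pdivlMr; last by lra.
  by move=> ?; lra.
have hK := HK _ t0; rewrite -/(pw 1 t) pw1// in hK.
have -> : expR (- (Re u * t)) = expR (- (Re u / 2 * t)) * expR (- (Re u / 2 * t)).
  by rewrite -expRD; congr expR; field.
set E := expR (- (Re u / 2 * t)) in hK *.
have E1 : E <= 1.
  rewrite /E -[leRHS]expR0 ler_expR oppr_le0; exact: (mulr_ge0 (ltW c0) (ltW t0)).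
have E0 : 0 < E by exact: expR_gt0.
have -> : t ^+ 2 * (E * E) = (t * E) * (t * E) by ring.
apply: (@le_trans _ _ ((t * E) * ((1 + t) * (1 - expR (- t)) * E))).
  apply: ler_wpM2l; first by apply: mulr_ge0; exact: ltW.
  by apply: ler_wpM2r; first exact: ltW.
rewrite [leLHS](_ : _ = (t * E * (1 - expR (- t))) * (E + t * E)); last by ring.
rewrite [leRHS](_ : _ = (t * E * (1 - expR (- t))) * (1 + K)); last by ring.
apply: ler_wpM2l; last exact: lerD.
by apply: mulr_ge0; [apply: mulr_ge0|]; exact: ltW.
Qed.

(* [lerch_integral u z (s + m)] is (m - 2)! times the integral over the m-cube. *)
Definition lerch_integral (z s : C) : C := mellin (lerch_weight z) (s - 2).

(* Euler's integral for the Gamma function; meaningful for 0 < Re s only. *)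
Definition gamma_integral (s : C) : C := mellin (cdecay 1) (s - 1).

Lemma gamma_integral_rec (s : C) : 0 < Re s -> gamma_integral (s + 1) = s * gamma_integral s.
Proof.
move=> s0; have r1 : 0 < Re (1 : C) by [].
by rewrite /gamma_integral (gamma_ibp s0 r1) mul1r addrK.
Qed.

(** The three summands of [ramp] give Euler integrals at s, s - 1 and s - 1 with rates v, v and v +
    1; the last two converge separately only for 1 < Re s. The factor s - 1 turns Gamma(s - 1) into
    Gamma(s). *)
Lemma mellin_num_weight (v s : C) : 0 < Re v -> 1 < Re s ->
  (s - 1) * mellin (num_weight v) (s - 2) =
  gamma_integral s * ((s - 1) * cpow v (- s) - cpow v (1 - s) + cpow (v + 1) (1 - s)).
Proof.
move=> v0 s1.
have v1 : 0 < Re (v + 1) by rewrite ReD /=; lra.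
have w1 := cdecay_weight v0; have w2 := cdecay_weight v1.
have a1 : -1 < Re (s - 1) + 0 by rewrite !cReE /=; lra.
have a2 : -1 < Re (s - 2) + 0 by rewrite !cReE /=; lra.
have i1 := mellin_integrable w1 a1.
have i2 := mellin_integrable w1 a2; have i3 := mellin_integrable w2 a2.
have E : mellin (num_weight v) (s - 2) =
    mellin (cdecay v) (s - 1) - mellin (cdecay v) (s - 1 - 1) + mellin (cdecay (v + 1)) (s - 1 - 1).
  rewrite (_ : s - 1 - 1 = s - 2); last by rewrite -addrA -opprD.
  rewrite /mellin -(cintegralB (@measurable_pos R) i1 i2) -(cintegralD (@measurable_pos R) (cintegrableB (@measurable_pos R) i1 i2) i3).
  apply: eq_cintegral => t; rewrite inE => /pos_gt0 t0.
  have -> : s - 1 = s - 2 + 1 by rewrite -[RHS]addrA; congr (_ + _); rewrite (_ : 2 = 1 + 1)// opprD subrK.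
  have -> : cdecay (v + 1) t = cdecay v t * (expR (- t))%:C.
    by rewrite /cdecay mulrDl mul1r opprD cexpD -RealCN cexp_real.
  by rewrite (tpowD (s - 2) 1) tpow1// /num_weight /ramp !RealCD RealCN; ring.
have s0 : 0 < Re s by lra.
have s10 : 0 < Re (s - 1) by rewrite !cReE /=; lra.
have G : gamma_integral s = (s - 1) * gamma_integral (s - 1) by rewrite -gamma_integral_rec// subrK.
rewrite E (mellin_cdecay s0 v0) (mellin_cdecay s10 v0) (mellin_cdecay s10 v1) -/(gamma_integral s) -/(gamma_integral (s - 1)) opprB G; ring.
Qed.

Lemma cpowV (v s : C) : (cpow v s)^-1 = cpow v (- s).
Proof. by rewrite /cpow mulNr cexpN. Qed.

(** The factor exp (- n t) of the n-th geometric term is absorbed by replacing u with u + n. The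
    integrand itself, up to a constant, dominates the partial sums, so |z| = 1 is covered whenever
    the integral converges. *)
Lemma lerch_integral_series (z s : C) : normc z <= 1 ->
  cintegrable mu pos (fun t => tpow (s - 2) t * lerch_weight z t) ->
  csum (fun n => z ^+ n * mellin (num_weight (u + n%:R)) (s - 2)) (lerch_integral z s).
Proof.
move=> z1 iJ.
pose W t := tpow (s - 2) t * num_weight u t.
pose q t := z * (expR (- t))%:C.
have q1 t : 0 < t -> normc (q t) < 1.
  move=> t0; rewrite normcM normc_real gtr0_norm ?expR_gt0//.
  apply: le_lt_trans (ler_wpM2r (expR_ge0 _) z1) _.
  by rewrite mul1r -expR0 ltr_expR oppr_lt0.
have cE n t : z ^+ n * (tpow (s - 2) t * num_weight (u + n%:R) t) = W t * q t ^+ n.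
  rewrite /W /q /num_weight exprMn -RealCX -expRM_natl.
  have -> : cdecay (u + n%:R) t = cdecay u t * (expR (n%:R * - t))%:C.
    by rewrite /cdecay mulrDl opprD cexpD natC -RealCM -RealCN cexp_real mulrN.
  by ring.
have [ir ii] := iJ.
(* The 2 bounds |1 - q ^ n| in the closed form of the partial sums; the sum of the absolute values
   of the two parts bounds the modulus and is visibly integrable. *)
pose g t := 2 * (`|Re (tpow (s - 2) t * lerch_weight z t)| + `|Im (tpow (s - 2) t * lerch_weight z t)|).
have ig : mu.-integrable pos (EFin \o g).
  have := integrableZl (@measurable_pos R) 2 (integrableD (@measurable_pos R) (integrable_norm ir) (integrable_norm ii)).
  by apply: eq_integrable => //; exact: measurable_pos.
have := cintegral_series (@measurable_pos R) (c := fun n t => z ^+ n * (tpow (s - 2) t * num_weight (u + n%:R) t))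
  (f := fun t => tpow (s - 2) t * lerch_weight z t) _ _ _ ig _.
case.
- move=> n; apply: cmeasM; first exact: cmeas_cst.
  by apply: cmeasM; [exact: cmeas_tpow|exact: cmeas_num_weight].
- exact: cintegrable_cmeas iJ.
- move=> t /pos_gt0 t0; rewrite /lerch_weight mulrA.
  have := csumZ (c := W t) (csum_geometric (q1 _ t0)); congr csum.
  by apply/funext => n; rewrite cE.
- move=> n t /pos_gt0 t0.
  rewrite [series _ _](_ : _ = W t * series (GRing.exp (q t)) n); last first.
    by rewrite /series /= mulr_sumr; apply: eq_bigr => i _; rewrite cE.
  have qn1 : q t != 1 by apply: contraTneq (q1 _ t0) => ->; rewrite normc1 ltxx.
  rewrite [series _ _](series_geometricC n qn1) mulrCA normcM /g ler_pM ?normc_ge0//.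
    apply: (le_trans (normcD _ _)); rewrite normc1 normc_opp normcX.
    by rewrite -[leRHS]/(1 + 1) lerD2l exprn_ile1 ?normc_ge0// ltW// q1.
  rewrite /lerch_weight mulrA.
  exact: normc_le.
move=> ic _; congr csum; apply/funext => n.
(* When z ^ n = 0 it cannot be divided out to recover integrability of the n-th term, but then both
   sides are 0. *)
rewrite /mellin; have [z0|z0] := eqVneq (z ^+ n) 0.
  rewrite z0 mul0r (eq_cintegral _ (g := fun=> 0)); last by move=> t _; rewrite mul0r.
  by rewrite /cintegral /= !(Rintegral_cst mu (@measurable_pos R)) !mul0r.
have := cintegrableZ (@measurable_pos R) (z ^+ n)^-1 (ic n); rewrite /= => iz.
rewrite (cintegralZ (@measurable_pos R))//.
by apply: eq_cintegrable iz; [exact: measurable_pos|move=> t _; rewrite mulrA mulVf// mul1r].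
Qed.

Lemma cut_plane_disc (z : C) : normc z < 1 -> cut_plane z.
Proof.
by move=> z1 [_]; apply/negP; rewrite -ltNge (le_lt_trans (ler_norm _))// (le_lt_trans (Re_le_normc _)).
Qed.

(** Termwise comparison. In the n-th term, (u + n + 1) ^ (1 - s) z ^ (n + 1) belongs to the series
    of Phi(z, s - 1, u) shifted by one; the missing initial term is u ^ (1 - s). *)
Lemma lerch_base (Phi : C -> C -> C -> C) (z s : C) : is_lerch Phi -> 2 < Re s ->
  normc z < 1 \/ z = 1 ->
  z * (s - 1) * lerch_integral z s =
  gamma_integral s * (z * (s - 1) * Phi z s u + (1 - z) * Phi z (s - 1) u - cpow u (1 - s)).
Proof.
move=> /(_ u u0)[hser _ _ _] s2 hz.
have iJ : cintegrable mu pos (fun t => tpow (s - 2) t * lerch_weight z t).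
  case: hz => [/cut_plane_disc/lerch_weight_cut w|->].
    by apply: mellin_integrable w _; rewrite !cReE /=; lra.
  by apply: mellin_integrable lerch_weight_1 _; rewrite !cReE /=; lra.
have z1 : normc z <= 1 by case: hz => [/ltW//|->]; rewrite normc1.
have SJ := lerch_integral_series z1 iJ.
have hz' w : 1 < Re w -> `|z| < 1 \/ `|z| = 1 /\ 1 < Re w.
  by move=> w1; case: hz => [h|->]; [left; rewrite normE ltcR|right; rewrite normr1].
have s1 : 1 < Re s by lra.
have s1' : 1 < Re (s - 1) by rewrite !cReE /=; lra.
have S0 : csum (fun n => z ^+ n / cpow (u + n%:R) s) (Phi z s u) by apply: hser; exact: hz'.
have S1 : csum (fun n => z ^+ n / cpow (u + n%:R) (s - 1)) (Phi z (s - 1) u).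
  by apply: hser; exact: hz'.
have S2 := csum_shift S1.
have SR := csumD (csumD (csumZ (c := gamma_integral s * (z * (s - 1))) S0) (csumZ (c := - (gamma_integral s * z)) S1))
  (csumZ (c := gamma_integral s) S2).
have SL := csumZ (c := z * (s - 1)) SJ.
have E : gamma_integral s * (z * (s - 1)) * Phi z s u + - (gamma_integral s * z) * Phi z (s - 1) u +
    gamma_integral s * (Phi z (s - 1) u - z ^+ 0 / cpow (u + 0%:R) (s - 1)) =
    gamma_integral s * (z * (s - 1) * Phi z s u + (1 - z) * Phi z (s - 1) u - cpow u (1 - s)).
  by rewrite addr0 expr0 mul1r cpowV opprB; ring.
rewrite -E; apply: (csum_unique SL); move: SR; congr csum.
apply/funext => n; have v0 : 0 < Re (u + n%:R).
  by rewrite ReD Re_nat ltr_wpDr.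
rewrite [RHS](_ : _ = z * z ^+ n * ((s - 1) * mellin (num_weight (u + n%:R)) (s - 2))); last by ring.
rewrite mellin_num_weight// !cpowV exprS opprB (_ : u + n.+1%:R = u + n%:R + 1); last first.
  by rewrite -addrA -(natrD _ n 1%N) addn1.
by ring.
Qed.

End kernel_weight.

(** * Continuation in z and in s *)

Section continuation.
Context {R : realType}.
Local Notation C := R[i].
Local Notation mu := (@lebesgue_measure R).
Local Notation pos := (`]0, +oo[%classic : set (measurableTypeR R)).
Variables (Phi : C -> C -> C -> C) (hPhi : is_lerch Phi) (u : C) (u0 : 0 < Re u).

Lemma analytic_at_opp_shift (f : C -> C) (c s : C) :
  analytic_at f (s - c) -> analytic_at (fun s => f (s - c)) s.
Proof. exact: analytic_at_shift. Qed.

Lemma Phi_analytic_z (z s : C) : cut_plane z -> analytic_at (fun z => Phi z s u) z.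
Proof. by have [_ /(_ s)/analytic_onP H _ _] := hPhi u0; exact: H. Qed.

Lemma Phi_analytic_s (z s : C) : cut_plane z -> analytic_at (fun s => Phi z s u) s.
Proof. by move=> cz; have [_ _ /(_ z cz)/analytic_onP H _] := hPhi u0; exact: H. Qed.

Lemma Phi1_analytic_s (s : C) : s != 1 -> analytic_at (fun s => Phi 1 s u) s.
Proof. by move=> s1; have [_ _ _ /analytic_onP H] := hPhi u0; exact: H. Qed.

Lemma cpow_analytic (s : C) : analytic_at (fun s => cpow u (1 - s)) s.
Proof.
have -> : (fun s => cpow u (1 - s)) = fun s => cexp ((- clog u) * s + clog u).
  by apply/funext => x; rewrite /cpow (_ : (1 - x) * clog u = - clog u * x + clog u)//; ring.
exact: analytic_at_cexp.
Qed.

Lemma lerch_integral_analytic_z (z s : C) : -1 < Re s -> cut_plane z ->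
  analytic_at (fun z => lerch_integral u z s) z.
Proof.
move=> s1 cz; have w := num_weight_weight u0.
have s2 : -1 < Re (s - 2) + 2 - 0 by rewrite !cReE /=; lra.
have [g [ig gP]] := mellin_dominated w (lexx 0) s2.
have mW : cmeas pos (fun t => tpow (s - 2) t * num_weight u t).
  by apply: cmeasM; [exact: cmeas_tpow|exact: cmeas_num_weight].
have Wg t : 0 < t -> normc (tpow (s - 2) t * num_weight u t) <= g t.
  by move=> t0; have := gP _ t0; rewrite mul0r expR0 mul1r.
have -> : (fun z => lerch_integral u z s) = fun z =>
    cintegral mu pos (fun t => tpow (s - 2) t * num_weight u t / (1 - z * (expR (- t))%:C)).
  apply/funext => y; rewrite /lerch_integral /mellin; apply: eq_cintegral => t _.
  by rewrite /lerch_weight mulrA.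
exact: resolvent_analytic mW ig Wg cz.
Qed.

Lemma lerch_integral_analytic_s (z s : C) :
  (cut_plane z /\ -1 < Re s) \/ (z = 1 /\ 0 < Re s) -> analytic_at (fun s => lerch_integral u z s) s.
Proof.
case=> [[cz s1]|[-> s0]]; apply: analytic_at_opp_shift.
  by apply: mellin_analytic (lerch_weight_cut u0 cz) _; rewrite !cReE /=; lra.
by apply: mellin_analytic (lerch_weight_1 u0) _; rewrite !cReE /=; lra.
Qed.

(** The shift by 1 moves the pole of the Gamma function at 0 out of reach: the integral converges
    down to -1 < Re s. *)
Lemma gamma_integral1_analytic (s : C) : -1 < Re s -> analytic_at (fun s => gamma_integral (s + 1)) s.
Proof.
move=> s1; have r1 : 0 < Re (1 : C) by [].
have s0 : -1 < Re s + 0 by lra.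
have -> : (fun s => gamma_integral (s + 1)) = mellin (cdecay (1 : C)).
  by apply/funext => x; rewrite /gamma_integral addrK.
exact: mellin_analytic (cdecay_weight r1) s0.
Qed.

Lemma Re_segment (p q : C) t : Re (segment p q t) = Re p + t * (Re q - Re p).
Proof. by rewrite /segment !cReE /= mul0r subr0. Qed.
Lemma Im_segment (p q : C) t : Im (segment p q t) = Im p + t * (Im q - Im p).
Proof. by rewrite /segment !cReE /= mul0r addr0. Qed.

Lemma lt_convex (a p q t : R) : a < p -> a < q -> 0 <= t <= 1 -> a < p + t * (q - p).
Proof.
move=> ap aq /andP[t0 t1]; rewrite -subr_gt0.
rewrite (_ : _ - a = (1 - t) * (p - a) + t * (q - a)); last by ring.
have [->|tn0] := eqVneq t 0; first by rewrite subr0 mul0r mul1r addr0 subr_gt0.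
by rewrite ltr_wpDl// ?mulr_ge0 ?subr_ge0// ?ltW// mulr_gt0 ?subr_gt0// lt_def tn0.
Qed.

(* At s fixed with 2 < Re s, continue in z from the unit disc. *)
Lemma lerch_formula_large (z s : C) : 2 < Re s -> cut_plane z ->
  z * (s - 1) * lerch_integral u z s =
  gamma_integral s * (z * (s - 1) * Phi z s u + (1 - z) * Phi z (s - 1) u - cpow u (1 - s)).
Proof.
move=> s2 cz; apply/eqP; rewrite -subr_eq0; apply/eqP.
pose D z := z * (s - 1) * lerch_integral u z s -
  gamma_integral s * (z * (s - 1) * Phi z s u + (1 - z) * Phi z (s - 1) u - cpow u (1 - s)).
apply: (@identity_on_segment _ D 0 z).
  move=> t /andP[t0 t1].
  (* The cut plane is star-shaped about 0: if t z lies on the cut then t > 0, so z is real, and Re z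
     >= t Re z >= 1. *)
  have ct : cut_plane (segment 0 z t).
    move=> [i0 r1]; rewrite Im_segment Re_segment /= !subr0 !add0r in i0 r1.
    have tp : 0 < t.
      by rewrite lt_def t0 andbT; apply: contraTneq r1 => ->; rewrite mul0r -ltNge.
    have iz : Im z = 0 by apply/eqP; move/eqP: i0; rewrite mulf_eq0 gt_eqF.
    apply: cz; split => //; apply: (le_trans r1).
    have [r0|r0] := leP 0 (Re z); first by rewrite ler_piMl.
    have h : t * Re z < 0 by rewrite pmulr_rlt0.
    by have := le_lt_trans r1 h; rewrite ltr10.
  have c y k : analytic_at (fun=> k : C) y by exact: analytic_at_cst.
  have i y : analytic_at (id : C -> C) y by exact: analytic_at_id.
  apply: analytic_atB.
    apply: analytic_atM; first exact: (analytic_atM (i _) (c _ (s - 1))).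
    by apply: lerch_integral_analytic_z => //; lra.
  apply: (analytic_atM (c _ (gamma_integral s))); apply: analytic_atB; last exact: c.
  apply: analytic_atD.
    apply: analytic_atM; first exact: (analytic_atM (i _) (c _ (s - 1))).
    exact: Phi_analytic_z.
  apply: analytic_atM; first exact: (analytic_atB (c _ 1) (i _)).
  exact: Phi_analytic_z.
exists 1 => // y; rewrite subr0 => y1.
by rewrite /D (lerch_base u0 hPhi s2 (or_introl y1)) subrr.
Qed.

Lemma lerch_continue_s (D : C -> C) (p q : C) : 2 < Re p ->
  (forall t : R, 0 <= t <= 1 -> analytic_at D (segment p q t)) ->
  (forall s, 2 < Re s -> D s = 0) -> D q = 0.
Proof.
move=> p2 Da D0; apply: identity_on_segment Da _.
exists (Re p - 2); first by rewrite subr_gt0.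
move=> s sp; apply: D0.
have := le_lt_trans (Re_le_normc _) sp; rewrite !cReE ltr_norml => /andP[h _]; lra.
Qed.

(** Multiplying [lerch_formula_large] by s replaces Gamma(s) by Gamma(s + 1); every factor is then
    analytic on the half-plane -1 < Re s, which is convex, so the segment from 4 to s stays
    inside. *)
Lemma lerch_formula_cut (z s : C) : -1 < Re s -> cut_plane z ->
  z * (s * (s - 1)) * lerch_integral u z s =
  gamma_integral (s + 1) * (z * (s - 1) * Phi z s u + (1 - z) * Phi z (s - 1) u - cpow u (1 - s)).
Proof.
move=> s1 cz; apply/eqP; rewrite -subr_eq0; apply/eqP.
pose D s := z * (s * (s - 1)) * lerch_integral u z s -
  gamma_integral (s + 1) * (z * (s - 1) * Phi z s u + (1 - z) * Phi z (s - 1) u - cpow u (1 - s)).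
have c y k : analytic_at (fun=> k : C) y by exact: analytic_at_cst.
have i y : analytic_at (id : C -> C) y by exact: analytic_at_id.
apply: (@lerch_continue_s D 4%:R s); first by rewrite Re_nat ltr_nat.
- move=> t /andP[t0 t1].
  have rt : -1 < Re (segment 4%:R s t).
    by rewrite Re_segment Re_nat; apply: lt_convex => //; [lra|rewrite t0].
  apply: analytic_atB.
    apply: analytic_atM.
      apply: (analytic_atM (c _ z)).
      exact: (analytic_atM (i _) (analytic_atB (i _) (c _ 1))).
    by apply: lerch_integral_analytic_s; left.
  apply: analytic_atM; first exact: gamma_integral1_analytic.
  apply: analytic_atB; last exact: cpow_analytic.
  apply: analytic_atD.
    apply: analytic_atM; last exact: Phi_analytic_s.
    by apply: (analytic_atM (c _ z)); exact: (analytic_atB (i _) (c _ 1)).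
  apply: (analytic_atM (c _ (1 - z))); apply: (@analytic_at_opp_shift (fun s => Phi z s u) 1).
  exact: Phi_analytic_s.
- move=> y y2; rewrite /D; have y0 : 0 < Re y by lra.
  have E : z * (y * (y - 1)) * lerch_integral u z y = y * (z * (y - 1) * lerch_integral u z y) by ring.
  rewrite E lerch_formula_large//.
  by rewrite (gamma_integral_rec y0) (mulrA y (gamma_integral y)) subrr.
Qed.

(* The segment along which s is continued starts at 4 + i or 4 - i, so as to avoid
   the pole of Phi at s = 1. *)
Lemma lerch_formula_1 (s : C) : 0 < Re s -> s != 1 ->
  s * (s - 1) * lerch_integral u 1 s =
  gamma_integral (s + 1) * ((s - 1) * Phi 1 s u - cpow u (1 - s)).
Proof.
move=> s0 sn1; apply/eqP; rewrite -subr_eq0; apply/eqP.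
pose D s := s * (s - 1) * lerch_integral u 1 s -
  gamma_integral (s + 1) * ((s - 1) * Phi 1 s u - cpow u (1 - s)).
have c y k : analytic_at (fun=> k : C) y by exact: analytic_at_cst.
have i y : analytic_at (id : C -> C) y by exact: analytic_at_id.
(* With [e] on the side of Im s, the imaginary part (1 - t) e + t Im s can vanish only at t = 1,
   where the point is s itself. *)
pose e : R := if 0 <= Im s then 1 else -1.
apply: (@lerch_continue_s D (4 +i* e) s); first by rewrite /=; lra.
- move=> t /andP[t0 t1].
  have rt : 0 < Re (segment (4 +i* e) s t).
    by rewrite Re_segment /=; apply: lt_convex => //; rewrite t0.
  have nt : segment (4 +i* e) s t != 1.
    apply/eqP => st; have := congr1 Im st; rewrite Im_segment /= => it.
    have [tE|tn] := eqVneq t 1.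
      by move: st; rewrite /segment tE mul1r addrC subrK => /eqP; rewrite (negPf sn1).
    have {}t1 : t < 1 by rewrite lt_neqAle tn.
    move: it; rewrite /e; case: ifP => [i0|/negbT]; last rewrite -ltNge => i0.
      by have := mulr_ge0 t0 i0; lra.
    by have := mulr_ge0_le0 t0 (ltW i0); lra.
  apply: analytic_atB.
    apply: analytic_atM.
      exact: (analytic_atM (i _) (analytic_atB (i _) (c _ 1))).
    by apply: lerch_integral_analytic_s; right.
  apply: analytic_atM; first by apply: gamma_integral1_analytic; lra.
  apply: analytic_atB; last exact: cpow_analytic.
  apply: analytic_atM; last exact: Phi1_analytic_s.
  exact: (analytic_atB (i _) (c _ 1)).
- move=> y y2; rewrite /D; have y0 : 0 < Re y by lra.
  have := lerch_base u0 hPhi y2 (or_intror erefl).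
  rewrite !mul1r subrr mul0r addr0 => E.
  by rewrite -(mulrA y (y - 1)) E (gamma_integral_rec y0) (mulrA y (gamma_integral y)) subrr.
Qed.

End continuation.

(** * The image of the weighted cube under the product *)

Section cube_integral.
Context {R : realType}.
Local Notation T := (measurableTypeR R).
Local Notation mu := (@lebesgue_measure R).
Local Open Scope ereal_scope.

(** [nu], which is a times the image of Lebesgue measure under x -> a x, agrees with it on
    intervals, hence everywhere by uniqueness. *)
Lemma ge0_integral_scale (a : R) (f : T -> \bar R) : (0 < a)%R ->
  measurable_fun setT f -> (forall x, 0 <= f x) ->
  \int[mu]_x f x = a%:E * \int[mu]_x f (a * x)%R.
Proof.
move=> a0 mf f0; pose an : {nonneg R} := NngNum (ltW a0).
have mM : measurable_fun setT (fun x : T => (a * x)%R : T) by exact: mulrl_measurable.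
pose nu := mscale an (measure_function_pushforward__canonical__measure_function_Measure mu mM).
transitivity (\int[nu]_x f x).
  apply: eq_measure_integral => A mA _; apply: lebesgue_measure_unique => //= _ [[c d] _ <-].
  rewrite /nu /mscale /= /pushforward.
  rewrite (_ : _ @^-1` _ = `]c / a, d / a]%classic)%R; last first.
    by apply/seteqP; split=> x /=; rewrite !in_itv/= ltr_pdivrMr// ler_pdivlMr// mulrC.
  rewrite !lebesgue_measure_itv/= !lte_fin ltr_pM2r ?invr_gt0//.
  case: ifP => _; last by rewrite mule0.
  by rewrite -!EFinD -EFinM mulrBr !(mulrC a) !divfK// gt_eqF.
rewrite ge0_integral_mscale//=; congr (_ * _).
by rewrite ge0_integral_pushforward.
Qed.

Lemma measurable_unit_cube m : measurable (@unit_cube R m).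
Proof.
rewrite (_ : unit_cube m = \bigcap_(i in [set: 'I_m])
    ((fun x : m.-tuple T => tnth x i) @^-1` `[0%R, 1%R]%classic)); last first.
  apply/seteqP; split => x /= H i; first by move=> _; rewrite /= in_itv/=; exact: H.
  by have := H i I; rewrite /= in_itv.
apply: fin_bigcap_measurable => // i _.
by rewrite -[X in measurable X]setTI; apply: measurable_tnth => //; exact: measurable_itv.
Qed.

(** The measure on tuples of length m + 1 is by definition the image of a product measure under
    [cons_pair], and the preimage of the cube is a product set; the rest is Tonelli. *)
Lemma ge0_integral_cube_cons m (F : m.+1.-tuple T -> \bar R) :
  measurable_fun setT F -> (forall x, unit_cube m.+1 x -> 0 <= F x) ->
  \int[lebesgue_tuple m.+1]_(x in unit_cube m.+1) F x =
  \int[mu]_(a in `[0%R, 1%R]) \int[lebesgue_tuple m]_(y in unit_cube m) F (cons_pair (a, y)).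
Proof.
move=> mF F0.
have mc := @measurable_cons_pair R m.
transitivity (\int[pushforward (mu \x lebesgue_tuple m) (@cons_pair R m)]_(x in unit_cube m.+1) F x).
  by [].
rewrite ge0_integral_pushforward//; last 3 first.
- exact: measurable_unit_cube.
- exact: measurable_funS mF.
- by move=> x; rewrite inE; exact: F0.
have cE : @cons_pair R m @^-1` unit_cube m.+1 = `[0%R, 1%R]%classic `*` unit_cube m.
  apply/seteqP; split => -[a y] /= H.
    split=> [|i]; first by have := H ord0; rewrite /= in_itv.
    by have := H (lift ord0 i); rewrite tnthS.
  case: H; rewrite in_itv/= => Ha Hy i.
  by case: (unliftP ord0 i) => [j ->|->]; rewrite ?tnthS//; exact: Hy.
rewrite cE.
rewrite integral_mkcond fubini_tonelli1; last 2 first.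
- apply/(measurable_restrictT _ _).1.
    by apply: measurableX; [exact: measurable_itv|exact: measurable_unit_cube].
  by apply: measurable_funS (measurableT_comp mF mc).
- by move=> x; rewrite /patch; case: ifP => //; rewrite inE -cE => ?; exact: F0.
rewrite [RHS]integral_mkcond; apply: eq_integral => a _; rewrite /fubini_F /patch.
case: ifPn => ai.
  rewrite [RHS]integral_mkcond; apply: eq_integral => y _ /=; rewrite /patch.
  by rewrite in_setX/= ai.
apply: integral0_eq => y _ /=.
by rewrite in_setX/= (negbTE ai).
Qed.

End cube_integral.

(** * Densities for the product of the coordinates *)

Section product_density.
Context {R : realType}.
Local Notation T := (measurableTypeR R).
Local Notation mu := (@lebesgue_measure R).

(* The density at y, with l = - ln y, of the product of k independent uniform
   variables on ]0, 1[; the junk value at k = 0 makes [der_log_density] hold. *)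
Definition log_density k (l : R) : R := if k is k'.+1 then l ^+ k' / k'`!%:R else 0.

Lemma der_log_density k l : der (log_density k) l (log_density k.-1 l).
Proof.
case: k => [|[|k]] /=; first exact: der_cst.
  by under [X in der X]eq_fun do rewrite expr0; exact: der_cst.
have dX n : der (fun x : R => x ^+ n) l (n%:R * l ^+ n.-1).
  elim: n => [|n IH]; first by rewrite mul0r; under [X in der X]eq_fun do rewrite expr0; exact: der_cst.
  under [X in der X]eq_fun do rewrite exprS.
  apply: (der_eq (derM (der_id l) IH)); rewrite mul1r mulrS mulrDl mul1r; congr (_ + _).
  case: n {IH} => [|n]; first by rewrite !mul0r mulr0.
  by rewrite mulrCA -exprS.
apply: (der_eq (derM (dX k.+1) (der_cst _ _))).
rewrite mulr0 addr0 /= factS natrM; field.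
by rewrite ?nat1r ?natr1 !pnatr_eq0 -lt0n fact_gt0.
Qed.

Lemma log_density_ge0 k l : 0 <= l -> 0 <= log_density k l.
Proof. by move=> l0; case: k => [|k] //=; rewrite divr_ge0// exprn_ge0. Qed.

Lemma log_density_mul k l : l * log_density k l = k%:R * log_density k.+1 l.
Proof.
case: k => [|k] /=; first by rewrite mulr0 mul0r.
rewrite factS natrM exprS; field.
by rewrite ?nat1r ?natr1 !pnatr_eq0 -lt0n fact_gt0.
Qed.

Lemma log_density0 k : log_density k.+2 0 = 0 :> R.
Proof. by rewrite /= exprS !mul0r. Qed.

(* The density at y of the image of [cube_weight] times Lebesgue measure under
   [cube_prod], with l = - ln y. *)
Definition weight_density m (l y : R) : R := (m%:R - 1) * log_density m l - (1 - y) * log_density m.-1 l.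

(** By [log_density_mul] the density factors as (l - (1 - y)) times [log_density m.-1 l]. *)
Lemma weight_density_ge0 m (l y : R) : (0 < m)%N -> 0 <= l -> 1 - y <= l -> 0 <= weight_density m l y.
Proof.
case: m => // m _ l0 yl; rewrite /weight_density /= -natr1 addrK -log_density_mul -mulrBl.
by rewrite mulr_ge0 ?subr_ge0 ?log_density_ge0.
Qed.

Definition cube_prod m (x : m.-tuple T) : R := \prod_(i < m) tnth x i.

Definition cube_weight m (x : m.-tuple T) : R :=
  m%:R - 1 - \sum_(1 <= k < m) \prod_(i < m | (i < k)%N) tnth x i.

Lemma cube_prod_cons m (a : T) (y : m.-tuple T) : cube_prod (cons_pair (a, y)) = a * cube_prod y.
Proof.
by rewrite /cube_prod big_ord_recl; congr (_ * _); apply: eq_bigr => i _; rewrite tnthS.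
Qed.

Lemma cube_weight_cons m (a : T) (y : m.+1.-tuple T) :
  cube_weight (cons_pair (a, y)) = m.+1%:R * (1 - a) + a * cube_weight y.
Proof.
rewrite /cube_weight.
have -> : \sum_(1 <= k < m.+2) \prod_(i < m.+2 | (i < k)%N) tnth (cons_pair (a, y)) i =
          a + a * \sum_(1 <= k < m.+1) \prod_(i < m.+1 | (i < k)%N) tnth y i.
  rewrite big_add1 /= big_nat_recl//; congr (_ + _).
    by rewrite big_mkcond big_ord_recl /= big1 ?mulr1.
  rewrite big_add1 mulr_sumr; apply: eq_bigr => k _.
  rewrite big_mkcond big_ord_recl /= [in RHS]big_mkcond; congr (_ * _).
  apply: eq_bigr => i _. by rewrite /bump leq0n add1n ltnS tnthS.
by rewrite -(natr1 m.+1); ring.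
Qed.

Lemma cube_weight1 (x : 1.-tuple T) : cube_weight x = 0.
Proof. by rewrite /cube_weight big_geq// subr0 subrr. Qed.

Lemma measurable_prod_tnth m (P : pred 'I_m) :
  measurable_fun [set: m.-tuple T] (fun x => \prod_(i < m | P i) tnth x i : R).
Proof.
rewrite (_ : (fun x => _) = fun x => \prod_(i < m) (if P i then tnth x i else 1) : R); last first.
  by apply/funext => x; rewrite big_mkcond.
apply: measurable_prod => i _; case: (P i); last exact: measurable_cst.
exact: measurable_tnth.
Qed.

Lemma measurable_cube_prod m : measurable_fun setT (@cube_prod m).
Proof. exact: measurable_prod_tnth. Qed.

Lemma measurable_cube_weight m : measurable_fun setT (@cube_weight m).
Proof.
apply: measurable_funB; first exact: measurable_cst.
by apply: measurable_sum => k; exact: measurable_prod_tnth.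
Qed.

Lemma cube_weight_ge0 m (x : m.+1.-tuple T) : unit_cube m.+1 x -> 0 <= cube_weight x.
Proof.
move=> cx; rewrite /cube_weight subr_ge0 -natr1 addrK.
apply: (@le_trans _ _ (\sum_(1 <= k < m.+1) 1)).
  by apply: ler_sum => k _; apply: prodr_ile1 => i _; exact: cx.
by rewrite sumr_const_nat subn1.
Qed.

Lemma measurable_invr : measurable_fun [set: T] (fun x : T => x^-1 : R).
Proof.
have [+ _] := cmeasV (cmeas_real (@measurable_id _ T setT)).
by under eq_fun do rewrite -RealCV /=.
Qed.

Lemma measurable_log_density d (U : measurableType d) (f : U -> R) k :
  measurable_fun setT f -> measurable_fun setT (fun x => log_density k (f x)).
Proof.
move=> mf; case: k => [|k] /=; first exact: measurable_cst.
by apply: measurable_funM; [exact: measurable_funX|exact: measurable_cst].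
Qed.

(* Density at the product y of (al * cube_weight + be) restricted to first
   coordinate a, as given by [cube_weight_cons]. *)
Definition fiber_density m (al be a y : R) : R :=
  al * weight_density m (ln a - ln y) (y * a^-1) +
  (al * m%:R * (1 - a) + be) * log_density m (ln a - ln y) * a^-1.

Lemma fiber_density_ge0 m (al be a y : R) : (0 < m)%N -> 0 <= al -> 0 <= be ->
  0 < y -> y < a -> a <= 1 -> 0 <= fiber_density m al be a y.
Proof.
move=> m0 al0 be0 y0 ya a1; have a0 : 0 < a by exact: lt_trans ya.
have l0 : 0 <= ln a - ln y by rewrite subr_ge0 ler_ln ?posrE// ltW.
have yl : 1 - y * a^-1 <= ln a - ln y.
  rewrite -ln_div ?posrE//.
  have := @expR_ge1Dx R (ln (y / a)); rewrite lnK ?posrE ?divr_gt0//.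
  by rewrite !ln_div ?posrE// => ?; lra.
apply: addr_ge0; first by rewrite mulr_ge0// weight_density_ge0.
rewrite mulr_ge0 ?invr_ge0 ?(ltW a0)// mulr_ge0 ?log_density_ge0//.
by rewrite addr_ge0// !mulr_ge0// subr_ge0.
Qed.

Lemma integral_fiber_density m (al be y : R) : (0 < m)%N -> 0 < y -> y < 1 ->
  (\int[mu]_(a in `]y, 1%R[) (fiber_density m al be a y)%:E =
   (al * weight_density m.+1 (- ln y) y + be * log_density m.+1 (- ln y))%:E)%E.
Proof.
move=> m0 y0 y1.
(* A primitive in a. It vanishes at a = y, where the logarithm is 0 and [log_density] of index m + 1
   >= 2 vanishes, and its value at a = 1 is the right-hand side. *)
pose P a := al * (m%:R * log_density m.+1 (ln a - ln y) - (a - y) * log_density m (ln a - ln y)) +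
  be * log_density m.+1 (ln a - ln y).
have pa a : y <= a <= 1 -> 0 < a by move=> /andP[ya _]; exact: lt_le_trans ya.
have dh k a : 0 < a -> der (fun a => log_density k (ln a - ln y)) a (log_density k.-1 (ln a - ln y) * a^-1).
  move=> a0; apply: der_comp; first exact: der_log_density.
  by apply: (der_eq (derB (der_ln a0) (der_cst _ _))); rewrite subr0.
have dk a : y <= a <= 1 -> derivable (fun a => fiber_density m al be a y) a 1.
  move=> /pa a0; have an0 : a != 0 by rewrite gt_eqF.
  apply: der_derivable; apply: derD.
    apply: derZ; apply: derB; first by apply: derZ; exact: dh.
    apply: derM; last exact: dh.
    apply: derB; first exact: der_cst.
    by apply: derZ; apply: (derV (f := id)) => //; exact: der_id.
  apply: derM; last by apply: (derV (f := id)) => //; exact: der_id.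
  apply: derM; last exact: dh.
  apply: derD; last exact: der_cst.
  by apply: derZ; apply: derB; [exact: der_cst|exact: der_id].
rewrite -(@integral_itv_bndoo _ _ _ _ true false); last first.
  apply/measurable_EFinP; apply: open_continuous_measurable_fun; first exact: interval_open.
  move=> a; rewrite inE/= in_itv/= => /andP[/ltW ya /ltW a1].
  by apply: differentiable_continuous; apply/derivable1_diffP; apply: dk; rewrite ya.
rewrite (@FTC_derivable _ _ P)//.
  congr EFin; rewrite /P subrr ln1 sub0r subrr mul0r subr0.
  case: m m0 {P pa dh dk} => // m _; rewrite log_density0 /weight_density -[m.+2%:R]natr1 addrK /=.
  by ring.
move=> a ya; have a0 := pa _ ya; have an0 : a != 0 by rewrite gt_eqF.
apply: der_eq.
  apply: derD; last by apply: derZ; exact: dh.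
  apply: derZ; apply: derB; first by apply: derZ; exact: dh.
  apply: derM; last exact: dh.
  by apply: derB; [exact: der_id|exact: der_cst].
by rewrite /fiber_density /weight_density /=; field.
Qed.

End product_density.

(** * Image of the weighted cube, by induction on the dimension *)

Section cube_density.
Context {R : realType}.
Local Notation T := (measurableTypeR R).
Local Notation mu := (@lebesgue_measure R).
Local Notation I01 := (`]0%R, 1%R[%classic : set T).
Local Open Scope ereal_scope.

Lemma oneNln_le (y : R) : (0 < y -> 1 - y <= - ln y)%R.
Proof. by move=> y0; have := @expR_ge1Dx R (ln y); rewrite lnK// => ?; lra. Qed.

Lemma measurable_cube_integrand m (al be : R) (G : T -> R) : measurable_fun setT G ->
  measurable_fun setT (fun x : m.-tuple T => ((al * cube_weight x + be) * G (cube_prod x))%:E).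
Proof.
move=> mG; apply/measurable_EFinP; apply: measurable_funM.
  apply: measurable_funD; last exact: measurable_cst.
  by apply: measurable_funM; [exact: measurable_cst|exact: measurable_cube_weight].
by apply: measurableT_comp => //; exact: measurable_cube_prod.
Qed.

Lemma measurable_fiber_density m (al be : R) :
  measurable_fun setT (fun p : T * T => fiber_density m al be p.1 p.2).
Proof.
have m1 := @measurable_fst _ _ T T; have m2 := @measurable_snd _ _ T T.
have ml : measurable_fun setT (fun p : T * T => ln p.1 - ln p.2)%R.
  by apply: measurable_funB; apply: measurableT_comp => //; exact: measurable_ln.
have mi : measurable_fun setT (fun p : T * T => p.1^-1)%R.
  by apply: (measurableT_comp (@measurable_invr R)).
have mh k := measurable_log_density k ml.
have mc c : measurable_fun setT (fun=> c : R) by move=> ?; exact: measurable_cst.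
apply: measurable_funD.
  apply: measurable_funM => //; apply: measurable_funB; apply: measurable_funM => //.
  by apply: measurable_funB => //; exact: measurable_funM.
apply: measurable_funM => //; apply: measurable_funM => //; apply: measurable_funD => //.
by apply: measurable_funM => //; exact: measurable_funB.
Qed.

(** Extended by 0 outside the triangle 0 < y < a < 1, so that the exchange of integrals is Tonelli
    on the whole plane. *)
Definition kernel_fun m (al be : R) (G : T -> R) (p : T * T) : R :=
  (\1_[set p : T * T | 0 < p.2 < p.1 /\ p.1 < 1] p * (G p.2 * fiber_density m al be p.1 p.2))%R.

Lemma measurable_kernel_fun m (al be : R) (G : T -> R) : measurable_fun setT G ->
  measurable_fun setT (kernel_fun m al be G).
Proof.
move=> mG; have m1 := @measurable_fst _ _ T T; have m2 := @measurable_snd _ _ T T.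
apply: measurable_funM.
  apply: measurable_indic.
  rewrite (_ : [set p | _] = [set p : T * T | 0 < p.2]%R `&` [set p | p.2 < p.1]%R `&` [set p | p.1 < 1]%R); last first.
    by apply/seteqP; split => p /=; [move=> [/andP[? ?] ?]|move=> [[-> ->] ?]].
  have lt (f g : T * T -> R) : measurable_fun setT f -> measurable_fun setT g ->
      measurable [set p | f p < g p]%R.
    move=> mf mg; rewrite (_ : [set p | _] = (fun p => f p < g p)%R @^-1` [set true]); last first.
      by apply/seteqP; split => p /=.
    by rewrite -[X in measurable X]setTI; apply: measurable_fun_ltr.
  apply: measurableI; first apply: measurableI.
  - by apply: lt; [exact: measurable_cst|exact: measurable_snd].
  - by apply: lt; [exact: measurable_snd|exact: measurable_fst].
  - by apply: lt; [exact: measurable_fst|exact: measurable_cst].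
have mg2 : measurable_fun setT (fun p : T * T => G p.2) by exact: measurableT_comp.
apply: measurable_funM; first exact: mg2.
exact: measurable_fiber_density.
Qed.

Lemma kernel_fun_ge0 m (al be : R) (G : T -> R) p : (0 < m)%N -> (0 <= al)%R -> (0 <= be)%R ->
  (forall x, 0 <= G x)%R -> (0 <= kernel_fun m al be G p)%R.
Proof.
move=> m0 al0 be0 G0; rewrite /kernel_fun indicE.
have [|] := boolP (p \in _); last by rewrite mul0r.
rewrite inE mul1r /= => -[/andP[p0 p1] p2].
by rewrite mulr_ge0// fiber_density_ge0// ltW.
Qed.

(** The substitution y -> a y makes the full product the variable of integration; the factors a^-1
    in [fiber_density] are its Jacobian, cancelled in the first term by the coefficient a of the
    tail weight. *)
Lemma cube_density_fiber m (al be a : R) (G : T -> R) : (0 < m)%N ->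
  (0 <= al)%R -> (0 <= be)%R -> measurable_fun setT G -> (forall x, 0 <= G x)%R -> I01 a ->
  \int[mu]_(y in I01) (G (a * y) * (al * a * weight_density m (- ln y) y +
      (al * m%:R * (1 - a) + be) * log_density m (- ln y)))%:E =
  \int[mu]_y (kernel_fun m al be G (a, y))%:E.
Proof.
move=> m0 al0 be0 mG G0; rewrite /= in_itv/= => /andP[a0 a1].
rewrite [RHS](ge0_integral_scale a0); last 2 first.
- apply/measurable_EFinP.
  exact: (measurableT_comp (measurable_kernel_fun m al be mG) (pair1_measurable a)).
- by move=> x; rewrite lee_fin kernel_fun_ge0.
rewrite -ge0_integralZl//; last 3 first.
- apply/measurable_EFinP.
  have mm : measurable_fun setT (fun y : T => (a * y)%R : T) by exact: mulrl_measurable.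
  have mp := measurableT_comp (pair1_measurable a) mm.
  exact: (measurableT_comp (measurable_kernel_fun m al be mG) mp).
- by move=> x _; rewrite lee_fin kernel_fun_ge0.
- by rewrite lee_fin ltW.
rewrite [LHS]integral_mkcond; apply: eq_integral => y _; rewrite patchE -EFinM.
case: ifPn => [|yn].
  rewrite inE /= in_itv/= => /andP[y0 y1].
  rewrite /kernel_fun indicE mem_set; last first.
    by rewrite /= mulr_gt0// gtr_pMr// a1 y1.
  rewrite /= mul1r; congr EFin.
  rewrite /fiber_density lnM ?posrE// opprD addrA subrr sub0r.
  rewrite [(a * y / a)%R]mulrAC divff ?gt_eqF// mul1r.
  by field; rewrite gt_eqF.
rewrite /kernel_fun indicE memNset ?mul0r ?mulr0//=.
move=> [/andP[ay0 ay1] _]; move/negP: yn; apply; rewrite inE /= in_itv/=.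
by rewrite pmulr_rgt0 in ay0 *; rewrite // ay0 -(gtr_pMr _ a0).
Qed.

(* The weight of a cons is m (1 - a) + a * (weight of the tail), so the induction
   on the dimension needs an affine function of the weight. *)
Lemma cube_density m (al be : R) (G : T -> R) : (0 < m)%N ->
  (0 <= al)%R -> (0 <= be)%R -> measurable_fun setT G -> (forall x, 0 <= G x)%R ->
  \int[lebesgue_tuple m]_(x in unit_cube m) ((al * cube_weight x + be) * G (cube_prod x))%:E =
  \int[mu]_(y in I01) (G y * (al * weight_density m (- ln y) y + be * log_density m (- ln y)))%:E.
Proof.
elim: m al be G => // m IH al be G _ al0 be0 mG G0.
have F0 x : unit_cube m.+1 x -> 0 <= ((al * cube_weight x + be) * G (cube_prod x))%:E.
  by move=> cx; rewrite lee_fin mulr_ge0// addr_ge0// mulr_ge0// cube_weight_ge0.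
rewrite ge0_integral_cube_cons//; last exact: measurable_cube_integrand.
(* In dimension 1 the tail measure is a Dirac mass at the empty tuple, the weight is 0, and the
   product is uniform on ]0, 1[. *)
case: m IH F0 => [|m] IH F0.
  transitivity (\int[mu]_(a in `[0%R, 1%R]) (be * G a)%:E).
    apply: eq_integral => a; rewrite inE => ai.
    rewrite /= integral_dirac; last 2 first.
    - exact: measurable_unit_cube.
    - apply: (@measurable_funS _ _ _ _ setT) => //.
      have mc1 := measurableT_comp (@measurable_cons_pair R 0) (pair1_measurable a).
      exact: (measurableT_comp (measurable_cube_integrand al be mG) mc1).
    rewrite diracE mem_set ?mul1e; last by move=> -[].
    by rewrite cube_weight1 cube_prod_cons /cube_prod big_ord0 mulr1 mulr0 add0r.
  rewrite integral_itv_bndoo; last first.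
    apply/measurable_EFinP; apply: measurable_funM; first exact: measurable_cst.
    exact: measurable_funS mG.
  apply: eq_integral => y _; congr EFin.
  by rewrite /weight_density /= expr0 subrr fact0 divr1 mul0r mulr0 subr0 mulr0 add0r mulr1 mulrC.
pose K := kernel_fun m.+1 al be G.
have mK : measurable_fun setT (EFin \o K) by apply/measurable_EFinP; exact: measurable_kernel_fun.
have K0 p : 0 <= (EFin \o K) p by rewrite lee_fin kernel_fun_ge0.
have fiber a : I01 a -> \int[lebesgue_tuple m.+1]_(y in unit_cube m.+1)
     ((al * cube_weight (cons_pair (a, y)) + be) * G (cube_prod (cons_pair (a, y))))%:E =
     \int[mu]_y (K (a, y))%:E.
  move=> aI; rewrite -cube_density_fiber//.
  move: (aI); rewrite /= in_itv/= => /andP[a0 a1].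
  rewrite -(IH (al * a)%R (al * m.+1%:R * (1 - a) + be)%R (fun y => G (a * y)%R))//.
  - apply: eq_integral => y _; rewrite cube_weight_cons cube_prod_cons; congr EFin.
    by congr (_ * _)%R; ring.
  - by rewrite mulr_ge0// ltW.
  - by rewrite addr_ge0// !mulr_ge0// subr_ge0 ltW.
  - by apply: measurableT_comp => //; exact: mulrl_measurable.
rewrite integral_itv_bndoo; last first.
  apply: (eq_measurable_fun (fun a => \int[mu]_y (K (a, y))%:E)).
    by move=> a; rewrite inE => aI; rewrite fiber.
  apply: (measurable_funS measurableT) => //.
  exact: (@measurable_fun_fubini_tonelli_F _ _ T T R mu (EFin \o K) mK K0).
transitivity (\int[mu]_(a in I01) \int[mu]_y (K (a, y))%:E).
  by apply: eq_integral => a; rewrite inE; exact: fiber.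
transitivity (\int[mu]_a \int[mu]_y (EFin \o K) (a, y)).
  rewrite [LHS]integral_mkcond; apply: eq_integral => a _; rewrite patchE; case: ifPn => // an.
  apply/esym; apply: integral0_eq => y _ /=; rewrite /K /kernel_fun indicE memNset ?mul0r//=.
  move=> [/andP[y0 ya] a1]; move/negP: an; apply; rewrite inE /= in_itv/= a1 andbT.
  exact: lt_trans ya.
(* After the exchange the first coordinate a is integrated out over ]y, 1[ at fixed product y, which
   is [integral_fiber_density]. *)
rewrite (@fubini_tonelli _ _ T T R mu mu (EFin \o K) mK K0) [RHS]integral_mkcond; apply: eq_integral => y _.
rewrite patchE; case: ifPn => [|yn]; last first.
  apply: integral0_eq => a _ /=; rewrite /K /kernel_fun indicE memNset ?mul0r//=.
  move=> [/andP[y0 ya] a1]; move/negP: yn; apply; rewrite inE /= in_itv/= y0.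
  exact: lt_trans a1.
rewrite inE /= in_itv/= => /andP[y0 y1].
transitivity (\int[mu]_(a in `]y, 1%R[) (G y * fiber_density m.+1 al be a y)%:E).
  rewrite [RHS]integral_mkcond; apply: eq_integral => a _; rewrite patchE /K /kernel_fun /= indicE.
  case: ifPn => [|an].
    by rewrite inE /= in_itv/= => /andP[ya a1]; rewrite mem_set ?mul1r//= y0.
  rewrite memNset ?mul0r//= => -[/andP[_ ya] a1]; move/negP: an; apply.
  by rewrite inE /= in_itv/= ya.
under eq_integral do rewrite EFinM.
rewrite ge0_integralZl//; last 3 first.
- apply/measurable_EFinP; apply: (measurable_funS measurableT) => //.
  exact: (measurableT_comp (measurable_fiber_density m.+1 al be) (pair2_measurable y)).
- by move=> a /=; rewrite in_itv/= => /andP[ya a1]; rewrite lee_fin fiber_density_ge0// ltW.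
- by rewrite lee_fin.
by rewrite integral_fiber_density// -EFinM.
Qed.

End cube_density.

(** * From the cube to the half-line *)

Section cube_reduction.
Context {R : realType}.
Local Notation T := (measurableTypeR R).
Local Notation C := R[i].
Local Notation mu := (@lebesgue_measure R).
Local Notation I01 := (`]0%R, 1%R[%classic : set T).
Local Notation pos := (`]0%R, +oo[%classic : set T).

(** The image of [exhaust n] under t -> exp (- t). *)
Definition exhaust01 (n : nat) : set T := `[expR (- n.+2%:R), expR (- (n.+2%:R)^-1)]%classic.

Lemma exhaust01E n y : exhaust01 n y <-> 0 < y /\ exhaust n (- ln y).
Proof.
rewrite /exhaust01 /exhaust /= !in_itv/=; split=> [/andP[h1 h2]|[y0 /andP[h1 h2]]].
  have y0 : 0 < y by apply: lt_le_trans h1; exact: expR_gt0.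
  have l1 : - n.+2%:R <= ln y by rewrite -[leLHS]expRK ler_ln ?posrE ?expR_gt0.
  have l2 : ln y <= - (n.+2%:R)^-1 by rewrite -[leRHS]expRK ler_ln ?posrE ?expR_gt0.
  by split => //; apply/andP; split; [rewrite lerNr|rewrite lerNl].
by rewrite -[y]lnK ?posrE// !ler_expR lerNl lerNr h1 h2.
Qed.

Lemma bigcup_exhaust01 : \bigcup_n exhaust01 n = I01.
Proof.
apply/seteqP; split=> y.
  move=> [n _ /exhaust01E[y0 /exhaust_pos h]]; rewrite /= in_itv/= y0 /=.
  by rewrite -ltr_ln ?posrE// ln1 -oppr_gt0.
rewrite /= in_itv/= => /andP[y0 y1].
have : (\bigcup_n exhaust n) (- ln y) by rewrite bigcup_exhaust /= in_itv/= andbT oppr_gt0 ln_lt0// y0.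
by move=> [n _ h]; exists n => //; apply/exhaust01E.
Qed.

Lemma nondecreasing_exhaust01 : nondecreasing_seq exhaust01.
Proof.
move=> n k nk; apply/subsetPset => y /exhaust01E[y0 h]; apply/exhaust01E; split => //.
by have /subsetPset := @nondecreasing_exhaust R _ _ nk; exact.
Qed.

Lemma der_expRN (t : R) : der (fun t => expR (- t)) t (- expR (- t)).
Proof. by apply: (der_eq (der_expR (derN (der_id t)))); rewrite mulrN1. Qed.

Lemma continuous_der (f : R -> R) t a : der f t a -> {for t, continuous f}.
Proof. by move=> /der_derivable df; apply: differentiable_continuous; exact/derivable1_diffP. Qed.

(** The substitution is made on compact intervals; since f is nonnegative, monotone convergence
    passes to the limit on both sides, infinite values included. *)
Lemma ge0_integral_expRN (f : R -> R) :
  (forall y, 0 < y < 1 -> 0 <= f y) -> (forall y, 0 < y < 1 -> {for y, continuous f}) ->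
  (\int[mu]_(y in I01) (f y)%:E = \int[mu]_(t in pos) (f (expR (- t)) * expR (- t))%:E)%E.
Proof.
move=> f0 cf.
have dF : derive1 (fun t : R => expR (- t)) = fun t => - expR (- t).
  by apply/funext => t; rewrite derive1E; have [_ ->] := der_expRN t.
have ex01 n y : exhaust01 n y -> 0 < y < 1.
  by move=> h; have : (\bigcup_n exhaust01 n) y by [exists n]; rewrite bigcup_exhaust01 /= in_itv.
have pos01 (t : R) : 0 < t -> 0 < expR (- t) < 1.
  by move=> t0; rewrite expR_gt0 -expR0 ltr_expR oppr_lt0.
have cdF t : {for t, continuous (fun t : R => - expR (- t))}.
  exact: continuous_der (derN (der_expRN t)).
have E n : (\int[mu]_(y in exhaust01 n) (f y)%:E =
    \int[mu]_(t in exhaust n) (f (expR (- t)) * expR (- t))%:E)%E.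
  rewrite /exhaust01 (@integration_by_substitution_decreasing _ (fun t => expR (- t)) f (n.+2%:R)^-1 n.+2%:R).
  - by apply: eq_integral => t _; rewrite dF /= opprK.
  - exact/ltW/exhaust_lt.
  - by move=> x y _ _; rewrite ltr_expR ltrN2.
  - by rewrite dF => x _; exact: cdF.
  - by rewrite dF; apply/cvg_ex; eexists; apply: cvg_at_right_filter; exact: cdF.
  - by rewrite dF; apply/cvg_ex; eexists; apply: cvg_at_left_filter; exact: cdF.
  - split.
    + by move=> t _; exact: der_derivable (der_expRN t).
    + by apply: cvg_at_right_filter; exact: continuous_der (der_expRN _).
    + by apply: cvg_at_left_filter; exact: continuous_der (der_expRN _).
  - by apply: continuous_in_subspaceT => y; rewrite inE => /(ex01 n); exact: cf.
have mf : measurable_fun I01 (EFin \o f).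
  apply/measurable_EFinP; apply: open_continuous_measurable_fun; first exact: interval_open.
  by move=> y; rewrite inE /= in_itv/=; exact: cf.
have mg : measurable_fun pos (EFin \o (fun t => f (expR (- t)) * expR (- t))).
  apply/measurable_EFinP; apply: open_continuous_measurable_fun; first exact: interval_open.
  move=> t; rewrite inE /= in_itv/= andbT => t0.
  have ce := continuous_der (der_expRN t).
  apply: (continuousM _ ce); apply: continuous_comp; first exact: ce.
  by apply: cf; exact: pos01.
have c1 := @ge0_nondecreasing_set_cvg_integral _ T R exhaust01 (EFin \o f) mu nondecreasing_exhaust01.
have c2 := @ge0_nondecreasing_set_cvg_integral _ T R exhaust
  (EFin \o (fun t => f (expR (- t)) * expR (- t))) mu (@nondecreasing_exhaust R).
rewrite bigcup_exhaust01 in c1; rewrite bigcup_exhaust in c2.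
have C1 : (\int[mu]_(y in exhaust01 n) (EFin \o f) y)%E @[n --> \oo] --> (\int[mu]_(y in I01) (EFin \o f) y)%E.
  apply: c1.
  - by move=> i; exact: measurable_itv.
  - by move=> i; apply: measurable_funS mf => // y /(ex01 i); rewrite /= in_itv.
  - by move=> i y /(ex01 i); rewrite lee_fin; exact: f0.
pose k (t : T) : R := f (expR (- t)) * expR (- t).
have C2 : (\int[mu]_(y in exhaust01 n) (EFin \o f) y)%E @[n --> \oo] -->
    (\int[mu]_(t in pos) (EFin \o k) t)%E.
  rewrite (_ : (fun n => _) = fun n => (\int[mu]_(t in exhaust n) (EFin \o k) t)%E); last first.
    by apply/funext => n; exact: E.
  apply: c2.
  - by move=> i; exact: measurable_itv.
  - by move=> i; apply: measurable_funS mg => // t /exhaust_pos; rewrite /= in_itv/= andbT.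
  - move=> i t /exhaust_pos t0; rewrite lee_fin mulr_ge0 ?expR_ge0//.
    by apply: f0; exact: pos01.
exact: cvg_unique C1 C2.
Qed.

Lemma weight_density_expRN m (t : R) : (1 < m)%N ->
  weight_density m (- ln (expR (- t))) (expR (- t)) = log_density m.-1 t * ramp t.
Proof.
case: m => // -[//|m] _; rewrite expRK opprK /weight_density /ramp -[m.+2%:R]natr1 addrK -log_density_mul /=.
by ring.
Qed.

Section one_function.
Variables (m : nat) (g gh : R -> R).
Hypotheses (m1 : (1 < m)%N) (mg : measurable_fun [set: T] g)
  (ggh : forall y, 0 < y < 1 -> g y = gh y)
  (dgh : forall y, 0 < y < 1 -> derivable gh y 1).

(** [g] is the function to be integrated, measurable on the whole line; [gh] is a formula for it on
    ]0, 1[ that can be differentiated there. *)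
Definition halfline_kernel (t : R) : R := gh (expR (- t)) * (log_density m.-1 t * ramp t * expR (- t)).

(** Positive homogeneity lets the nonnegative weight and densities pass through [phi], so the
    density formula for nonnegative functions applies to |x| and to |x| - x, and thereby to signed
    integrands. *)
Lemma integral_cube_phi (phi : R -> R) : continuous phi -> (forall x, 0 <= phi x) ->
  (forall c x, 0 <= c -> phi (x * c) = phi x * c) ->
  (\int[lebesgue_tuple m]_(x in unit_cube m) (phi (g (cube_prod x) * cube_weight x))%:E =
   \int[mu]_(t in pos) (phi (halfline_kernel t))%:E)%E.
Proof.
move=> cphi phi0 phiM; have m0 : (0 < m)%N by exact: ltnW.
have mphi : measurable_fun [set: T] (phi \o g).
  by apply: measurableT_comp => //; exact: continuous_measurable_fun.
transitivity (\int[lebesgue_tuple m]_(x in unit_cube m) ((1 * cube_weight x + 0) * (phi \o g) (cube_prod x))%:E)%E.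
  apply: eq_integral => x; rewrite inE => cx.
  have w0 k (y : k.-tuple T) : (0 < k)%N -> unit_cube k y -> 0 <= cube_weight y.
    by case: k y => // k y _; exact: cube_weight_ge0.
  by rewrite (phiM _ _ (w0 _ _ m0 cx)) mul1r addr0 [cube_weight x * _]mulrC.
rewrite (cube_density m0 ler01 (lexx 0) mphi); last by move=> x; exact: phi0.
transitivity (\int[mu]_(y in I01) ((phi (gh y) * weight_density m (- ln y) y)%:E))%E.
  by apply: eq_integral => y; rewrite inE /= in_itv/= => y01; rewrite mul0r mul1r addr0 ggh.
rewrite ge0_integral_expRN.
- apply: eq_integral => t; rewrite inE /= in_itv/= andbT => t0.
  have h0 : 0 <= log_density m.-1 t * ramp t * expR (- t).
    by rewrite !mulr_ge0 ?expR_ge0 ?ramp_ge0// log_density_ge0// ltW.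
  by rewrite /halfline_kernel (phiM _ _ h0) weight_density_expRN// -(mulrA (phi _)).
- move=> y /andP[y0 y1]; rewrite mulr_ge0// weight_density_ge0// ?oneNln_le//.
  by rewrite oppr_ge0 ltW// ln_lt0// y0.
- move=> y y01; have y0 : 0 < y by case/andP: y01.
  have cg : {for y, continuous gh}.
    by apply: differentiable_continuous; apply/derivable1_diffP; exact: dgh.
  apply: continuousM; first by apply: continuous_comp => //; exact: cphi.
  have dl k : der (fun y => log_density k (- ln y)) y (log_density k.-1 (- ln y) * - y^-1).
    by apply: der_comp; [exact: der_log_density|apply: derN; exact: der_ln].
  apply: continuous_der; apply: derB; first by apply: derZ; exact: dl.
  by apply: derM; [apply: derB; [exact: der_cst|exact: der_id]|exact: dl].
Qed.

Lemma cube_reduction_real : mu.-integrable pos (EFin \o halfline_kernel) ->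
  (lebesgue_tuple m).-integrable (unit_cube m) (EFin \o (fun x => g (cube_prod x) * cube_weight x)) /\
  \int[lebesgue_tuple m]_(x in unit_cube m) (g (cube_prod x) * cube_weight x) =
  \int[mu]_(t in pos) halfline_kernel t.
Proof.
move=> ik; have mcube := @measurable_unit_cube R m.
have mF : measurable_fun (unit_cube m) (fun x : m.-tuple T => g (cube_prod x) * cube_weight x).
  apply: (measurable_funS measurableT) => //; apply: measurable_funM; last exact: measurable_cube_weight.
  by apply: measurableT_comp => //; exact: measurable_cube_prod.
have nE := @integral_cube_phi (fun x => `|x|) (@norm_continuous _ R^o) (@normr_ge0 _ _) _.
have {}nE : (\int[lebesgue_tuple m]_(x in unit_cube m) `|g (cube_prod x) * cube_weight x|%:E =
   \int[mu]_(t in pos) `|halfline_kernel t|%:E)%E.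
  by apply: nE => c x c0; rewrite normrM (ger0_norm c0).
have pE : (\int[lebesgue_tuple m]_(x in unit_cube m) (`|g (cube_prod x) * cube_weight x| - g (cube_prod x) * cube_weight x)%:E =
   \int[mu]_(t in pos) (`|halfline_kernel t| - halfline_kernel t)%:E)%E.
  apply: (@integral_cube_phi (fun x => `|x| - x)).
  - by move=> x; apply: continuousB; [exact: (@norm_continuous _ R^o)|exact: cvg_id].
  - by move=> x; rewrite subr_ge0 ler_norm.
  - by move=> c x c0; rewrite normrM (ger0_norm c0) mulrBl.
have iF : (lebesgue_tuple m).-integrable (unit_cube m) (EFin \o (fun x => g (cube_prod x) * cube_weight x)).
  apply/integrableP; split; first exact/measurable_EFinP.
  rewrite [ltLHS](_ : _ = \int[mu]_(t in pos) `|halfline_kernel t|%:E)%E; last exact: nE.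
  by have /integrableP[] := ik.
split => //.
have iFn := integrable_norm iF; have ikn := integrable_norm ik.
(* Both pieces are nonnegative and their integrals are already transferred by [nE] and [pE]. *)
have sub (x : R) : x = `|x| - (`|x| - x) by rewrite opprB addrC subrK.
have iFd : (lebesgue_tuple m).-integrable (unit_cube m)
    (EFin \o (fun x => `|g (cube_prod x) * cube_weight x| - g (cube_prod x) * cube_weight x)).
  by apply: eq_integrable (integrableB mcube iFn iF) => // x _ /=; rewrite EFinB.
have ikd : mu.-integrable pos (EFin \o (fun t => `|halfline_kernel t| - halfline_kernel t)).
  by apply: eq_integrable (integrableB (@measurable_pos R) ikn ik) => // x _ /=; rewrite EFinB.
under eq_Rintegral do rewrite (sub (g _ * _)).
under [RHS]eq_Rintegral do rewrite (sub (halfline_kernel _)).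
rewrite (RintegralB mcube iFn iFd) (RintegralB (@measurable_pos R) ikn ikd).
by congr (fine _ - fine _); [exact: nE|exact: pE].
Qed.

End one_function.

End cube_reduction.

(** * The integrand of the theorem on the half-line *)

Section integrand_reduction.
Context {R : realType}.
Local Notation T := (measurableTypeR R).
Local Notation C := R[i].
Local Notation mu := (@lebesgue_measure R).
Local Notation pos := (`]0%R, +oo[%classic : set T).

(** Covers the whole line for the sake of measurability. At y = 0 the division 0 / 0 is 0, so the
    argument takes the default value [acos 0]. *)
Lemma carg_real (y : R) : carg y%:C = \1_[set x : R | x < 0] y * pi + \1_[set 0] y * acos 0.
Proof.
rewrite /carg lexx Re_norm normc_real /= !indicE.
have [y0|y0|->] := ltgtP y 0.
- rewrite mem_set// memNset ?mul0r ?addr0 ?mul1r; last by move=> /= E; rewrite E ltxx in y0.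
  by rewrite ltr0_norm// invrN mulrN divff ?acosN1// lt_eqF.
- rewrite memNset ?mul0r ?add0r; last by move=> /=; rewrite ltNge (ltW y0).
  rewrite memNset ?mul0r; last by move=> /= E; rewrite E ltxx in y0.
  by rewrite gtr0_norm// divff ?acos1// gt_eqF.
- rewrite memNset ?mul0r ?add0r; last by rewrite /= ltxx.
  by rewrite mem_set ?mul1r// mul0r.
Qed.

Lemma cmeas_clog : cmeas [set: T] (fun y => clog y%:C).
Proof.
split.
  rewrite (_ : (fun y => _) = fun y : T => ln `|y|); last first.
    by apply/funext => y; rewrite /clog /= -[X in ln X]/(Re `|y%:C|) Re_norm normc_real.
  by apply: (measurableT_comp (@measurable_ln R)); exact: normr_measurable.
rewrite (_ : (fun y => _) = fun y : T => \1_[set x : R | x < 0] y * pi + \1_[set 0] y * acos 0); last first.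
  by apply/funext => y; rewrite /clog /= carg_real.
apply: measurable_funD; apply: measurable_funM; try exact: measurable_cst.
  apply: measurable_indic; rewrite (_ : [set x | _] = `]-oo, 0[%classic); first exact: measurable_itv.
  by apply/seteqP; split => x /=; rewrite in_itv.
by apply: measurable_indic; exact: measurable_set1.
Qed.

Lemma cmeas_cpow (w : C) : cmeas [set: T] (fun y => cpow y%:C w).
Proof. by apply: cmeas_cexp; apply: cmeasM; [exact: cmeas_cst|exact: cmeas_clog]. Qed.

Definition prod_kernel (u z s : C) (y : T) : C :=
  (1 - z * y%:C)^-1 * cpow y%:C (u - 1) * cpow (- ln y)%:C s.

Lemma cmeas_prod_kernel (u z s : C) : cmeas [set: T] (prod_kernel u z s).
Proof.
apply: cmeasM; last first.
  have [hr hi] := cmeas_cpow s.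
  have ml : measurable_fun [set: T] (fun y : T => - ln y : T).
    by apply: measurable_funN; exact: measurable_ln.
  by split; [exact: (measurableT_comp hr ml)|exact: (measurableT_comp hi ml)].
apply: cmeasM (cmeas_cpow _); apply: cmeasV; apply: cmeasB; first exact: cmeas_cst.
by apply: cmeasM; [exact: cmeas_cst|apply: cmeas_real; exact: measurable_id].
Qed.

Lemma integrandE m (u z s : C) (x : m.-tuple T) :
  integrand m u z s x = prod_kernel u z s (cube_prod x) * (cube_weight x)%:C.
Proof. by rewrite /integrand /prod_kernel -/(cube_prod x) -/(cube_weight x); ring. Qed.

Lemma cderV (f : R -> C) t l : f t != 0 -> cder f t l -> exists k, cder (fun x => (f x)^-1) t k.
Proof.
move=> f0 [fr fi].
have nz : Re (f t) * Re (f t) + Im (f t) * Im (f t) != 0.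
  by rewrite -!expr2 -normc_sqr expf_neq0// normc_eq0.
have I (z : C) : z^-1 = (Re z * (Re z * Re z + Im z * Im z)^-1) +i*
    (- (Im z * (Re z * Re z + Im z * Im z)^-1)).
  by case: z => a b /=; rewrite -!expr2.
have dn := @derV _ (fun x => Re (f x) * Re (f x) + Im (f x) * Im (f x)) _ _ nz
  (derD (derM fr fr) (derM fi fi)).
have dr := derM fr dn; have di := derN (derM fi dn).
eexists (_ +i* _); split => /=.
  by under [X in der X]eq_fun do rewrite I /=; exact: dr.
by under [X in der X]eq_fun do rewrite I /=; exact: di.
Qed.

Definition prod_kernel_smooth (u z s : C) (y : R) : C :=
  (1 - z * y%:C)^-1 * tpow (u - 1) y * tpow s (- ln y).

Lemma prod_kernelE (u z s : C) y : 0 < y < 1 ->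
  prod_kernel u z s y = prod_kernel_smooth u z s y.
Proof.
move=> /andP[y0 y1]; rewrite /prod_kernel /prod_kernel_smooth !cpow_real//.
by rewrite oppr_gt0 ln_lt0// y0.
Qed.

Lemma cder_prod_kernel_smooth (u z s : C) y : 0 < y < 1 -> 1 - z * y%:C != 0 ->
  exists l, cder (prod_kernel_smooth u z s) y l.
Proof.
move=> /andP[y0 y1] nz; have l0 : 0 < - ln y by rewrite oppr_gt0 ln_lt0// y0.
have d1 : cder (fun y => 1 - z * y%:C) y (0 + (-1) * (z * 1%:C)).
  apply: cderD; first exact: cder_cst.
  under [X in cder X]eq_fun do rewrite -mulN1r.
  by apply: cderZ; apply: cderZ; apply: cder_real; exact: der_id.
have [k dk] := cderV nz d1.
eexists; apply: cderM; first by apply: cderM; [exact: dk|exact: cder_tpow].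
apply: cder_cexp; apply: cderZ; apply: cder_real.
by apply: der_comp; [exact: der_ln|apply: derN; exact: der_ln].
Qed.

Lemma exp_mul_tpow (u : C) (t : R) : tpow (u - 1) (expR (- t)) * (expR (- t))%:C = cdecay u t.
Proof.
rewrite /tpow expRK /cdecay -cexp_real -cexpD; congr cexp.
by rewrite !RealCN; ring.
Qed.

Lemma tpow_nat n (t : R) : 0 < t -> tpow n%:R t = (t ^+ n)%:C.
Proof.
move=> t0; elim: n => [|n IH]; first by rewrite /tpow mul0r cexp0.
by rewrite -natr1 tpowD tpow1// IH -RealCM exprSr.
Qed.

(** The density contributes t ^ (m - 2) / (m - 2)!, which shifts the exponent s, and the Jacobian
    exp (- t) turns the exponent u - 1 into u. *)
Lemma halfline_kernelE m (u z s : C) (t : R) : (1 < m)%N -> 0 < t ->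
  prod_kernel_smooth u z s (expR (- t)) * (log_density m.-1 t * ramp t * expR (- t))%:C =
  ((m - 2)`!%:R)^-1 * (tpow (s + m%:R - 2) t * lerch_weight u z t).
Proof.
case: m => [//|[//|m]] _ t0; rewrite /prod_kernel_smooth expRK opprK subn2 /=.
have -> : s + m.+2%:R - 2 = s + m%:R by rewrite -addn2 natrD addrA addrK.
rewrite (tpowD s) tpow_nat// /lerch_weight /num_weight -exp_mul_tpow.
by rewrite !RealCM RealCV -natC; ring.
Qed.

Definition lerch_domain (z s : C) : Prop :=
  (cut_plane z /\ -1 < Re s) \/ (z = 1 /\ 0 < Re s).

Lemma lerch_integrable (u z s : C) : 0 < Re u -> lerch_domain z s ->
  cintegrable mu pos (fun t => tpow (s - 2) t * lerch_weight u z t).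
Proof.
move=> u0 [[cz s1]|[-> s0]].
  by apply: mellin_integrable (lerch_weight_cut u0 cz) _; rewrite !cReE /=; lra.
by apply: mellin_integrable (lerch_weight_1 u0) _; rewrite !cReE /=; lra.
Qed.

Lemma cintegral_cube m (u z s : C) : (1 < m)%N -> 0 < Re u -> lerch_domain z (s + m%:R) ->
  cintegrable (lebesgue_tuple m) (unit_cube m) (integrand m u z s) /\
  cintegral (lebesgue_tuple m) (unit_cube m) (integrand m u z s) =
  ((m - 2)`!%:R)^-1 * lerch_integral u z (s + m%:R).
Proof.
move=> m1 u0 dom.
have nz y : 0 < y < 1 -> 1 - z * y%:C != 0.
  move=> /andP[y0 y1]; case: dom => [[/cut_plane_dist[e e0 He] _]|[-> _]].
    have y01 : 0 <= y <= 1 by rewrite !ltW.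
    by rewrite -normc_gt0; exact: lt_le_trans (He _ y01).
  by rewrite mul1r -RealCN -RealCD -normc_eq0 normc_real normr_eq0 gt_eqF// subr_gt0.
pose gh := prod_kernel_smooth u z s.
pose k t := gh (expR (- t)) * (log_density m.-1 t * ramp t * expR (- t))%:C.
have kE t : pos t -> k t = ((m - 2)`!%:R)^-1 * (tpow (s + m%:R - 2) t * lerch_weight u z t).
  by move=> /pos_gt0 t0; exact: halfline_kernelE.
have iJ := lerch_integrable u0 dom.
have [ir ii] : cintegrable mu pos k.
  apply: eq_cintegrable (cintegrableZ (@measurable_pos R) ((m - 2)`!%:R)^-1 iJ); first exact: measurable_pos.
  by move=> t; rewrite inE => /kE ->.
have [mr mi] := cmeas_prod_kernel u z s.
have krE t : halfline_kernel m (fun y => Re (gh y)) t = Re (k t).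
  by rewrite /halfline_kernel /k ReM /= mulr0 subr0.
have kiE t : halfline_kernel m (fun y => Im (gh y)) t = Im (k t).
  by rewrite /halfline_kernel /k ImM /= mulr0 add0r.
have [|||iR eR] := @cube_reduction_real _ m (fun y => Re (prod_kernel u z s y)) (fun y => Re (gh y)) m1 mr _ _ _.
- by move=> y y01; rewrite prod_kernelE.
- by move=> y y01; have [l [dr _]] := cder_prod_kernel_smooth u s y01 (nz _ y01); exact: der_derivable dr.
- by rewrite (_ : halfline_kernel _ _ = fun t => Re (k t)) //; apply/funext.
have [|||iI eI] := @cube_reduction_real _ m (fun y => Im (prod_kernel u z s y)) (fun y => Im (gh y)) m1 mi _ _ _.
- by move=> y y01; rewrite prod_kernelE.
- by move=> y y01; have [l [_ di]] := cder_prod_kernel_smooth u s y01 (nz _ y01); exact: der_derivable di.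
- by rewrite (_ : halfline_kernel _ _ = fun t => Im (k t)) //; apply/funext.
have rE (x : m.-tuple T) : Re (integrand m u z s x) = Re (prod_kernel u z s (cube_prod x)) * cube_weight x.
  by rewrite integrandE ReM /= mulr0 subr0.
have iE (x : m.-tuple T) : Im (integrand m u z s x) = Im (prod_kernel u z s (cube_prod x)) * cube_weight x.
  by rewrite integrandE ImM /= mulr0 add0r.
split.
  by split; [under eq_fun do rewrite rE|under eq_fun do rewrite iE].
rewrite /lerch_integral /mellin -(cintegralZ (@measurable_pos R) _ iJ).
rewrite -(@eq_cintegral _ _ _ mu pos k); last by move=> t; rewrite inE => /kE.
rewrite /cintegral; congr (_ +i* _).
  under eq_Rintegral do rewrite rE; rewrite eR.
  by apply: eq_Rintegral => t _; exact: krE.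
under eq_Rintegral do rewrite iE; rewrite eI.
by apply: eq_Rintegral => t _; exact: kiE.
Qed.

End integrand_reduction.

(** * Continuation to the removable singularities *)

Section right_hand_side.
Context {R : realType}.
Local Notation C := R[i].
Local Notation mu := (@lebesgue_measure R).
Local Notation pos := (`]0%R, +oo[%classic : set (measurableTypeR R)).

Lemma gamma_integral_cpow (w : C) : cintegral mu pos
  (fun t => cpow t%:C (w - 1) * (expR (- t))%:C) = gamma_integral w.
Proof.
rewrite /gamma_integral /mellin; apply: eq_cintegral => t; rewrite inE => /pos_gt0 t0.
by rewrite cpow_real// /cdecay mul1r -(RealCN t) cexp_real.
Qed.

(** The shift chosen by [cGamma] is 0 for 0 < Re w and 1 for -1 < Re w <= 0; the recurrence brings
    the first case to the form of the second. *)
Lemma cGammaE (w : C) : -1 < Re w -> w != 0 -> cGamma w = gamma_integral (w + 1) / w.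
Proof.
move=> w1 w0; rewrite /cGamma gamma_integral_cpow.
have [r0|r0] := ltP 0 (Re w).
  have -> : Num.truncn (1 - Re w) = 0%N by apply/truncn0Pn; rewrite -ltNge; lra.
  by rewrite big_ord0 addr0 divr1 gamma_integral_rec// mulrC mulKf.
have -> : Num.truncn (1 - Re w) = 1%N by apply: truncn_def; lra.
by rewrite big_ord1 addr0.
Qed.

Lemma near_punctured (a : C) (P : C -> Prop) (e : R) : 0 < e ->
  (forall x, normc (x - a) < e -> x != a -> P x) -> \forall x \near (a : C^o)^', P x.
Proof.
move=> e0 H; rewrite near_withinE; apply/nbhsC_P.
by exists e => // x xe; exact: H.
Qed.

Lemma analytic_at_punctured (f g : C -> C) (a : C) (e : R) : 0 < e ->
  (forall x, normc (x - a) < e -> x != a -> g x = f x) -> analytic_at f a ->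
  (g x : C^o) @[x --> (a : C^o)^'] --> (f a : C^o).
Proof.
move=> e0 H fa.
apply: (@cvg_trans _ ((fun x : C^o => f x : C^o) x @[x --> (a : C^o)^'])).
  by apply: near_eq_cvg; apply: near_punctured e0 _ => x xe xa; rewrite H.
by apply: cvg_within_filter; exact: analytic_at_continuous.
Qed.

Lemma lerch_domain_open (z s : C) : lerch_domain z s ->
  exists2 e : R, 0 < e & forall s', normc (s' - s) < e -> lerch_domain z s'.
Proof.
have H (a : R) : a < Re s -> exists2 e : R, 0 < e & forall s', normc (s' - s) < e -> a < Re s'.
  move=> h; exists (Re s - a); first by rewrite subr_gt0.
  move=> s' h'; have := le_lt_trans (Re_le_normc _) h'.
  by rewrite !cReE ltr_norml => /andP[h1 _]; lra.
by case=> -[hz /H[e e0 He]]; exists e => // s' /He h; [left|right].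
Qed.

Variables (Phi : C -> C -> C -> C) (hPhi : is_lerch Phi) (u : C) (u0 : 0 < Re u).
Variable m : nat.

Let J (z s : C) : C := ((m - 2)`!%:R)^-1 * lerch_integral u z (s + m%:R).

(** With w = s + m, the cleared identity is divided by z w (w - 1), nonzero under the three
    exclusions; the factor 1 / w is the one in [cGammaE]. *)
Lemma rhs_exprE (z s : C) : lerch_domain z (s + m%:R) -> z != 0 ->
  s != - m%:R -> s != 1 - m%:R -> rhs_expr Phi m u z s = J z s.
Proof.
move=> dom z0 s0 s1; rewrite /rhs_expr /J.
have -> : - s - m%:R + 1 = 1 - (s + m%:R) by ring.
move: dom; have : s + m%:R != 0 by rewrite addr_eq0.
have : s + m%:R != 1 by rewrite -subr_eq0 -addrA addr_eq0 opprB.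
move: (s + m%:R) => w w1 w0 dom.
have rw : -1 < Re w by case: dom => -[_ //]; lra.
have E : z * (w * (w - 1)) * lerch_integral u z w =
    gamma_integral (w + 1) * (z * (w - 1) * Phi z w u + (1 - z) * Phi z (w - 1) u - cpow u (1 - w)).
  case: dom => [[cz _]|[-> rw0]]; first exact: lerch_formula_cut.
  by rewrite !mul1r (lerch_formula_1 hPhi u0)// subrr mul0r addr0.
rewrite (cGammaE rw w0).
have d : z * (w * (w - 1)) != 0 by rewrite !mulf_neq0// subr_eq0.
have -> : lerch_integral u z w = (z * (w * (w - 1)))^-1 * (z * (w * (w - 1)) * lerch_integral u z w).
  by rewrite mulKf.
rewrite {}E invfM; move: (gamma_integral _) (Phi _ _ _) (Phi _ _ _) (cpow _ _) => g p q c.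
move: (((m - 2)`!%:R)^-1) => k; have w1' : w - 1 != 0 by rewrite subr_eq0.
by field; rewrite z0 w0 w1'.
Qed.

Lemma rhs_value_zP (z s : C) : lerch_domain z (s + m%:R) ->
  s != - m%:R -> s != 1 - m%:R -> rhs_value_z Phi m u z s (J z s).
Proof.
move=> dom s0 s1; rewrite /rhs_value_z; case: eqVneq dom => [->|z0] dom; last first.
  by rewrite rhs_exprE.
have rw : -1 < Re (s + m%:R) by case: dom => -[_ //]; lra.
have c0 (x : C) : normc x < 1 -> cut_plane x by exact: cut_plane_disc.
apply: (@analytic_at_punctured (fun z => J z s) _ 0 1) => //.
  move=> x; rewrite subr0 => /c0 cx x0; apply: rhs_exprE => //; by left.
apply: analytic_atM; first exact: analytic_at_cst.
by apply: lerch_integral_analytic_z => //; apply: c0; rewrite normc0.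
Qed.

Lemma rhs_valueP (z s : C) : lerch_domain z (s + m%:R) ->
  rhs_value Phi m u z s (J z s).
Proof.
move=> dom; rewrite /rhs_value; case: ifPn => [ss|]; last first.
  by rewrite negb_or => /andP[? ?]; exact: rhs_value_zP.
have [e e0 He] := lerch_domain_open dom; exists (J z).
  (* The exceptional values - m and 1 - m are at distance 1, so a punctured disc of radius 1 about
     one avoids the other; [e] keeps it inside the domain. The function [J z] itself is the witness,
     and its continuity gives the limit. *)
  apply: (@near_punctured s _ (Num.min e 1)); first by rewrite lt_min e0/=.
  move=> x; rewrite lt_min => /andP[xe x1] xs.
  have d : lerch_domain z (x + m%:R).
    by apply: He; rewrite (_ : _ - _ = x - s)//; ring.
  have far (k : C) : s != k -> normc (k - s) = 1 -> x != k.
    by move=> _ h; apply: contraTneq x1 => ->; rewrite h ltxx.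
  have n01 : (- m%:R : C) != 1 - m%:R.
    by rewrite eq_sym -subr_eq0 opprK subrK oner_eq0.
  case/orP: ss => /eqP sE; rewrite sE in xs far; apply: rhs_value_zP => //; apply: far => //.
  - by rewrite eq_sym.
  - by rewrite opprB addKr normc_opp normc1.
  - by rewrite opprK subrK normc1.
apply: (@analytic_at_punctured (J z) _ s 1) => //.
apply: analytic_atM; first exact: analytic_at_cst.
apply: (@analytic_at_shift _ (lerch_integral u z)); exact: lerch_integral_analytic_s.
Qed.

End right_hand_side.

Theorem theorem4 (R : realType) (Phi : R[i] -> R[i] -> R[i] -> R[i])
  (hPhi : is_lerch Phi) (m : nat) (hm : (1 < m)%N) (u z s : R[i])
  (hu : 0 < complex.Re u)
  (hzs : (cut_plane z /\ - m%:R - 1 < complex.Re s) \/ (z = 1 /\ - m%:R < complex.Re s)) :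
  cintegrable (lebesgue_tuple m) (unit_cube m) (integrand m u z s) /\
  rhs_value Phi m u z s
    (cintegral (lebesgue_tuple m) (unit_cube m) (integrand m u z s)).
Proof.
have dom : lerch_domain z (s + m%:R).
  by case: hzs => -[hz hs]; [left|right]; split => //; rewrite ReD Re_nat; lra.
have [int ->] := cintegral_cube hm hu dom.
by split => //; exact: rhs_valueP.
Qed.
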